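(* Let $n\ge 1$, $a\in(-\infty,1)$ and let $u\in H^{1,a}(B_1)$ be an energy solution, odd in $y$, of $$-\mathrm{div}\left(|y|^a\nabla u\right)=|y|^a f\qquad\text{in }B_1 .$$ Then for any $0<r<1$ the ratio $w=\dfrac{u}{y|y|^{-a}}$ belongs to $H^{1,2-a}(B_r)$, and it is an energy solution, even in $y$, of $$-\mathrm{div}\left(|y|^{2-a}\nabla w\right)=|y|^{2-a}\bar f,\qquad \bar f=\frac{f}{y|y|^{-a}},\qquad\text{in }B_r .$$
   Context: Points of $\mathbb{R}^{n+1}$ are written $z=(x,y)$, $x\in\mathbb{R}^n$, $y\in\mathbb{R}$; $B_r$ is the ball of radius $r$ centered at $0$ in $\mathbb{R}^{n+1}$; $\Sigma=\{y=0\}$. For $b\in\mathbb{R}$ and $\Omega$ open bounded, $H^{1,b}(\Omega)$ is the closure of the set of functions in $C^\infty(\overline\Omega)$ with finite norm, with respect to the norm $\left(\int_\Omega|y|^b u^2+\int_\Omega |y|^b|\nabla u|^2\right)^{1/2}$. An energy solution in $B_r$ of $-\mathrm{div}(|y|^b\nabla u)=|y|^b g$ is a function $u\in H^{1,b}(B_r)$ such that $\int_{B_r}|y|^b\nabla u\cdot\nabla\phi=\int_{B_r}|y|^b g\phi$ for all $\phi\in C^\infty_c(B_r)\cap H^{1,b}(B_r)$. Standing integrability assumption on $f$ (so that the notion of energy solution for $u$ makes sense). If $a\in(-1,1)$, put $a^+=\max\{a,0\}$: if $n\geq 2$, or $n=1$ and $a^+>0$, then $f\in L^p(B_1,|y|^a\,dz)$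 with $p\ge \frac{2(n+1+a^+)}{n+a^++3}$; if $n=1$ and $a^+=0$ then $f\in L^p(B_1,|y|^a\,dz)$ with $p>1$. If $a\le -1$: $|y|^{a/2}f\in L^p(B_1)$ with $p\ge \frac{2(n+1)}{n+3}$ if $n\ge2$, and $p>1$ if $n=1$. *)

(* Defs.v *)
From HB Require Import structures.
From mathcomp Require Import all_boot all_order all_algebra.
From mathcomp Require Import all_classical all_reals all_analysis.
From mathcomp Require Import measurable_realfun.

Set Implicit Arguments.
Unset Strict Implicit.
Unset Printing Implicit Defensive.

Import Order.TTheory GRing.Theory Num.Theory.
Import numFieldNormedType.Exports.

Local Open Scope classical_set_scope.
Local Open Scope ring_scope.

Definition rV_display : measure_display. Proof. exact: default_measure_display. Qed.

Section measurable_rV.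
Context {R : realType} (n : nat).

Let coords : 'I_n -> 'rV[R]_n -> measurableTypeR R := fun i z => z ord0 i.

Let rV_set0 : g_sigma_preimage coords set0.
Proof. exact: sigma_algebra0. Qed.

Let rV_setC A : g_sigma_preimage coords A -> g_sigma_preimage coords (~` A).
Proof. exact: sigma_algebraC. Qed.

Let rV_bigcup (F : _^nat) : (forall i, g_sigma_preimage coords (F i)) ->
  g_sigma_preimage coords (\bigcup_i (F i)).
Proof. exact: sigma_algebra_bigcup. Qed.

(* The sigma-algebra generated by the coordinates, i.e. the Borel one. *)
HB.instance Definition _ := @isMeasurable.Build rV_display 'rV[R]_n
  (g_sigma_preimage coords) rV_set0 rV_setC rV_bigcup.

Lemma measurable_coord (i : 'I_n) :
  measurable_fun [set: 'rV[R]_n] (fun z => z ord0 i : measurableTypeR R).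
Proof.
move=> _ Y mY; rewrite setTI; apply: sub_sigma_algebra => /=.
rewrite -bigcup_seq/=; exists i => /=; first by rewrite mem_index_enum.
by exists Y => //; rewrite setTI.
Qed.

Lemma measurable_fun_coordP d (T : measurableType d) (f : T -> 'rV[R]_n) :
  (forall i, measurable_fun [set: T]
     (fun x => f x ord0 i : measurableTypeR R)) ->
  measurable_fun [set: T] f.
Proof.
move=> mf _ A mA; rewrite setTI.
suff : g_sigma_preimage (fun i => coords i \o f) `<=` measurable.
  apply; rewrite g_sigma_preimage_comp; exists A => //.
  by rewrite setTI.
apply: smallest_sub; first exact: sigma_algebra_measurable.
move=> B; rewrite -bigcup_seq/= => -[i _ [C mC <-]].
exact: mf.
Qed.

End measurable_rV.

(* The last coordinate of [snoc_rV (x, y)] is [y]. *)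
Definition snoc_rV {R : realType} n (p : 'rV[R]_n * measurableTypeR R) :
    'rV[R]_n.+1 :=
  \row_j (if unlift ord_max j is Some i then p.1 ord0 i else p.2).

Lemma measurable_snoc_rV {R : realType} n :
  measurable_fun setT (@snoc_rV R n).
Proof.
apply: measurable_fun_coordP => j; rewrite /snoc_rV.
under [X in measurable_fun _ X]eq_fun do rewrite mxE.
case: (unlift ord_max j) => [i|]; last exact: measurable_snd.
apply: (measurableT_comp (measurable_coord i)); exact: measurable_fst.
Qed.


Section lebesgue_rV.
Context {R : realType}.

Section snoc.
Variables (n : nat) (m : {measure set 'rV[R]_n -> \bar R}).

Definition lebesgue_snoc : set 'rV[R]_n.+1 -> \bar R :=
  pushforward (m \x lebesgue_measure)%E (@snoc_rV R n).

HB.instance Definition _ := Measure.copy lebesgue_snoc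
  (measure_function_pushforward__canonical__measure_function_Measure
    (m \x lebesgue_measure)%E (@measurable_snoc_rV R n)).

End snoc.

Fixpoint lebesgue_rV n : {measure set 'rV[R]_n -> \bar R} :=
  if n is k.+1 then lebesgue_snoc (lebesgue_rV k)
  else @dirac _ 'rV[R]_0 0 R.

Lemma lebesgue_rV_box n (l h : 'I_n -> R) : (forall i, l i <= h i) ->
  lebesgue_rV n [set z : 'rV[R]_n | forall i, z ord0 i \in `[l i, h i]] =
  (\prod_(i < n) (h i - l i))%:E.
Proof.
have mbox k (l' h' : 'I_k -> R) :
    measurable [set z : 'rV[R]_k | forall i, z ord0 i \in `[l' i, h' i]].
  rewrite (_ : [set z : 'rV[R]_k | _] = \bigcap_(i in [set: 'I_k])
      (fun z : 'rV[R]_k => z ord0 i : measurableTypeR R) @^-1` `[l' i, h' i]%classic).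
    apply: fin_bigcap_measurable => // i _.
    by rewrite -[X in measurable X]setTI; apply: measurable_coord.
  by apply/seteqP; split => z /= zlh i; [move=> _|]; exact: zlh.
elim: n l h => [|n ih] l h lh.
  by rewrite big_ord0 /= diracE mem_set// => -[].
rewrite [LHS]/= /lebesgue_snoc /pushforward.
rewrite (_ : @snoc_rV R n @^-1` _ =
    [set z : 'rV[R]_n | forall i, z ord0 i \in
      `[l (widen_ord (leqnSn n) i), h (widen_ord (leqnSn n) i)]] `*`
    `[l ord_max, h ord_max]%classic); last first.
  have liftE i : lift ord_max i = widen_ord (leqnSn n) i.
    by apply/val_inj; rewrite /= /bump leqNgt ltn_ord.
  apply/seteqP; split => [[x y] /= H|[x y] /= [Hx Hy] i].
    split=> [i|]; last by move: (H ord_max); rewrite mxE unlift_none.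
    by move: (H (lift ord_max i)); rewrite mxE liftK liftE.
  rewrite mxE; case: unliftP => [j ->|->]; last exact: Hy.
  by rewrite liftE; exact: Hx.
rewrite product_measure1E//; last exact: mbox.
rewrite big_ord_recr/= EFinM -ih//; congr (_ * _)%E.
rewrite lebesgue_measure_itv/= lte_fin.
have := lh ord_max; rewrite le_eqVlt => /predU1P[->|lt].
  by rewrite ltxx subrr.
by rewrite lt -EFinD.
Qed.

End lebesgue_rV.

Section points.
Context {R : realType} {n : nat}.
Implicit Types z : 'rV[R]_n.+1.

(* A point of R^(n+1) is z = (x, y) with y the last coordinate. *)
Definition ycoord z : R := z ord0 ord_max.

Definition yflip z : 'rV[R]_n.+1 :=
  \row_j (if j == ord_max then - z ord0 j else z ord0 j).

(* The norm of 'rV[R]_n.+1 as a normed module is the sup norm, hence the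
   explicit Euclidean ball. *)
Definition eball (r : R) : set 'rV[R]_n.+1 :=
  [set z : 'rV[R]_n.+1 | Num.sqrt (\sum_i z ord0 i ^+ 2) < r].

(* The value given by powR on the null set {y = 0} is irrelevant. *)
Definition weight (b : R) z : R := `|ycoord z| `^ b.

Lemma measurable_weight b : measurable_fun setT (weight b).
Proof.
apply: (measurableT_comp (measurable_powR _)).
apply: measurableT_comp => //; exact: measurable_coord.
Qed.

Definition odd_in_y (Om : set 'rV[R]_n.+1) (u : 'rV[R]_n.+1 -> R) :=
  {ae lebesgue_rV n.+1, forall z, Om z -> u (yflip z) = - u z}.

Definition even_in_y (Om : set 'rV[R]_n.+1) (u : 'rV[R]_n.+1 -> R) :=
  {ae lebesgue_rV n.+1, forall z, Om z -> u (yflip z) = u z}.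

End points.

Section weighted_measure.
Context {R : realType} (n : nat) (b : R).

Definition weighted_measure (A : set 'rV[R]_n.+1) : \bar R :=
  (\int[lebesgue_rV n.+1]_(z in A) (weight b z)%:E)%E.

Let weighted_measure0 : weighted_measure set0 = 0%E.
Proof. by rewrite /weighted_measure integral_set0. Qed.

Let weighted_measure_ge0 A : (0 <= weighted_measure A)%E.
Proof. by apply: integral_ge0 => z _; rewrite lee_fin powR_ge0. Qed.

Let weighted_measure_sigma_additive : semi_sigma_additive weighted_measure.
Proof.
move=> F mF tF mUF; rewrite /weighted_measure ge0_integral_bigcup//.
- apply: is_cvg_ereal_nneg_natsum_cond => k _ _; exact: weighted_measure_ge0.
- apply/measurable_EFinP/measurable_funTS; exact: measurable_weight.
- by move=> z _; rewrite lee_fin powR_ge0.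
Qed.

HB.instance Definition _ := isMeasure.Build _ _ _ weighted_measure
  weighted_measure0 weighted_measure_ge0 weighted_measure_sigma_additive.

End weighted_measure.

Section sobolev.
Context {R : realType} {n : nat}.
Implicit Types (Om : set 'rV[R]_n.+1) (u f g phi : 'rV[R]_n.+1 -> R)
  (U : 'I_n.+1 -> 'rV[R]_n.+1 -> R).

Definition partial (i : 'I_n.+1) phi : 'rV[R]_n.+1 -> R :=
  fun z => 'D_(delta_mx ord0 i) phi z.

Definition smooth phi := forall s : seq 'I_n.+1,
  let psi := foldr partial phi s in
  continuous psi /\ forall i z, derivable psi z (delta_mx ord0 i).

Definition gradient phi : 'I_n.+1 -> 'rV[R]_n.+1 -> R :=
  fun i => partial i phi.

Definition H1norm (b : R) Om u U : \bar R :=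
  (((\int[lebesgue_rV n.+1]_(z in Om) (weight b z * u z ^+ 2)%:E) +
    (\int[lebesgue_rV n.+1]_(z in Om)
      (weight b z * \sum_i U i z ^+ 2)%:E)) `^ 2^-1)%E.

(* (u, U) is a limit, in the H^{1,b}(Om) norm, of pairs (phi, nabla phi) with
   phi in C^oo of the closure of Om (a restriction of a smooth function on
   R^(n+1)) of finite norm.  U is then the weak gradient of u off {y = 0}, so
   it is determined by u up to a null set.  Elements of H^{1,b} are classes
   modulo null sets; u and U are Borel representatives. *)
Definition in_H1_with_gradient (b : R) Om u U : Prop :=
  [/\ measurable_fun Om u,
      forall i, measurable_fun Om (U i) &
      forall e : R, 0 < e -> exists phi,
        [/\ smooth phi, (H1norm b Om phi (gradient phi) < +oo)%E &
            (H1norm b Om (fun z => (u z - phi z)%R)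
               (fun i z => (U i z - gradient phi i z)%R) < e%:E)%E]].

Definition in_H1 (b : R) Om u : Prop := exists U, in_H1_with_gradient b Om u U.

Definition smooth_compact_support Om phi : Prop :=
  smooth phi /\ exists K : set 'rV[R]_n.+1,
    [/\ compact K, K `<=` Om & forall z, ~ K z -> phi z = 0].

(* Integrability of the right-hand side is part of the notion: the integral of
   a non-integrable function is a junk value. *)
Definition energy_solution (b : R) Om u g : Prop :=
  exists2 U, in_H1_with_gradient b Om u U &
    forall phi, smooth_compact_support Om phi -> in_H1 b Om phi ->
      (lebesgue_rV n.+1).-integrable Om
        (fun z => (weight b z * g z * phi z)%:E) /\
      (\int[lebesgue_rV n.+1]_(z in Om)
         (weight b z * \sum_i U i z * gradient phi i z)%:E =
       \int[lebesgue_rV n.+1]_(z in Om) (weight b z * g z * phi z)%:E)%E.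

(* f \_ B is f extended by 0 outside B; p = +oo is allowed. *)
Definition standing_integrability (a : R) f : Prop :=
  if -1 < a then
    let ap := Num.max a 0 in
    exists p : \bar R,
      (if (2 <= n)%N || (0 < ap)%R
       then ((2 * (n%:R + 1 + ap)) / (n%:R + ap + 3))%:E <= p
       else 1 < p)%E /\
      f \_ (eball 1) \in Lfun (weighted_measure a) p
  else
    exists p : \bar R,
      (if (2 <= n)%N then ((2 * (n%:R + 1)) / (n%:R + 3))%:E <= p
       else 1 < p)%E /\
      (fun z => weight (a / 2) z * f z) \_ (eball 1) \in
        Lfun (lebesgue_rV n.+1) p.

End sobolev.

(* y |y|^(-a); a quotient by it is 0 on the null set {y = 0}. *)
Definition odd_profile {R : realType} {n : nat} (a : R) (z : 'rV[R]_n.+1) : R :=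
  ycoord z * `|ycoord z| `^ (- a).

(* Main.v *)
Require Import Defs.
From HB Require Import structures.
From mathcomp Require Import all_boot all_order all_algebra.
From mathcomp Require Import all_classical all_reals all_analysis.
From mathcomp Require Import measurable_realfun.
From mathcomp Require Import ring lra.

Set Implicit Arguments.
Unset Strict Implicit.
Unset Printing Implicit Defensive.

Import Order.TTheory GRing.Theory Num.Theory.
Import numFieldNormedType.Exports.

Local Open Scope classical_set_scope.
Local Open Scope ring_scope.

(** Write $B$ for the unit ball and $w = u/(y|y|^{-a})$. The function
$y|y|^{-a}$ is the odd solution of the homogeneous equation that depends on $y$
alone. Off the hyperplane $y = 0$ the statement is a computation, based on
$|y|^{2-a} \nabla w = y \nabla u - (1-a)\, u\, e_y$ and $|y|^{2-a} \bar f = y f$.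
What has to be shown is that the hyperplane, where the weight and the profile
degenerate, does no harm.

Membership in $H^{1,2-a}$. The second term of $|y|^{2-a} \nabla w$ has finite
energy because of Hardy's inequality
$\int_B |y|^{a-2} u^2 \le C \int_B |y|^a (\partial_y u)^2$, which holds for odd
functions since they vanish at $y = 0$ on each vertical slice of the ball
([hardy1], [hardy]). To approximate $w$ one takes $\phi$ smooth and close to $u$,
and multiplies $\phi/(y|y|^{-a})$ by $\eta = e^{-d/y^2}$. The products of smooth
functions with powers of $|y|$ and $\eta$ are smooth across the hyperplane
([smooth_mul_flat]), and the error is estimated by the Hardy integral of $u$
times quantities vanishing with $d$, plus the error of $\phi$ times a constant
that depends on $d$ ([sqjet_quot_approx], [in_H1_quot]).

The equation. For a test function $\psi$ supported in the ball, the equation of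
$u$ is tested with $\psi\, y|y|^{-a} \eta$, which is smooth, compactly supported
and of finite energy. As $d \to 0$ this gives ([profile_equation])
$\int_B y \nabla u \cdot \nabla\psi + (1-a)\, \psi\, \partial_y u = \int_B y f \psi$.
The dominating functions are $|\nabla u|$, integrable since $|y|^{-a}$ is, and
$|y f|$, integrable by the standing assumption on $f$ ([integrable_source]).
Finally $\int_B \psi\, \partial_y u = - \int_B u\, \partial_y \psi$
([integration_by_parts_H1]), and the left-hand side becomes
$\int_B |y|^{2-a} \nabla w \cdot \nabla\psi$ ([quot_equation]).

The passage from $B$ to a smaller ball is a restriction. *)

(** * The Borel structure of R^n *)

(** The boxes with rational centre and rational half-width form a countable base. *)
Lemma open_measurable_rV (R : realType) n (A : set 'rV[R]_n) :
  open A -> measurable A.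
Proof.
move=> oA.
pose box (p : 'rV[rat]_n * rat) := [set z : 'rV[R]_n |
  forall i, z ord0 i \in `](ratr (p.1 ord0 i - p.2) : R), ratr (p.1 ord0 i + p.2)[].
have mbox p : measurable (box p).
  rewrite (_ : box p = \bigcap_(i in [set: 'I_n])
      (fun z : 'rV[R]_n => z ord0 i : measurableTypeR R) @^-1`
        `]ratr (p.1 ord0 i - p.2), ratr (p.1 ord0 i + p.2)[%classic).
    apply: fin_bigcap_measurable => // i _.
    by rewrite -[X in measurable X]setTI; apply: measurable_coord.
  by apply/seteqP; split => z /= zlh i; [move=> _|]; exact: zlh.
rewrite (_ : A = \bigcup_k (if unpickle k is Some p then
    if `[< box p `<=` A >] then box p else set0 else set0)); last first.
  apply/seteqP; split=> [z Az|z [k _]]; last first.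
    by case: unpickle => // p; case: asboolP => // + /[dup] _; exact.
  have /nbhs_ballP[e /= e0 eA] := open_nbhs_nbhs (conj oA Az).
  have [q] := rat_in_itvoo (divr_gt0 e0 (ltr0n _ 2)).
  rewrite in_itv/= => /andP[q0 qe].
  have cP i : exists c : rat, ratr c \in `]z ord0 i - ratr q, z ord0 i + ratr q[.
    by apply: rat_in_itvoo; rewrite ltrBlDr -addrA ltrDl addr_gt0.
  pose c := \row_i sval (cid (cP i)).
  have cE i : z ord0 i - ratr q < ratr (c ord0 i) < z ord0 i + ratr q.
    by rewrite mxE; case: cid => /= x; rewrite in_itv.
  exists (pickle (c, q)) => //; rewrite pickleK.
  have zb : box (c, q) z.
    move=> i /=; have /andP[h1 h2] := cE i.
    by rewrite in_itv/= rmorphB rmorphD/=; apply/andP; split; lra.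
  case: asboolP => // ncA; exfalso; apply: ncA => x xb; apply: eA; split => // i j.
  rewrite (ord1 i) /ball/= ltr_norml.
  have := xb j; have := zb j.
  rewrite !in_itv/= !rmorphB !rmorphD/= => /andP[h1 h2] /andP[h3 h4].
  by apply/andP; split; lra.
apply: bigcupT_measurable => k; case: unpickle => // p.
by case: asboolP.
Qed.

Lemma continuous_measurable_rV (R : realType) n (f : 'rV[R]_n -> R) :
  continuous f -> measurable_fun setT f.
Proof.
move=> /continuousP cf; apply: (measurability _ (RGenOpens.measurableE R)).
move=> _ [_ [a [b ->] <-]]; rewrite setTI; apply: open_measurable_rV.
exact/cf/interval_open.
Qed.

(** * The Lebesgue measure of balls, slices and reflections *)

Section cubes.
Context {R : realType}.
Local Open Scope ereal_scope.

Definition cube (n : nat) (M : R) : set 'rV[R]_n :=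
  [set z : 'rV[R]_n | forall i, z ord0 i \in `[(- M)%R, M]].

Lemma measurable_cube n (M : R) : measurable (@cube n M).
Proof.
rewrite (_ : cube M = \bigcap_(i in [set: 'I_n])
    (fun z : 'rV[R]_n => z ord0 i : measurableTypeR R) @^-1` `[(- M)%R, M]%classic).
  apply: fin_bigcap_measurable => // i _.
  by rewrite -[X in measurable X]setTI; apply: measurable_coord.
by apply/seteqP; split => z /= zlh i; [move=> _|]; exact: zlh.
Qed.

Lemma sigma_finite_lebesgue_rV n : sigma_finite setT (@lebesgue_rV R n).
Proof.
exists (fun k => @cube n k%:R); last first.
  move=> k; split; first exact: measurable_cube.
  rewrite (@lebesgue_rV_box R n (fun=> - k%:R)%R (fun=> k%:R)) ?ltry// => _.
  by rewrite (@le_trans _ _ 0%R)// oppr_le0.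
apply/seteqP; split=> // z _.
exists (Num.truncn `|z|).+1 => // i.
rewrite in_itv/= -ler_norml; apply: le_trans (ltW (truncnS_gt _)).
rewrite [leRHS]/Num.norm/= mx_normrE; apply/bigmax_geP; right => /=.
by exists (ord0, i).
Qed.

End cubes.

(** A measure repackaged with a proof that it is sigma-finite, as the Tonelli
theorem reads sigma-finiteness off the structure of the measure. *)
Definition sigma_finite_pack d (T : measurableType d) (R : realType)
  (m : {measure set T -> \bar R}) of sigma_finite setT m : set T -> \bar R := m.

Section sigma_finite_pack.
Context d (T : measurableType d) (R : realType) (m : {measure set T -> \bar R}).
Hypothesis sf : sigma_finite setT m.

HB.instance Definition _ := Measure.copy (sigma_finite_pack sf) m.
HB.instance Definition _ := @Measure_isSigmaFinite.Build d T R (sigma_finite_pack sf) sf.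

End sigma_finite_pack.

Section slices.
Context {R : realType} (n : nat).
Implicit Types (x : 'rV[R]_n) (t : R) (z : 'rV[R]_n.+1).

Lemma ycoord_snoc x t : ycoord (snoc_rV (x, t)) = t.
Proof. by rewrite /ycoord mxE unlift_none. Qed.

Lemma snoc_rV_lift x t i : snoc_rV (x, t) ord0 (lift ord_max i) = x ord0 i.
Proof. by rewrite mxE liftK. Qed.

Lemma yflip_snoc x t : yflip (snoc_rV (x, t)) = snoc_rV (x, - t).
Proof.
apply/rowP => j; rewrite !mxE; case: unliftP => [i ->|->]; last by rewrite eqxx.
by rewrite eq_sym (negbTE (neq_lift _ _)).
Qed.

Lemma ycoord_yflip z : ycoord (yflip z) = - ycoord z.
Proof. by rewrite /ycoord mxE eqxx. Qed.

Lemma yflipK : involutive (@yflip R n).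
Proof.
by move=> z; apply/rowP => j; rewrite !mxE; case: (j == ord_max); rewrite ?opprK.
Qed.

Lemma snoc_rV_add x t h :
  snoc_rV (x, h + t) = h *: delta_mx ord0 ord_max + snoc_rV (x, t).
Proof.
apply/rowP => j; rewrite !mxE eqxx/=; case: unliftP => [i ->|->].
  by rewrite eq_sym (negbTE (neq_lift _ _)) mulr0 add0r.
by rewrite eqxx mulr1.
Qed.

Lemma sumsqr_snoc x t :
  \sum_i snoc_rV (x, t) ord0 i ^+ 2 = \sum_i x ord0 i ^+ 2 + t ^+ 2.
Proof.
rewrite big_ord_recr/=; congr (_ + _); last by rewrite mxE unlift_none.
apply: eq_bigr => i _; rewrite -(snoc_rV_lift x t i).
congr (snoc_rV _ _ _ ^+ 2).
by apply/val_inj; rewrite /= /bump leqNgt ltn_ord.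
Qed.

Lemma sumsqr_yflip z : \sum_i yflip z ord0 i ^+ 2 = \sum_i z ord0 i ^+ 2.
Proof. by apply: eq_bigr => i _; rewrite mxE; case: ifP => // _; rewrite sqrrN. Qed.

Lemma eballE (r : R) : 0 < r ->
  eball r = [set z : 'rV[R]_n.+1 | \sum_i z ord0 i ^+ 2 < r ^+ 2].
Proof.
move=> r0; apply/seteqP; split=> z; rewrite /eball/=.
  move=> h; rewrite -ltr_sqrt ?exprn_gt0//.
  by rewrite sqrtr_sqr gtr0_norm.
move=> h; rewrite -[ltRHS]gtr0_norm// -sqrtr_sqr ltr_sqrt// exprn_gt0//.
Qed.

Lemma eball_yflip (r : R) z : eball r (yflip z) <-> eball r z.
Proof. by rewrite /eball/= sumsqr_yflip. Qed.

Lemma eball_coord (r : R) z i : eball r z -> `|z ord0 i| < r.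
Proof.
move=> h; apply: le_lt_trans h.
rewrite -sqrtr_sqr ler_wsqrtr// (bigD1 i)//= lerDl.
by apply: sumr_ge0 => j _; exact: sqr_ge0.
Qed.

Lemma sub_eball (r s : R) : r <= s -> eball r `<=` (eball s : set 'rV[R]_n.+1).
Proof. by move=> rs z; rewrite /eball/= => /lt_le_trans; exact. Qed.

Lemma measurable_yflip : measurable_fun setT (@yflip R n).
Proof.
apply: measurable_fun_coordP => j.
under [X in measurable_fun _ X]eq_fun do rewrite mxE.
case: (j == ord_max); last exact: measurable_coord.
exact: (@measurable_funN _ _ R setT (fun z : 'rV[R]_n.+1 => z ord0 j) (measurable_coord j)).
Qed.

Lemma measurable_eball (r : R) : measurable (eball r : set 'rV[R]_n.+1).
Proof.
rewrite (_ : eball r = (fun z : 'rV[R]_n.+1 => Num.sqrt (\sum_i z ord0 i ^+ 2)) @^-1` `]-oo, r[%classic).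
  rewrite -[X in measurable X]setTI.
  have : measurable_fun setT (fun z : 'rV[R]_n.+1 => Num.sqrt (\sum_i z ord0 i ^+ 2)).
    apply: (@measurableT_comp _ _ _ _ (measurableTypeR R) (measurableTypeR R) Num.sqrt).
      by apply: continuous_measurable_fun; exact: sqrt_continuous.
    apply: measurable_sum => i; apply: measurable_funX; exact: measurable_coord.
  by move/(_ measurableT); apply.
by apply/seteqP; split=> z; rewrite /eball/= in_itv.
Qed.

Local Open Scope ereal_scope.

(** Cavalieri's principle along the last coordinate: it reduces the estimates on
the ball to estimates in one variable. *)
Lemma ge0_integral_slices (f : 'rV[R]_n.+1 -> \bar R) :
  measurable_fun setT f -> (forall z, 0 <= f z) ->
  \int[lebesgue_rV n.+1]_z f z =
  \int[lebesgue_rV n]_x \int[lebesgue_measure]_t f (snoc_rV (x, t)).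
Proof.
move=> mf f0; have mfs := measurableT_comp mf (@measurable_snoc_rV R n).
transitivity (\int[lebesgue_rV n \x lebesgue_measure]_p f (snoc_rV p)).
  have := @ge0_integral_pushforward _ _ _ _ R (@snoc_rV R n)
    (@measurable_snoc_rV R n) (lebesgue_rV n \x lebesgue_measure) setT f.
  by rewrite preimage_setT; apply.
exact: (@fubini_tonelli1 _ _ _ _ _
  (sigma_finite_pack (@sigma_finite_lebesgue_rV R n)) lebesgue_measure
  (fun p => f (snoc_rV p))).
Qed.

Lemma ge0_integralN (g : R -> \bar R) :
  measurable_fun setT g -> (forall t, 0 <= g t) ->
  \int[lebesgue_measure]_t g (- t)%R = \int[lebesgue_measure]_t g t.
Proof.
move=> mg g0.
have := @ge0_integral_pushforward _ _ (measurableTypeR R) (measurableTypeR R) R -%R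
  (@oppr_measurable R setT) lebesgue_measure setT g.
rewrite preimage_setT /= => <- //.
by apply: eq_measure_integral => A mA _; exact: lebesgue_measureN.
Qed.

Lemma ge0_integral_yflip (f : 'rV[R]_n.+1 -> \bar R) :
  measurable_fun setT f -> (forall z, 0 <= f z) ->
  \int[lebesgue_rV n.+1]_z f (yflip z) = \int[lebesgue_rV n.+1]_z f z.
Proof.
move=> mf f0; rewrite (@ge0_integral_slices f)//.
rewrite (@ge0_integral_slices (f \o @yflip R n)) /=; last 2 first.
  exact: (measurableT_comp mf measurable_yflip).
  by move=> z; exact: f0.
apply: eq_integral => x _.
under eq_integral do rewrite yflip_snoc.
apply: (@ge0_integralN (fun t => f (snoc_rV (x, t)))) => //.
apply: (measurableT_comp mf).
apply: (measurableT_comp (@measurable_snoc_rV R n)).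
exact: pair1_measurable.
Qed.

(** Each slice meets the hyperplane in a single point. *)
Lemma ae_ycoord_neq0 : {ae lebesgue_rV n.+1, forall z : 'rV[R]_n.+1, ycoord z != 0%R}.
Proof.
have mH : measurable [set z : 'rV[R]_n.+1 | ycoord z = 0%R].
  have /(_ measurableT _ (measurable_set1 0%R)) := @measurable_coord R n.+1 ord_max.
  by rewrite setTI.
exists [set z | ycoord z = 0%R]; split => //; last by move=> z /= /negP/negPn/eqP.
rewrite -[LHS]mul1e -integral_cst// integral_mkcond ge0_integral_slices//=.
- rewrite integral0_eq// => x _.
  rewrite (_ : (fun t => _) = (cst 1 \_ [set 0%R])).
    rewrite -integral_mkcond integral_cst//.
    by rewrite [X in _ * X]lebesgue_measure_set1 mule0.
  apply/funext => t; rewrite !patchE; congr (if _ then _ else _).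
  by apply/idP/idP; rewrite !inE/= ycoord_snoc.
- by apply/(measurable_restrictT _ mH); exact: measurable_cst.
- by move=> z; rewrite patchE; case: ifP.
Qed.

Lemma eball_lty (r : R) : (0 < r)%R -> lebesgue_rV n.+1 (eball r) < +oo.
Proof.
move=> r0.
have box : lebesgue_rV n.+1 (@cube R n.+1 r) < +oo.
  by rewrite (@lebesgue_rV_box R n.+1 (fun=> - r)%R (fun=> r)) ?ltry// => i; lra.
apply: le_lt_trans box.
have mB := @measurable_cube R n.+1 r.
apply: le_measure; rewrite ?inE//; first exact: measurable_eball.
move=> z zr i; rewrite in_itv/=.
by have := eball_coord i zr; rewrite ltr_norml => /andP[? ?]; apply/andP; split; apply: ltW.
Qed.

End slices.

(** * Hardy's inequality on the line *)

Section powers.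
Context {R : realType}.
Implicit Types (x p d : R).

Lemma is_derive_powR x p : 0 < x ->
  is_derive x 1 (fun y => y `^ p) (p * x `^ (p - 1)).
Proof.
move=> x0.
have -> : p * x `^ (p - 1) = derive1 (fun y : R => y `^ p) x.
  by rewrite powR_derive1// in_itv/= x0.
rewrite derive1E; apply/derivableP/derivable_powR.
by rewrite in_itv/= x0.
Qed.

Lemma is_derive_powR_shift x d p : 0 < x + d ->
  is_derive x 1 (fun y => (y + d) `^ p) (p * (x + d) `^ (p - 1)).
Proof.
move=> xd.
have := @is_derive1_comp R (fun y => y `^ p) (fun y => y + d) x _ 1
  (is_derive_powR p xd).
rewrite mulr1; apply.
have : is_derive x 1 (@idfun R + cst d) (1 + 0) by apply: is_deriveD.
by rewrite addr0.
Qed.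

Lemma continuous_powR_shift x d p : 0 < x + d ->
  {for x, continuous (fun y => (y + d) `^ p)}.
Proof.
move=> xd; apply: differentiable_continuous; apply/derivable1_diffP.
by have [] := is_derive_powR_shift p xd.
Qed.

Lemma continuous_is_derive (g g' : R -> R) :
  (forall t : R, is_derive t 1 g (g' t)) -> continuous g.
Proof.
move=> dg t; apply: differentiable_continuous; apply/derivable1_diffP.
by have [] := dg t.
Qed.

End powers.

Section ftc.
Context {R : realType}.
Implicit Types (g : R -> R) (a b : R).
Local Notation mu := (@lebesgue_measure R).

(** The fundamental theorem of calculus without one-sided limits, since all the
antiderivatives at hand are continuous up to the endpoints. *)
Lemma ftc_is_derive g g' a b : a <= b ->
  {in `[a, b], continuous g} -> {in `[a, b], continuous g'} ->
  {in `]a, b[, forall t : R, is_derive t 1 g (g' t)} ->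
  \int[mu]_(t in `[a, b]) g' t = g b - g a.
Proof.
rewrite le_eqVlt => /predU1P[<- _ _ _|ab cg cg' dg].
  by rewrite set_itv1 Rintegral_set1 subrr.
have cg'w : {within `[a, b], continuous g'}.
  by apply: continuous_in_subspaceT => t; rewrite inE; exact: cg'.
rewrite /Rintegral (@continuous_FTC2 R g' g a b ab cg'w) //.
- split=> [t tab||]; first by have [] := dg _ tab.
  + by apply: cvg_at_right_filter; apply: cg; rewrite in_itv/= lexx ltW.
  + by apply: cvg_at_left_filter; apply: cg; rewrite in_itv/= lexx ltW.
- by move=> t tab; rewrite derive1E; have [_ ->] := dg _ tab.
Qed.

Lemma integrable_itv_continuous g a b : {in `[a, b], continuous g} ->
  mu.-integrable `[a, b] (EFin \o g).
Proof.
move=> cg; apply: continuous_compact_integrable; first exact: segment_compact.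
by apply: continuous_in_subspaceT => t; rewrite inE; exact: cg.
Qed.

(** Hardy's inequality in one dimension, in a form without singularity at the
origin: one integrates the derivative of $(t+d)^{a-1} g^2$, whose two boundary
terms have a sign because $g(0) = 0$. *)
Lemma hardy1 (a d h : R) g g' : a < 1 -> 0 < d -> 0 <= h ->
  (forall t : R, is_derive t 1 g (g' t)) -> continuous g' -> g 0 = 0 ->
  \int[mu]_(t in `[0, h]) ((t + d) `^ (a - 2) * g t ^+ 2) <=
  4 / (1 - a) ^+ 2 * \int[mu]_(t in `[0, h]) ((t + d) `^ a * g' t ^+ 2).
Proof.
move=> a1 d0 h0 dg cg' g00.
have cg := continuous_is_derive dg.
pose A t := (t + d) `^ (a - 2) * g t ^+ 2.
pose B t := (t + d) `^ a * g' t ^+ 2.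
pose H t := (t + d) `^ (a - 1) * g t ^+ 2.
pose H' t := (a - 1) * A t + 2 * ((t + d) `^ (a - 1) * (g t * g' t)).
have td t : t \in `[0, h] -> 0 < t + d.
  by rewrite in_itv/= => /andP[t0 _]; lra.
have cpow p t : t \in `[0, h] -> {for t, continuous (fun y => (y + d) `^ p)}.
  by move=> /td; exact: continuous_powR_shift.
have cA : {in `[0, h], continuous A}.
  by move=> t th; apply: cvgM; [exact: cpow|apply: cvgM; exact: cg].
have cB : {in `[0, h], continuous B}.
  by move=> t th; apply: cvgM; [exact: cpow|apply: cvgM; exact: cg'].
have cH : {in `[0, h], continuous H}.
  by move=> t th; apply: cvgM; [exact: cpow|apply: cvgM; exact: cg].
have cH' : {in `[0, h], continuous H'}.
  move=> t th; apply: cvgD; first by apply: cvgM; [exact: cvg_cst|exact: cA].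
  apply: cvgM; first exact: cvg_cst.
  by apply: cvgM; [exact: cpow|apply: cvgM; [exact: cg|exact: cg']].
have dH : {in `]0, h[, forall t : R, is_derive t 1 H (H' t)}.
  move=> t th; have t0 : 0 < t + d by apply: td; exact: subset_itv_oo_cc th.
  have := is_deriveM (is_derive_powR_shift (a - 1) t0)
                     (is_deriveX 2 (dg t)).
  move=> /is_derive_eq; apply; rewrite /H' /A /=.
  rewrite (_ : a - 1 - 1 = a - 2); last by ring.
  by rewrite (_ : (g ^+ 2) t = g t ^+ 2)// expr1 /GRing.scale/=; ring.
have IH : 0 <= \int[mu]_(t in `[0, h]) H' t.
  rewrite (ftc_is_derive h0 cH cH' dH) /H g00 expr0n mulr0 subr0.
  by rewrite mulr_ge0 ?powR_ge0 ?sqr_ge0.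
have c0 : 0 < 1 - a by lra.
have le : \int[mu]_(t in `[0, h]) H' t <=
    \int[mu]_(t in `[0, h]) (2 / (1 - a) * B t - (1 - a) / 2 * A t).
  apply: le_Rintegral => //.
  - exact: integrable_itv_continuous.
  - apply: integrable_itv_continuous => t th.
    by apply: cvgB; (apply: cvgM; [exact: cvg_cst|]); [exact: cB|exact: cA].
  - move=> t th; have t0 := td _ th.
    rewrite /H' /A /B.
    have -> : (t + d) `^ (a - 2) = (t + d) `^ a * ((t + d)^-1) ^+ 2.
      rewrite powRB; last by rewrite (gt_eqF t0) implybT.
      by rewrite powR_mulrn ?ltW// exprVn.
    have -> : (t + d) `^ (a - 1) = (t + d) `^ a * (t + d)^-1.
      rewrite powRB; last by rewrite (gt_eqF t0) implybT.
      by rewrite powRr1 ?ltW.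
    set P := (t + d) `^ a; have P0 : 0 <= P := powR_ge0 _ _.
    set s := (t + d)^-1; set c := 1 - a.
    rewrite -subr_ge0.
    rewrite (_ : _ - _ = P * (2 / c) * (g' t - c / 2 * s * g t) ^+ 2).
      by rewrite mulr_ge0 ?sqr_ge0// mulr_ge0// divr_ge0// ltW.
    rewrite (_ : a - 1 = - c); last by rewrite /c; ring.
    by field; rewrite gt_eqF.
move: (le_trans IH le); rewrite RintegralB//; last 2 first.
  - apply: integrable_itv_continuous => t th.
    by apply: cvgM; [exact: cvg_cst|exact: cB].
  - apply: integrable_itv_continuous => t th.
    by apply: cvgM; [exact: cvg_cst|exact: cA].
rewrite !RintegralZl//; [|exact: integrable_itv_continuous..].
set IA := (\int[mu]_(t in _) A t); set IB := (\int[mu]_(t in _) B t).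
rewrite subr_ge0 => IAB.
have -> : 4 / (1 - a) ^+ 2 * IB = (2 / (1 - a)) * (2 / (1 - a) * IB).
  by field; rewrite gt_eqF.
apply: le_trans (ler_wpM2l _ IAB); last by rewrite divr_ge0// ltW.
by rewrite le_eqVlt; apply/orP; left; apply/eqP; field; rewrite gt_eqF.
Qed.

End ftc.

Section line_integrals.
Context {R : realType}.
Local Notation mu := (@lebesgue_measure R).
Local Open Scope ereal_scope.

Lemma fatou_le d (T : measurableType d) (nu : {measure set T -> \bar R})
    (D : set T) (f_ : (T -> \bar R)^nat) (f : T -> \bar R) (C : \bar R) :
  measurable D -> (forall k, measurable_fun D (f_ k)) ->
  (forall k x, D x -> 0 <= f_ k x) ->
  (forall x, D x -> f_ ^~ x @ \oo --> f x) ->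
  (forall k, \int[nu]_(x in D) f_ k x <= C) ->
  \int[nu]_(x in D) f x <= C.
Proof.
move=> mD mf f0 cf leC.
have -> : \int[nu]_(x in D) f x = \int[nu]_(x in D) limn_einf (f_ ^~ x).
  apply: eq_integral => x; rewrite inE => Dx.
  by have [-> _] := cvg_limn_einf_sup (cf x Dx).
apply: le_trans (fatou _ mD mf f0) _.
rewrite limn_einf_lim; apply: lime_le; first exact: is_cvg_einfs.
apply: nearW => k; apply: le_trans (leC k).
by apply: ereal_inf_lbound; exists k => /=.
Qed.

Lemma ge0_integral_sym (F : R -> \bar R) :
  measurable_fun setT F -> (forall t, 0 <= F t) ->
  \int[mu]_t F t =
  \int[mu]_(t in `[0%R, +oo[) F t + \int[mu]_(t in `[0%R, +oo[) F (- t)%R.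
Proof.
move=> mF F0.
have mFN : measurable_fun setT (F \o -%R) by exact: measurableT_comp.
rewrite addeC (ge0_integration_by_substitution0 mFN)/=; last by move=> r; exact: F0.
under [X in _ = X + _]eq_integral do rewrite opprK.
rewrite -[X in _ = X + _]integral_itv_bndo_bndc; last exact: measurable_funTS.
rewrite -ge0_integral_setU//=; last 2 first.
- exact: measurable_funTS.
- by apply/disj_setPS => t [] /=; rewrite !in_itv/= andbT => h1 h2; lra.
congr (integral _ _ _); apply/esym/seteqP; split=> // t _ /=.
by rewrite !in_itv/= andbT; case: (ltP t 0%R) => ?; [left|right].
Qed.

(** The antiderivative of the shifted power is bounded uniformly in the shift,
which is then sent to zero. *)
Lemma integral_powR_lty (b : R) : (-1 < b)%R ->
  \int[mu]_(t in `[0%R, 1%R]) (`|t| `^ b)%:E < +oo.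
Proof.
move=> b1; have b10 : (0 < b + 1)%R by lra.
pose d (k : nat) : R := (k.+1%:R^-1)%R.
have d0 k : (0 < d k)%R by rewrite invr_gt0.
pose C := (2 `^ (b + 1) / (b + 1))%R.
have intk k : \int[mu]_(t in `[0%R, 1%R]) ((t + d k) `^ b)%:E <= C%:E.
  pose G t := ((b + 1)^-1 * (t + d k) `^ (b + 1))%R.
  have td t : t \in `[0%R, 1%R] -> (0 < t + d k)%R.
    by rewrite in_itv/= => /andP[t0 _]; have := d0 k; lra.
  have cpow p : {in `[0%R, 1%R], continuous (fun y => (y + d k) `^ p)%R}.
    by move=> t /td; exact: continuous_powR_shift.
  have ib : mu.-integrable `[0%R, 1%R] (fun t => ((t + d k) `^ b)%:E).
    exact: (integrable_itv_continuous (cpow b)).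
  rewrite -[leLHS]fineK; last exact: integrable_fin_num ib.
  rewrite lee_fin [leLHS](@ftc_is_derive R G (fun t => (t + d k) `^ b)%R)//.
  - rewrite /G /C -mulrBr mulrC ler_pM2r ?invr_gt0// add0r.
    rewrite lerBlDr; apply: (@le_trans _ _ (2 `^ (b + 1))%R); last first.
      by rewrite lerDl powR_ge0.
    have := d0 k => dk; apply: ge0_ler_powR; rewrite ?nnegrE//; try lra.
    by rewrite -lerBrDl (_ : 2 - 1 = 1)%R ?invf_le1 ?ler1n//; ring.
  - move=> t th; apply: cvgM; [exact: cvg_cst|exact: cpow].
  - move=> t th; have t0 := td t (subset_itv_oo_cc th).
    have := is_deriveZ (b + 1)^-1 (is_derive_powR_shift (b + 1) t0).
    move=> /is_derive_eq; apply; rewrite addrK /GRing.scale/= mulrA mulVf ?mul1r//.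
    by rewrite gt_eqF.
apply: (@le_lt_trans _ _ C%:E); last exact: ltry.
have mpow k : measurable_fun (`[0%R, 1%R] : set R) (fun t : R => ((t + d k) `^ b)%:E).
  apply/measurable_EFinP.
  apply: (@measurableT_comp _ _ _ _ _ _ (fun x => x `^ b)%R).
    exact: measurable_powR.
  by apply: measurable_funD.
rewrite -integral_itv_obnd_cbnd; last first.
  apply/measurable_EFinP.
  apply: (@measurableT_comp _ _ _ _ _ _ (fun x => x `^ b)%R).
    exact: measurable_powR.
  exact: normr_measurable.
apply: (@fatou_le _ (measurableTypeR R) mu _ (fun k t => ((t + d k) `^ b)%:E)) => //.
- by move=> k; apply: measurable_funS (mpow k) => //; exact: subset_itv_oc_cc.
- by move=> k x _; rewrite lee_fin powR_ge0.
- move=> x /=; rewrite in_itv/= => /andP[x0 x1].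
  apply: cvg_EFin; first by apply: nearW.
  have : {for (0 : R)%R, continuous (fun y => (y + x) `^ b)%R}.
    by apply: continuous_powR_shift; rewrite add0r.
  move=> cx; rewrite (gtr0_norm x0).
  have := cvg_comp d _ cvg_harmonic cx; rewrite add0r.
  rewrite (_ : fine \o _ = (fun y => (y + x) `^ b)%R \o d)//.
  by apply/funext => k /=; rewrite addrC.
- move=> k; apply: le_trans (intk k).
  apply: ge0_subset_integral => //; last exact: subset_itv_oc_cc.
  - exact: mpow.
  - by move=> t _; rewrite lee_fin powR_ge0.
Qed.

End line_integrals.

(** * Integrability of the powers of the distance to the hyperplane *)

Section weight.
Context {R : realType} (n : nat).
Implicit Types (b : R) (z : 'rV[R]_n.+1).
Local Notation mu := (@lebesgue_rV R n.+1).
Local Notation B := (@eball R n 1).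
Local Open Scope ereal_scope.

Lemma measurable_weightE b D : measurable_fun D (fun z : 'rV[R]_n.+1 => (weight b z)%:E).
Proof. by apply/measurable_EFinP/measurable_funTS; exact: measurable_weight. Qed.

Lemma weight_ge0 b z : (0 <= weight b z)%R.
Proof. exact: powR_ge0. Qed.

(** The ball lies in the cube of half-width 1, so every slice contributes at most
the integral of $|t|^b$ over $[-1, 1]$. *)
Lemma integral_weight_lty b : (-1 < b)%R ->
  \int[mu]_(z in B) (weight b z)%:E < +oo.
Proof.
move=> b1; have mB := @measurable_eball R n 1.
pose I := \int[lebesgue_measure]_(t in `[0%R, 1%R]) (`|t| `^ b)%:E.
pose h (t : R) : \bar R := ((fun t => (`|t| `^ b)%:E) \_ `[(-1)%R, 1%R]) t.
have mpow : measurable_fun setT (fun t : R => (`|t| `^ b)%:E).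
  apply/measurable_EFinP.
  apply: (@measurableT_comp _ _ _ _ _ _ (fun x => x `^ b)%R).
    exact: measurable_powR.
  exact: normr_measurable.
have mh : measurable_fun setT h.
  by apply/(measurable_restrictT _ _).1 => //; exact: measurable_funTS.
have h0 t : 0 <= h t by rewrite /h patchE; case: ifP => // _; rewrite lee_fin powR_ge0.
have Ih : \int[lebesgue_measure]_t h t < +oo.
  rewrite ge0_integral_sym//.
  have hE : \int[lebesgue_measure]_(t in `[0%R, +oo[) h t <= I.
    rewrite /h -integral_mkcondr /I.
    apply: ge0_subset_integral => //.
    - by apply: measurableI; exact: measurable_itv.
    - by exact: measurable_funTS.
    - by move=> t [] /=; rewrite !in_itv/= andbT => -> /andP[_ ->].
  have hN t : h (- t)%R = h t.
    rewrite /h !patchE normrN; congr (if _ then _ else _).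
    by apply/idP/idP; rewrite !inE/= !in_itv/= => /andP[? ?]; apply/andP; split; lra.
  under [X in _ + X]eq_integral do rewrite hN.
  by rewrite lte_add_pinfty//; apply: le_lt_trans hE _; exact: integral_powR_lty.
have mcube := @measurable_cube R n 1.
pose F z := ((fun z => (weight b z)%:E) \_ B) z.
rewrite integral_mkcond -/F.
have F0 z : 0 <= F z.
  by rewrite /F patchE; case: ifP => // _; rewrite lee_fin weight_ge0.
have mF : measurable_fun setT F.
  by apply/(measurable_restrictT _ _).1 => //; exact: measurable_weightE.
rewrite ge0_integral_slices//.
apply: (@le_lt_trans _ _ (\int[lebesgue_rV n]_x
   ((cst (\int[lebesgue_measure]_t h t)) \_ (cube 1)) x)).
  apply: ge0_le_integral => //.
  - by move=> x _; exact: integral_ge0.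
  - apply: (measurable_fun_fubini_tonelli_F (fun p => F (snoc_rV p))) => //.
    exact: (measurableT_comp mF (@measurable_snoc_rV R n)).
  - apply/(measurable_restrictT _ _).1 => //; exact: measurable_cst.
  move=> x _; rewrite patchE; case: ifPn => [xc|xc].
    apply: ge0_le_integral => //.
    - apply: (measurableT_comp mF).
      by apply: (measurableT_comp (@measurable_snoc_rV R n)).
    - move=> t _; rewrite /F /h !patchE; case: ifPn => [/set_mem zB|_]; last first.
        by case: ifP => // _; rewrite lee_fin powR_ge0.
      rewrite ifT; first by rewrite /weight ycoord_snoc.
      rewrite inE/= in_itv/=.
      have := eball_coord ord_max zB; rewrite -/(ycoord _) ycoord_snoc ltr_norml.
      by move=> /andP[? ?]; rewrite !ltW.
  rewrite integral0_eq// => t _; rewrite /F patchE; case: ifPn => [/set_mem zB|//].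
  exfalso; move: xc; rewrite notin_setE; apply => i /=.
  have := eball_coord (lift ord_max i) zB; rewrite snoc_rV_lift ltr_norml in_itv/=.
  by move=> /andP[? ?]; rewrite !ltW.
rewrite -integral_mkcond integral_cst// lte_mul_pinfty//.
- exact: integral_ge0.
- by rewrite ge0_fin_numE// integral_ge0.
- by rewrite (@lebesgue_rV_box R n (fun=> - 1)%R (fun=> 1)%R) ?ltry// => i; lra.
Qed.

End weight.

(** * Smooth functions along lines *)

Section lines.
Context {R : realType} {V : normedModType R}.

(** Directional derivatives are computed by restriction to a line. *)
Lemma is_derive_lineP (f : V -> R) (g : R -> R) (z v : V) (t df : R) :
  (forall h, f (h *: v + z) = g (h + t)) ->
  is_derive z v f df <-> is_derive t 1 g df.
Proof.
move=> fg; have fz : f z = g t by have := fg 0; rewrite scale0r !add0r.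
have E : (fun h : R => h^-1 *: ((f \o shift z) (h *: v) - f z)) =
         (fun h : R => h^-1 *: ((g \o shift t) (h *: 1) - g t)).
  apply/funext => h /=; rewrite fg fz; congr (_ *: (g (_ + _) - _)).
  by rewrite /GRing.scale/= mulr1.
by split=> -[d1 d2]; split; move: d1 d2; rewrite /derivable /derive E.
Qed.

End lines.

Section slices_of_smooth.
Context {R : realType} (n : nat).
Implicit Types (phi : 'rV[R]_n.+1 -> R).

Lemma smooth_continuous phi : smooth phi -> continuous phi.
Proof. by move=> /(_ [::])[]. Qed.

Lemma smooth_derivable phi i z : smooth phi -> derivable phi z (delta_mx ord0 i).
Proof. by move=> /(_ [::])[]. Qed.

Lemma smooth_partial phi i : smooth phi -> smooth (partial i phi).
Proof.
by move=> sphi s; have := sphi (rcons s i); rewrite -cats1 foldr_cat.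
Qed.

Lemma continuous_partial phi i : smooth phi -> continuous (partial i phi).
Proof. by move=> /(smooth_partial i)/smooth_continuous. Qed.

Lemma measurable_smooth phi : smooth phi -> measurable_fun setT phi.
Proof. by move=> /smooth_continuous; exact: continuous_measurable_rV. Qed.

Lemma measurable_partial phi i : smooth phi -> measurable_fun setT (partial i phi).
Proof. by move=> /(smooth_partial i)/measurable_smooth. Qed.

Lemma is_derive_slice phi (x : 'rV[R]_n) (t : R) : smooth phi ->
  is_derive t 1 (fun t => phi (snoc_rV (x, t))) (partial ord_max phi (snoc_rV (x, t))).
Proof.
move=> sphi; apply/(is_derive_lineP (z := snoc_rV (x, t)) (v := delta_mx ord0 ord_max)
  (f := phi)).
  by move=> h; rewrite snoc_rV_add.
exact/derivableP/smooth_derivable.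
Qed.

Lemma continuous_snoc (x : 'rV[R]_n) : continuous (fun t : R => snoc_rV (x, t)).
Proof.
move=> t; rewrite (_ : (fun _ => _) =
    (fun s : R => (s - t) *: delta_mx ord0 ord_max + snoc_rV (x, t))); last first.
  by apply/funext => s; rewrite -snoc_rV_add subrK.
apply: (@cvgD _ 'rV[R]_n.+1 _ _ _ _ _ _ _); last exact: cvg_cst.
apply: cvgZ; last exact: cvg_cst.
by apply: cvgB; [exact: cvg_id|exact: cvg_cst].
Qed.

Lemma continuous_slice phi (x : 'rV[R]_n) : continuous phi ->
  continuous (fun t : R => phi (snoc_rV (x, t))).
Proof.
by move=> cphi t; apply: continuous_comp; [exact: continuous_snoc|exact: cphi].
Qed.

Lemma bounded_on_eball phi : continuous phi ->
  exists C : R, 0 < C /\ forall z, eball 1 z -> `|phi z| <= C.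
Proof.
move=> cphi.
have cube_compact : compact (@cube R n.+1 1).
  apply: (@rV_compact _ _ (fun=> `[(-1 : R), 1]%classic)).
  by move=> _; exact: segment_compact.
have /compact_bounded := continuous_compact (continuous_subspaceT cphi) cube_compact.
move=> [M [_ HM]]; exists (`|M| + 1); split; first by rewrite ltr_wpDl.
move=> z zB; apply: HM; first by rewrite (le_lt_trans (ler_norm _))// ltrDl.
exists z => // i; have := eball_coord i zB; rewrite ltr_norml in_itv/=.
by move=> /andP[? ?]; rewrite !ltW.
Qed.

(** The derivatives of a compactly supported function vanish off the support,
whose complement is open. *)
Lemma partial_eq0_off_support phi i (K : set 'rV[R]_n.+1) :
  closed K -> (forall z, ~ K z -> phi z = 0) ->
  forall z, ~ K z -> partial i phi z = 0.
Proof.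
move=> cK phi0 z Kz; rewrite /partial.
have : is_derive z (delta_mx ord0 i) (cst 0 : 'rV[R]_n.+1 -> R) 0 by exact: is_derive_cst.
have oK : open (~` K) by exact: closed_openC.
move=> /(@near_eq_is_derive _ _ _ _ phi) => /(_ _)[] //.
have := open_nbhs_nbhs (conj oK Kz : open_nbhs z (~` K)).
by apply: filterS => y /phi0 ->.
Qed.

End slices_of_smooth.

(** * Functions flat on the hyperplane *)

Section flat_functions.
Context {R : realType} (d : R).
Hypothesis d0 : 0 < d.
Implicit Types (m : nat) (c y : R).

(** $\mathrm{sgn}(y)^m |y|^c e^{-d/y^2}$. The exponential kills every power of
$|y|$ at the origin, so these functions are smooth and their span is closed
under differentiation. *)
Definition flat m c y : R :=
  if y == 0 then 0 else Num.sg y ^+ m * `|y| `^ c * expR (- (d / y ^+ 2)).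

Lemma flat0 m c : flat m c 0 = 0.
Proof. by rewrite /flat eqxx. Qed.

Lemma flatN m c y : flat m c (- y) = (-1) ^+ m * flat m c y.
Proof.
rewrite /flat oppr_eq0; case: ifP => _; first by rewrite mulr0.
by rewrite normrN sqrrN sgrN [in LHS]exprNn !mulrA.
Qed.

Lemma norm_flat m c y : y != 0 ->
  `|flat m c y| = `|y| `^ c * expR (- (d / y ^+ 2)).
Proof.
move=> y0; rewrite /flat (negbTE y0) !normrM normrX normr_sg y0 expr1n mul1r.
by rewrite (ger0_norm (powR_ge0 _ _)) (ger0_norm (expR_ge0 _)).
Qed.

(** One uses $e^{-s} \le N!/s^N$ with $s = d/y^2$ and $N$ so large that the
remaining power $|y|^{c + 2N}$ has exponent at least 2. The factor $y^2$ makes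
the function differentiable at the origin, with derivative 0. *)
Lemma flat_bound m c :
  exists C : R, 0 <= C /\ forall y, `|y| <= 1 -> `|flat m c y| <= C * y ^+ 2.
Proof.
pose N := (Num.truncn `|c|).+2.
have Nc : 2 <= c + N.*2%:R.
  have : `|c| < (Num.truncn `|c|).+1%:R by exact: truncnS_gt.
  have : - `|c| <= c by rewrite lerNl -normrN ler_norm.
  have -> : N.*2%:R = 2 * ((Num.truncn `|c|).+1%:R + 1) :> R.
    by rewrite -mul2n natrM /N -[X in _ * X]natr1.
  by have := normr_ge0 c; lra.
exists (N`!%:R / d ^+ N); split=> [|y y1].
  by rewrite divr_ge0// exprn_ge0// ltW.
have [->|y0] := eqVneq y 0; first by rewrite flat0 normr0 expr0n mulr0.
rewrite norm_flat//.
have ny0 : 0 < `|y| by rewrite normr_gt0.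
have y20 : 0 < y ^+ 2 by rewrite exprn_even_gt0.
have t0 : 0 < d / y ^+ 2 by rewrite divr_gt0.
have Et : expR (- (d / y ^+ 2)) <= N`!%:R / (d / y ^+ 2) ^+ N.
  rewrite expRN -[leRHS]invrK lef_pV2 ?posrE ?expR_gt0//; last first.
    by rewrite invr_gt0 divr_gt0 ?ltr0n ?fact_gt0// exprn_gt0.
  rewrite invf_div; apply: le_trans (expR_ge1Dxn (Num.truncn `|c|).+1 (ltW t0)).
  by rewrite lerDr.
apply: (le_trans (ler_wpM2l (powR_ge0 _ _) Et)).
have -> : `|y| `^ c * (N`!%:R / (d / y ^+ 2) ^+ N) =
    N`!%:R / d ^+ N * `|y| `^ (c + N.*2%:R).
  rewrite powRD ?(gt_eqF ny0) ?implybT// powR_mulrn// -mul2n exprM.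
  by rewrite real_normK ?num_real// expr_div_n; field; rewrite !expf_neq0// ?gt_eqF.
rewrite ler_wpM2l ?divr_ge0 ?exprn_ge0 ?(ltW d0)//.
rewrite -real_normK ?num_real// -powR_mulrn//.
by apply: ger_powR; rewrite ?ny0.
Qed.

Lemma is_derive_flat_pos m c y : 0 < y ->
  is_derive y 1 (flat m c) (c * flat m.+1 (c - 1) y + 2 * d * flat m.+1 (c - 3) y).
Proof.
move=> y0.
have dE : is_derive y 1 (fun y => expR (- (d / y ^+ 2)))
    (expR (- (d / y ^+ 2)) * (2 * d * y ^- 3)).
  apply: (@is_derive1_comp R expR (fun y => - (d / y ^+ 2))).
  have dX : is_derive y 1 (fun y : R => y ^+ 2) (2 * y).
    have := is_deriveX 2 (is_derive_id y (1 : R)).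
    by move=> /is_derive_eq; apply; rewrite /GRing.scale/= mulr1.
  have := is_deriveN (is_deriveZ d (@is_deriveV R (fun y => y ^+ 2) y _ 1 (lt0r_neq0 (exprn_gt0 2 y0)) dX)).
  by move=> /is_derive_eq; apply; rewrite /GRing.scale/=; field; exact: lt0r_neq0.
have fE : \forall x \near y,
    ((fun y => y `^ c) * (fun y => expR (- (d / y ^+ 2)))) x = flat m c x.
  near=> x; have x0 : 0 < x by near: x; exact: lt_nbhsr.
  by rewrite /flat gt_eqF// gtr0_sg// expr1n mul1r gtr0_norm.
have := near_eq_is_derive fE (is_deriveM (is_derive_powR c y0) dE).
move=> /is_derive_eq; apply; rewrite /flat gt_eqF// gtr0_sg// expr1n !mul1r gtr0_norm//.
have -> : y `^ (c - 3) = y `^ c * y ^- 3.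
  rewrite powRB; last by rewrite (gt_eqF y0) implybT.
  by rewrite powR_mulrn// ltW.
by rewrite /GRing.scale/=; ring.
Unshelve. all: by end_near. Qed.

Lemma is_derive_flat m c y :
  is_derive y 1 (flat m c) (c * flat m.+1 (c - 1) y + 2 * d * flat m.+1 (c - 3) y).
Proof.
have [y0|y0|<-] := ltgtP 0 y; first exact: is_derive_flat_pos.
  have Ny0 : 0 < - y by rewrite oppr_gt0.
  have := is_deriveZ ((-1) ^+ m)
    (@is_derive1_comp R (flat m c) -%R y _ _ (is_derive_flat_pos m c Ny0) (is_deriveNid y 1)).
  rewrite (_ : _ \*: _ = flat m c); last first.
    apply/funext => x; rewrite /= flatN /GRing.scale/= mulrA -expr2 sqrr_sign.
    by rewrite mul1r.
  move=> /is_derive_eq; apply; rewrite !flatN /GRing.scale/= exprS.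
  have := sqrr_sign R m; rewrite expr2; set s := (-1) ^+ m => ss.
  rewrite [LHS](_ : _ = (s * s) * (c * flat m.+1 (c - 1) y + 2 * d * flat m.+1 (c - 3) y)).
    by rewrite ss mul1r.
  by ring.
have [C [C0 HC]] := flat_bound m c.
rewrite !flat0 !mulr0 addr0.
have lim0 : (fun h : R => h^-1 *: ((flat m c \o shift 0) (h *: 1) - flat m c 0)) @ 0^' --> (0 : R).
  apply/cvgr0Pnorm_le => e e0; near=> h.
  have h0 : h != 0 by near: h; exact: nbhs_dnbhs_neq.
  have hC : `|h| < e / (C + 1) by near: h; apply: dnbhs0_lt; rewrite divr_gt0//; lra.
  have h1 : `|h| <= 1 by near: h; exact: dnbhs0_le.
  rewrite /= flat0 subr0 addr0 /GRing.scale/= mulr1 normrM normfV.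
  rewrite ler_pdivrMl ?normr_gt0//.
  apply: le_trans (HC _ h1) _.
  rewrite -real_normK ?num_real// expr2 mulrCA ler_wpM2l//.
  have C1 : 0 < C + 1 by lra.
  move: hC; rewrite ltr_pdivlMr// => /ltW; apply: le_trans.
  by rewrite mulrC ler_wpM2l// lerDl.
split; first by apply/cvg_ex; exists 0.
exact: cvg_lim.
Unshelve. all: by end_near. Qed.

Lemma continuous_flat m c : continuous (flat m c).
Proof. exact: continuous_is_derive (is_derive_flat m c). Qed.

End flat_functions.

Section smooth_flat.
Context {R : realType} (n : nat) (d : R).
Hypothesis d0 : 0 < d.
Implicit Types (f g : 'rV[R]_n.+1 -> R).

(** Unlike a single product of a smooth function with a flat one, these sums are
stable under all partial derivatives; their smoothness follows by induction. *)
Inductive flat_span : ('rV[R]_n.+1 -> R) -> Prop :=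
| flat_span_mul k f m c : smooth f ->
    flat_span (fun z => k * (f z * flat d m c (ycoord z)))
| flat_span_add f g : flat_span f -> flat_span g -> flat_span (f + g).

Lemma continuous_ycoord : continuous (@ycoord R n).
Proof. exact: coord_continuous. Qed.

Lemma is_derive_flat_ycoord m c (z : 'rV[R]_n.+1) i :
  is_derive z (delta_mx ord0 i) (fun z => flat d m c (ycoord z))
    ((i == ord_max)%:R *
     (c * flat d m.+1 (c - 1) (ycoord z) + 2 * d * flat d m.+1 (c - 3) (ycoord z))).
Proof.
have [->|im] := eqVneq i ord_max.
  rewrite mul1r; have E h : flat d m c (ycoord (h *: delta_mx ord0 ord_max + z)) =
      flat d m c (h + ycoord z).
    by rewrite /ycoord !mxE !eqxx mulr1.
  by apply/(is_derive_lineP _ E); exact: is_derive_flat.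
rewrite mul0r; have E h : flat d m c (ycoord (h *: delta_mx ord0 i + z)) =
    cst (flat d m c (ycoord z)) (h + 0).
  by rewrite /ycoord !mxE eqxx/= eq_sym (negbTE im) mulr0 add0r.
by apply/(is_derive_lineP _ E); exact: is_derive_cst.
Qed.

Lemma flat_span_continuous g : flat_span g -> continuous g.
Proof.
elim=> [k f m c sf|f1 f2 _ c1 _ c2] z.
  have cf : {for z, continuous (fun z => flat d m c (ycoord z))}.
    apply: continuous_comp; first exact: continuous_ycoord.
    exact: continuous_flat.
  have ck : {for z, continuous (cst k : 'rV[R]_n.+1 -> R)} by exact: cst_continuous.
  exact: (continuousM ck (continuousM (smooth_continuous sf (x := z)) cf)).
exact: (@continuousD _ _ _ f1 f2 z (c1 z) (c2 z)).
Qed.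

Lemma is_derive_mul_flat f k m c z i : smooth f ->
  is_derive z (delta_mx ord0 i) (fun z => k * (f z * flat d m c (ycoord z)))
   (k * (partial i f z * flat d m c (ycoord z)) +
    (k * (i == ord_max)%:R * c) * (f z * flat d m.+1 (c - 1) (ycoord z)) +
    (k * (i == ord_max)%:R * 2 * d) * (f z * flat d m.+1 (c - 3) (ycoord z))).
Proof.
move=> sf.
have df : is_derive z (delta_mx ord0 i) f (partial i f z).
  exact/derivableP/smooth_derivable.
have := is_deriveZ k (is_deriveM df (is_derive_flat_ycoord m c z i)).
by move=> /is_derive_eq; apply; rewrite /GRing.scale/=; ring.
Qed.

Lemma flat_span_derivable g z i : flat_span g -> derivable g z (delta_mx ord0 i).
Proof.
elim=> [k f m c sf|f1 f2 _ d1 _ d2]; last exact: derivableD.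
by have [] := is_derive_mul_flat k m c z i sf.
Qed.

Lemma flat_span_partial g i : flat_span g -> flat_span (partial i g).
Proof.
elim=> [k f m c sf|f1 f2 s1 d1 s2 d2]; last first.
  rewrite (_ : partial i _ = partial i f1 + partial i f2); first exact: flat_span_add.
  by apply/funext => z; apply: deriveD; exact: flat_span_derivable.
rewrite (_ : partial i _ =
  (fun z => k * (partial i f z * flat d m c (ycoord z))) +
  (fun z => (k * (i == ord_max)%:R * c) * (f z * flat d m.+1 (c - 1) (ycoord z))) +
  (fun z => (k * (i == ord_max)%:R * 2 * d) * (f z * flat d m.+1 (c - 3) (ycoord z)))).
  apply: flat_span_add; last exact: flat_span_mul.
  by apply: flat_span_add; apply: flat_span_mul; [exact: smooth_partial|].
apply/funext => z; have [_ E] := is_derive_mul_flat k m c z i sf; exact: E.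
Qed.

Lemma flat_span_smooth g : flat_span g -> smooth g.
Proof.
move=> sg s /=.
have : flat_span (foldr partial g s) by elim: s => //= i s; exact: flat_span_partial.
by move=> h; split=> [|i z]; [exact: flat_span_continuous|exact: flat_span_derivable].
Qed.

(** This is how approximants and test functions are made: multiplying by a flat
function removes the singularity of a power of $|y|$ on the hyperplane. *)
Lemma smooth_mul_flat f m c : smooth f ->
  smooth (fun z => f z * flat d m c (ycoord z)).
Proof.
move=> sf; have := flat_span_smooth (flat_span_mul 1 m c sf).
rewrite (_ : (fun z => 1 * _) = (fun z => f z * flat d m c (ycoord z)))//.
by apply/funext => z; rewrite mul1r.
Qed.

Lemma partial_mul_flat f m c i z : smooth f ->
  partial i (fun z => f z * flat d m c (ycoord z)) z =
  partial i f z * flat d m c (ycoord z) +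
  (i == ord_max)%:R * f z *
    (c * flat d m.+1 (c - 1) (ycoord z) + 2 * d * flat d m.+1 (c - 3) (ycoord z)).
Proof.
move=> sf.
have df : is_derive z (delta_mx ord0 i) f (partial i f z).
  exact/derivableP/smooth_derivable.
have := is_deriveM df (is_derive_flat_ycoord m c z i).
move=> -[_ E]; etransitivity; first exact: E.
by rewrite /GRing.scale/=; ring.
Qed.

End smooth_flat.

(** * The energy *)

Section integral_bounds.
Context d (T : measurableType d) (R : realType) (mu : {measure set T -> \bar R}).
Context (D : set T) (mD : measurable D).
Implicit Types (f g : T -> R).
Local Open Scope ereal_scope.

Lemma ae_ge0_le_integralD f g1 g2 (c1 c2 : R) :
  measurable_fun D f -> measurable_fun D g1 -> measurable_fun D g2 ->
  (forall z, D z -> 0 <= f z)%R -> (forall z, D z -> 0 <= g1 z)%R ->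
  (forall z, D z -> 0 <= g2 z)%R -> (0 <= c1)%R -> (0 <= c2)%R ->
  {ae mu, forall z, D z -> (f z <= c1 * g1 z + c2 * g2 z)%R} ->
  \int[mu]_(z in D) (f z)%:E <=
  c1%:E * \int[mu]_(z in D) (g1 z)%:E + c2%:E * \int[mu]_(z in D) (g2 z)%:E.
Proof.
move=> mf mg1 mg2 f0 g10 g20 c10 c20 fg.
have mc g c : measurable_fun D g -> measurable_fun D (fun z => (c * g z)%:E).
  by move=> mg; apply/measurable_EFinP; exact: measurable_funM.
have h1 z : D z -> 0 <= (g1 z)%:E by move=> Dz; rewrite lee_fin g10.
have h2 z : D z -> 0 <= (g2 z)%:E by move=> Dz; rewrite lee_fin g20.
have m1 : measurable_fun D (EFin \o g1) by exact/measurable_EFinP.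
have m2 : measurable_fun D (EFin \o g2) by exact/measurable_EFinP.
rewrite -(ge0_integralZl_EFin mu mD h1 m1 c10) -(ge0_integralZl_EFin mu mD h2 m2 c20).
rewrite -(ge0_integralD mu mD); last 4 first.
- by move=> z Dz; rewrite -EFinM lee_fin mulr_ge0// g10.
- exact: mc.
- by move=> z Dz; rewrite -EFinM lee_fin mulr_ge0// g20.
- exact: mc.
apply: ae_ge0_le_integral => //.
- exact/measurable_EFinP.
- by move=> z Dz; rewrite -!EFinM -EFinD lee_fin addr_ge0// mulr_ge0// (g10, g20).
- by apply: emeasurable_funD; exact: mc.
Qed.

Lemma ge0_le_integralD f g1 g2 (c1 c2 : R) :
  measurable_fun D f -> measurable_fun D g1 -> measurable_fun D g2 ->
  (forall z, D z -> 0 <= f z)%R -> (forall z, D z -> 0 <= g1 z)%R ->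
  (forall z, D z -> 0 <= g2 z)%R -> (0 <= c1)%R -> (0 <= c2)%R ->
  (forall z, D z -> f z <= c1 * g1 z + c2 * g2 z)%R ->
  \int[mu]_(z in D) (f z)%:E <=
  c1%:E * \int[mu]_(z in D) (g1 z)%:E + c2%:E * \int[mu]_(z in D) (g2 z)%:E.
Proof.
move=> mf mg1 mg2 f0 g10 g20 c10 c20 fg; apply: ae_ge0_le_integralD => //.
exact: nearW.
Qed.

Lemma bounded_integral_lty f (C : R) : mu D < +oo -> measurable_fun D f ->
  (forall z, D z -> 0 <= f z <= C)%R -> \int[mu]_(z in D) (f z)%:E < +oo.
Proof.
move=> Doo mf fC; apply: (@le_lt_trans _ _ (\int[mu]_(z in D) (cst (`|C|%R%:E) z))).
  apply: ge0_le_integral => //.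
  - by move=> z Dz; rewrite lee_fin; have /andP[] := fC _ Dz.
  - exact/measurable_EFinP.
  - move=> z Dz; rewrite lee_fin; have /andP[_ fzC] := fC _ Dz.
    exact: le_trans fzC (ler_norm _).
by rewrite integral_cst// lte_mul_pinfty// lee_fin.
Qed.

End integral_bounds.

Section energy.
Context {R : realType} {n : nat}.
Implicit Types (Om : set 'rV[R]_n.+1) (u phi : 'rV[R]_n.+1 -> R)
  (U : 'I_n.+1 -> 'rV[R]_n.+1 -> R).

Definition sqjet u U (z : 'rV[R]_n.+1) : R := u z ^+ 2 + \sum_i U i z ^+ 2.

Lemma sqjet_ge0 u U z : 0 <= sqjet u U z.
Proof. by rewrite addr_ge0 ?sqr_ge0// sumr_ge0// => i _; exact: sqr_ge0. Qed.

Lemma measurable_sqjet Om u U : measurable_fun Om u ->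
  (forall i, measurable_fun Om (U i)) -> measurable_fun Om (sqjet u U).
Proof.
move=> mu mU; apply: measurable_funD; first exact: measurable_funX.
by apply: measurable_sum => i; exact: measurable_funX.
Qed.

Lemma measurable_weight_sqjet b Om u U : measurable_fun Om u ->
  (forall i, measurable_fun Om (U i)) ->
  measurable_fun Om (fun z => weight b z * sqjet u U z).
Proof.
move=> mu mU; apply: measurable_funM; last exact: measurable_sqjet.
by apply: measurable_funTS; exact: measurable_weight.
Qed.

Lemma weight_sqjet_ge0 b u U z : 0 <= weight b z * sqjet u U z.
Proof. by rewrite mulr_ge0 ?weight_ge0 ?sqjet_ge0. Qed.

(** The square of the norm of $H^{1,b}$, as a single integral. *)
Definition energy (b : R) Om u U : \bar R :=
  (\int[lebesgue_rV n.+1]_(z in Om) (weight b z * sqjet u U z)%:E)%E.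

Lemma energy_ge0 b Om u U : (0 <= energy b Om u U)%E.
Proof. by apply: integral_ge0 => z _; rewrite lee_fin weight_sqjet_ge0. Qed.

Local Open Scope ereal_scope.

Lemma H1normE b Om u U : measurable Om -> measurable_fun Om u ->
  (forall i, measurable_fun Om (U i)) ->
  H1norm b Om u U = energy b Om u U `^ 2^-1.
Proof.
move=> mOm mu mU; rewrite /H1norm /energy -ge0_integralD//.
- by congr (_ `^ _); apply: eq_integral => z _; rewrite /sqjet mulrDr.
- by move=> z _; rewrite lee_fin mulr_ge0 ?weight_ge0 ?sqr_ge0.
- apply/measurable_EFinP/measurable_funM; last exact: measurable_funX.
  by apply: measurable_funTS; exact: measurable_weight.
- move=> z _; rewrite lee_fin mulr_ge0 ?weight_ge0// sumr_ge0// => i _.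
  exact: sqr_ge0.
- apply/measurable_EFinP/measurable_funM.
    by apply: measurable_funTS; exact: measurable_weight.
  by apply: measurable_sum => i; exact: measurable_funX.
Qed.

Lemma poweR_half_lt (x : \bar R) (e : R) : (0 < e)%R -> 0 <= x ->
  (x `^ 2^-1 < e%:E) = (x < (e ^+ 2)%:E).
Proof.
move=> e0; case: x => [x|_|//]; last by rewrite poweRyr// invr_eq0.
rewrite lee_fin => x0; rewrite poweR_EFin !lte_fin powR12_sqrt//.
have e2 : (0 < e ^+ 2)%R by rewrite exprn_gt0.
by rewrite -[X in (_ < X)%R = _](ger0_norm (ltW e0)) -sqrtr_sqr ltr_sqrt.
Qed.

Lemma poweR_half_lty (x : \bar R) : 0 <= x -> (x `^ 2^-1 < +oo) = (x < +oo).
Proof.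
by case: x => [x|_|//]; rewrite ?poweR_EFin ?ltry// poweRyr ?invr_eq0.
Qed.

Lemma measurable_gradient Om phi i : smooth phi ->
  measurable_fun Om (gradient phi i).
Proof. by move=> sphi; apply: measurable_funTS; exact: measurable_partial. Qed.

(** The exponent $1/2$ of the norm is removed by squaring the tolerance. *)
Lemma in_H1_energyP b Om u U : measurable Om ->
  in_H1_with_gradient b Om u U <->
  [/\ measurable_fun Om u, forall i, measurable_fun Om (U i) &
      forall e : R, (0 < e)%R -> exists phi, [/\ smooth phi,
        energy b Om phi (gradient phi) < +oo &
        energy b Om (fun z => u z - phi z)%R
          (fun i z => U i z - gradient phi i z)%R < e%:E]].
Proof.
move=> mOm; split=> -[mu mU H]; split=> // e e0.
  have se0 : (0 < Num.sqrt e)%R by rewrite sqrtr_gt0.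
  have [phi [sphi phioo Hphi]] := H _ se0; exists phi.
  have mphi : measurable_fun Om phi.
    by apply: measurable_funTS; exact: measurable_smooth.
  have mg i : measurable_fun Om (gradient phi i) by exact: measurable_gradient.
  split=> //; first by move: phioo; rewrite H1normE// poweR_half_lty// energy_ge0.
  move: Hphi; rewrite H1normE//.
  - by rewrite poweR_half_lt// ?energy_ge0// sqr_sqrtr// ltW.
  - exact: measurable_funB.
  - by move=> i; exact: measurable_funB.
have [|phi [sphi phioo Hphi]] := H (e ^+ 2)%R; first by rewrite exprn_gt0.
exists phi.
have mphi : measurable_fun Om phi.
  by apply: measurable_funTS; exact: measurable_smooth.
have mg i : measurable_fun Om (gradient phi i) by exact: measurable_gradient.
split=> //; first by rewrite H1normE// poweR_half_lty// energy_ge0.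
rewrite H1normE//.
- by rewrite poweR_half_lt// energy_ge0.
- exact: measurable_funB.
- by move=> i; exact: measurable_funB.
Qed.

Lemma sqr_le_sub (x y : R) : (x ^+ 2 <= 2 * (x - y) ^+ 2 + 2 * y ^+ 2)%R.
Proof. by rewrite -subr_ge0 (_ : _ - _ = (x - 2 * y) ^+ 2)%R ?sqr_ge0//; ring. Qed.

Lemma sqjet_le_sub u U phi V z : (sqjet u U z <=
  2 * sqjet (fun z => u z - phi z) (fun i z => U i z - V i z) z +
  2 * sqjet phi V z)%R.
Proof.
rewrite /sqjet !mulrDr addrACA lerD ?sqr_le_sub//.
by rewrite !mulr_sumr -big_split/=; apply: ler_sum => i _; exact: sqr_le_sub.
Qed.

Lemma energy_lty b Om u U : measurable Om -> in_H1_with_gradient b Om u U ->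
  energy b Om u U < +oo.
Proof.
move=> mOm /(in_H1_energyP _ _ _ mOm)[mu mU /(_ 1%R ltr01)[phi [sphi phioo Hphi]]].
have mphi : measurable_fun Om phi.
  by apply: measurable_funTS; exact: measurable_smooth.
have mg i : measurable_fun Om (gradient phi i) by exact: measurable_gradient.
apply: (@le_lt_trans _ _ (2%:E * energy b Om (fun z => u z - phi z)%R
          (fun i z => U i z - gradient phi i z)%R +
          2%:E * energy b Om phi (gradient phi))); last first.
  rewrite lte_add_pinfty// lte_mul_pinfty//.
  by apply: lt_trans Hphi _; rewrite ltry.
apply: ge0_le_integralD => //; try by move=> z _; exact: weight_sqjet_ge0.
- exact: measurable_weight_sqjet.
- apply: measurable_weight_sqjet; first exact: measurable_funB.
  by move=> i; exact: measurable_funB.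
- exact: measurable_weight_sqjet.
- move=> z _; rewrite mulrCA [X in (_ <= _ + X)%R]mulrCA -mulrDr.
  by rewrite ler_wpM2l ?weight_ge0//; exact: sqjet_le_sub.
Qed.

Lemma energyS b Om Om' u U : measurable Om -> measurable Om' -> Om' `<=` Om ->
  measurable_fun Om u -> (forall i, measurable_fun Om (U i)) ->
  energy b Om' u U <= energy b Om u U.
Proof.
move=> mOm mOm' sub mu mU; apply: ge0_subset_integral => //.
  by apply/measurable_EFinP; exact: measurable_weight_sqjet.
by move=> z _; rewrite lee_fin weight_sqjet_ge0.
Qed.

Lemma in_H1_with_gradientS b Om Om' u U : measurable Om -> measurable Om' ->
  Om' `<=` Om -> in_H1_with_gradient b Om u U -> in_H1_with_gradient b Om' u U.
Proof.
move=> mOm mOm' sub /(in_H1_energyP _ _ _ mOm)[mu mU H].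
apply/(in_H1_energyP _ _ _ mOm'); split=> [|i|e /H[phi [sphi phioo Hphi]]].
- exact: measurable_funS mu.
- exact: measurable_funS (mU i).
have mphi : measurable_fun Om phi.
  by apply: measurable_funTS; exact: measurable_smooth.
have mg i : measurable_fun Om (gradient phi i) by exact: measurable_gradient.
exists phi; split=> //.
  by apply: le_lt_trans phioo; exact: energyS.
apply: le_lt_trans Hphi; apply: energyS => //; first exact: measurable_funB.
by move=> i; exact: measurable_funB.
Qed.

End energy.

(** * Hardy's inequality for odd functions *)

Section hardy.
Context {R : realType} (n : nat) (a : R).
Hypothesis a1 : a < 1.
Local Notation mu := (@lebesgue_rV R n.+1).
Local Notation B := (@eball R n 1).
Local Notation K := (4 / (1 - a) ^+ 2).
Implicit Types (phi u : 'rV[R]_n.+1 -> R).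

Let K_ge0 : 0 <= K. Proof. by rewrite divr_ge0// sqr_ge0. Qed.

(** For $a \le 0$ the power is decreasing. For $a > 0$ the shift is absorbed by the
factor $2 \ge 2^a$ where $d \le y$, and by $C$ where $y < d$. *)
Lemma powR_shift_le (e C : R) : 0 < e -> 0 < C ->
  exists d : R, [/\ 0 < d, d <= e & forall y, 0 < y -> (y + d) `^ a <= 2 * y `^ a + C].
Proof.
move=> e0 C0; have [a0|a0] := leP a 0.
  exists e; split=> // y y0.
  apply: (@le_trans _ _ (y `^ a)); last by have := powR_ge0 y a; lra.
  rewrite -[a]opprK [leLHS]powRN [leRHS]powRN lef_pV2 ?posrE ?powR_gt0//; last lra.
  by apply: ge0_ler_powR; rewrite ?nnegrE; lra.
have two_pow y : 0 <= y -> (2 * y) `^ a <= 2 * y `^ a.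
  move=> y0; rewrite powRM// ler_wpM2r ?powR_ge0//.
  by apply: ler1_powR; [lra|exact: ltW].
exists (Num.min e ((C / 2) `^ a^-1)); split.
- by rewrite lt_min e0 powR_gt0// divr_gt0.
- by rewrite ge_min lexx.
move=> y y0; set d := Num.min _ _.
have d0 : 0 < d by rewrite lt_min e0 powR_gt0// divr_gt0.
have dC : 2 * d `^ a <= C.
  rewrite mulrC -ler_pdivlMr//.
  have -> : C / 2 = ((C / 2) `^ a^-1) `^ a.
    by rewrite -powRrM mulVf ?gt_eqF// powRr1// ltW// divr_gt0.
  by apply: ge0_ler_powR; rewrite ?nnegrE ?powR_ge0 ?(ltW a0) ?(ltW d0)// ge_min lexx orbT.
have [dy|yd] := leP d y.
  apply: (@le_trans _ _ (2 * y `^ a)); last by lra.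
  apply: le_trans (two_pow _ (ltW y0)).
  by apply: ge0_ler_powR; rewrite ?nnegrE; lra.
apply: (@le_trans _ _ C); last by have := powR_ge0 y a; lra.
apply: le_trans dC; apply: le_trans (two_pow _ (ltW d0)).
by apply: ge0_ler_powR; rewrite ?nnegrE; lra.
Qed.

Definition odd_part phi z : R := (phi z - phi (yflip z)) / 2.

Definition odd_part_dy phi z : R :=
  (partial ord_max phi z + partial ord_max phi (yflip z)) / 2.

Lemma odd_part_yflip phi z : odd_part phi (yflip z) = - odd_part phi z.
Proof. by rewrite /odd_part yflipK -mulNr opprB. Qed.

Lemma odd_part_dy_yflip phi z : odd_part_dy phi (yflip z) = odd_part_dy phi z.
Proof. by rewrite /odd_part_dy yflipK addrC. Qed.

Lemma measurable_odd_part phi D : smooth phi -> measurable_fun D (odd_part phi).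
Proof.
move=> sphi; have m := measurable_smooth sphi; apply: measurable_funTS.
apply: measurable_funM => //; apply: measurable_funB => //.
exact: (measurableT_comp m (@measurable_yflip R n)).
Qed.

Lemma measurable_odd_part_dy phi D : smooth phi -> measurable_fun D (odd_part_dy phi).
Proof.
move=> sphi; have m := measurable_partial ord_max sphi; apply: measurable_funTS.
apply: measurable_funM => //; apply: measurable_funD => //.
exact: (measurableT_comp m (@measurable_yflip R n)).
Qed.

Lemma is_derive_odd_part phi (x : 'rV[R]_n) (t : R) : smooth phi ->
  is_derive t 1 (fun t => odd_part phi (snoc_rV (x, t))) (odd_part_dy phi (snoc_rV (x, t))).
Proof.
move=> sphi.
have d1 := is_derive_slice x t sphi.
have d2 := @is_derive1_comp R _ -%R t _ _ (is_derive_slice x (- t) sphi) (is_deriveNid t 1).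
have -> : (fun t => odd_part phi (snoc_rV (x, t))) =
    2^-1 \*: ((fun t => phi (snoc_rV (x, t))) - ((fun t => phi (snoc_rV (x, t))) \o -%R)).
  by apply/funext => s; rewrite /odd_part yflip_snoc /GRing.scale/= mulrC.
have := is_deriveZ 2^-1 (is_deriveB d1 d2).
move=> /is_derive_eq; apply.
by rewrite /odd_part_dy yflip_snoc /GRing.scale/= mulrN1 opprK mulrC.
Qed.

Lemma continuous_odd_part_dy phi (x : 'rV[R]_n) : smooth phi ->
  continuous (fun t : R => odd_part_dy phi (snoc_rV (x, t))).
Proof.
move=> sphi.
have c := continuous_slice (x := x) (continuous_partial (i := ord_max) sphi).
have -> : (fun t => odd_part_dy phi (snoc_rV (x, t))) =
    (fun t => (partial ord_max phi (snoc_rV (x, t)) +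
               (partial ord_max phi (snoc_rV (x, - t)))) * 2^-1).
  by apply/funext => s; rewrite /odd_part_dy yflip_snoc.
move=> t; apply: cvgM; last exact: cvg_cst.
apply: cvgD; first exact: c.
by apply: (@continuous_comp _ _ _ -%R (fun t => partial ord_max phi (snoc_rV (x, t))));
  [exact: opp_continuous|exact: c].
Qed.

Local Open Scope ereal_scope.

(** The slices of the ball are intervals around the origin; the integrands are
even, so that it suffices to treat the upper half of each slice, where the
one-dimensional inequality applies because an odd function vanishes at 0. *)
Lemma hardy_odd_part phi (d : R) : smooth phi -> (0 < d)%R ->
  \int[mu]_(z in B) ((`|ycoord z| + d) `^ (a - 2) * odd_part phi z ^+ 2)%:E <=
  K%:E * \int[mu]_(z in B) ((`|ycoord z| + d) `^ a * odd_part_dy phi z ^+ 2)%:E.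
Proof.
move=> sphi d0; have mB := @measurable_eball R n 1.
have mpow p : measurable_fun setT (fun z : 'rV[R]_n.+1 => (`|ycoord z| + d) `^ p)%R.
  apply: (@measurableT_comp _ _ _ _ _ _ (fun x => x `^ p)%R).
    exact: measurable_powR.
  apply: measurable_funD => //.
  by apply: (measurableT_comp (@normr_measurable R setT)); exact: measurable_coord.
pose F z := ((`|ycoord z| + d) `^ (a - 2) * odd_part phi z ^+ 2)%R.
pose G z := ((`|ycoord z| + d) `^ a * odd_part_dy phi z ^+ 2)%R.
have mF : measurable_fun setT F.
  by apply: measurable_funM => //; apply: measurable_funX; exact: measurable_odd_part.
have mG : measurable_fun setT G.
  by apply: measurable_funM => //; apply: measurable_funX; exact: measurable_odd_part_dy.
have F0 z : (0 <= F z)%R by rewrite mulr_ge0 ?powR_ge0 ?sqr_ge0.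
have G0 z : (0 <= G z)%R by rewrite mulr_ge0 ?powR_ge0 ?sqr_ge0.
rewrite -ge0_integralZl_EFin//; last 2 first.
- by move=> z _; rewrite lee_fin G0.
- by apply/measurable_EFinP/measurable_funTS.
rewrite 2![integral _ B _]integral_mkcond.
pose FB := (fun z => (F z)%:E) \_ B; pose GB := (fun z => (K * G z)%:E) \_ B.
rewrite -/FB (_ : (fun z => K%:E * _) \_ B = GB)//.
have FB0 z : 0 <= FB z by rewrite /FB patchE; case: ifP => // _; rewrite lee_fin.
have GB0 z : 0 <= GB z.
  by rewrite /GB patchE; case: ifP => // _; rewrite lee_fin mulr_ge0.
have mFB : measurable_fun setT FB.
  by apply/(measurable_restrictT _ _).1 => //; apply/measurable_EFinP/measurable_funTS.
have mGB : measurable_fun setT GB.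
  apply/(measurable_restrictT _ _).1 => //; apply/measurable_EFinP/measurable_funTS.
  exact: measurable_funM.
rewrite (ge0_integral_slices mFB FB0) (ge0_integral_slices mGB GB0).
have mslice (H : 'rV[R]_n.+1 -> \bar R) x : measurable_fun setT H ->
    measurable_fun setT (fun t => H (snoc_rV (x, t))).
  move=> mH; apply: (measurableT_comp mH).
  by apply: (measurableT_comp (@measurable_snoc_rV R n)); exact: pair1_measurable.
apply: ge0_le_integral => //.
- by move=> x _; exact: integral_ge0.
- apply: (measurable_fun_fubini_tonelli_F (fun p => FB (snoc_rV p))) => //.
  exact: (measurableT_comp mFB (@measurable_snoc_rV R n)).
- apply: (measurable_fun_fubini_tonelli_F (fun p => GB (snoc_rV p))) => //.
  exact: (measurableT_comp mGB (@measurable_snoc_rV R n)).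
move=> x _.
rewrite ge0_integral_sym//; last exact: mslice.
rewrite [leRHS]ge0_integral_sym//; last exact: mslice.
have BN t : (snoc_rV (x, (- t)%R) \in B) = (snoc_rV (x, t) \in B).
  rewrite -yflip_snoc; apply/idP/idP; rewrite !inE => h; last by apply/eball_yflip.
  by apply/eball_yflip.
have FN t : FB (snoc_rV (x, (- t)%R)) = FB (snoc_rV (x, t)).
  rewrite /FB !patchE BN; congr (if _ then _%:E else _).
  by rewrite /F -yflip_snoc odd_part_yflip ycoord_yflip normrN sqrrN.
have GN t : GB (snoc_rV (x, (- t)%R)) = GB (snoc_rV (x, t)).
  rewrite /GB !patchE BN; congr (if _ then _%:E else _).
  by rewrite /G -yflip_snoc odd_part_dy_yflip ycoord_yflip normrN.
under [X in _ + X <= _]eq_integral do rewrite FN.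
under [X in _ <= _ + X]eq_integral do rewrite GN.
suff h : \int[lebesgue_measure]_(t in `[0%R, +oo[) FB (snoc_rV (x, t)) <=
    \int[lebesgue_measure]_(t in `[0%R, +oo[) GB (snoc_rV (x, t)).
  exact: leeD.
pose p : R := (\sum_i x ord0 i ^+ 2)%R.
have p0 : (0 <= p)%R by apply: sumr_ge0 => i _; exact: sqr_ge0.
have [p1|p1] := leP 1%R p.
  rewrite [leLHS]integral0_eq; first exact: integral_ge0.
  move=> t _; rewrite /FB patchE; case: ifPn => [|//].
  rewrite inE eballE// /= sumsqr_snoc -/p expr1n => h; exfalso.
  by have := sqr_ge0 t; lra.
pose h := Num.sqrt (1 - p); have h0 : (0 < h)%R by rewrite sqrtr_gt0 subr_gt0.
have Bh t : (0 <= t)%R -> (snoc_rV (x, t) \in B) = (t < h)%R.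
  move=> t0; apply/idP/idP.
    rewrite inE eballE// /= sumsqr_snoc -/p expr1n => pt.
    rewrite -[ltLHS]ger0_norm// -sqrtr_sqr /h ltr_sqrt ?subr_gt0//; lra.
  rewrite -[ltLHS]ger0_norm// -sqrtr_sqr /h ltr_sqrt ?subr_gt0// => pt.
  by rewrite inE eballE// /= sumsqr_snoc -/p expr1n; lra.
have slice (H : 'rV[R]_n.+1 -> R) : measurable_fun setT H ->
    \int[lebesgue_measure]_(t in `[0%R, +oo[)
      ((fun z => (H z)%:E) \_ B) (snoc_rV (x, t)) =
    \int[lebesgue_measure]_(t in `[0%R, h]) (H (snoc_rV (x, t)))%:E.
  move=> mH; rewrite -integral_itv_bndo_bndc; last first.
    by apply: measurable_funTS; apply: (mslice (fun z => (H z)%:E)); exact/measurable_EFinP.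
  rewrite integral_mkcond [RHS]integral_mkcond; apply: eq_integral => t _.
  rewrite !patchE; have [t0|t0] := ltP t 0%R.
    by rewrite !ifF// ?inE/=; apply/negbTE; rewrite notin_setE/= in_itv/= => /andP[]; lra.
  rewrite ifT; last by rewrite inE/= in_itv/= t0.
  rewrite Bh//; congr (if _ then _ else _).
  by apply/idP/idP; rewrite inE/= in_itv/= t0.
rewrite slice// (slice (fun z => K * G z)%R); last exact: measurable_funM.
have cpow q t : t \in `[0%R, h] -> {for t, continuous (fun y : R => (y + d) `^ q)%R}.
  by rewrite in_itv/= => /andP[t0 _]; apply: continuous_powR_shift; lra.
have dv t := is_derive_odd_part x t sphi.
have cdv := continuous_odd_part_dy (x := x) sphi.
have v0 : odd_part phi (snoc_rV (x, 0%R)) = 0%R.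
  by rewrite /odd_part yflip_snoc oppr0 subrr mul0r.
have := hardy1 a1 d0 (ltW h0) dv cdv v0.
have cv := continuous_is_derive dv.
have iF : lebesgue_measure.-integrable `[0%R, h]
    (fun t => ((t + d) `^ (a - 2) * odd_part phi (snoc_rV (x, t)) ^+ 2)%:E).
  apply: (@integrable_itv_continuous R (fun t => (t + d) `^ (a - 2) * odd_part phi (snoc_rV (x, t)) ^+ 2)%R).
  by move=> t th; apply: cvgM; [exact: cpow|apply: cvgM; exact: cv].
have iG : lebesgue_measure.-integrable `[0%R, h]
    (fun t => ((t + d) `^ a * odd_part_dy phi (snoc_rV (x, t)) ^+ 2)%:E).
  apply: (@integrable_itv_continuous R (fun t => (t + d) `^ a * odd_part_dy phi (snoc_rV (x, t)) ^+ 2)%R).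
  by move=> t th; apply: cvgM; [exact: cpow|apply: cvgM; exact: cdv].
rewrite -lee_fin EFinM !fineK; [|exact: integrable_fin_num..].
have iG0 (t : R) : `[0%R, h]%classic t ->
    0 <= ((t + d) `^ a * odd_part_dy phi (snoc_rV (x, t)) ^+ 2)%:E.
  by move=> _; rewrite lee_fin mulr_ge0 ?powR_ge0 ?sqr_ge0.
have miG := (integrableP _ _ _ iG).1.
have tE t : t \in `[0%R, h] -> `|t|%R = t.
  by rewrite in_itv/= => /andP[t0 _]; rewrite ger0_norm.
move=> hle.
have <- : K%:E * \int[lebesgue_measure]_(t in `[0%R, h])
     ((t + d) `^ a * odd_part_dy phi (snoc_rV (x, t)) ^+ 2)%:E =
   \int[lebesgue_measure]_(t in `[0%R, h]) (K * G (snoc_rV (x, t)))%:E.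
  transitivity (\int[lebesgue_measure]_(t in `[0%R, h])
      (K%:E * ((t + d) `^ a * odd_part_dy phi (snoc_rV (x, t)) ^+ 2)%:E)).
    by apply/esym; apply: ge0_integralZl_EFin => //; exact: measurable_itv.
  by apply: eq_integral => t; rewrite inE/= => /tE tE'; rewrite /G ycoord_snoc tE'.
apply: le_trans hle; rewrite le_eqVlt; apply/orP; left; apply/eqP.
by apply: eq_integral => t; rewrite inE/= => /tE tE'; rewrite /F ycoord_snoc tE'.
Qed.

Lemma measurable_eball_yflip (f : 'rV[R]_n.+1 -> R) :
  measurable_fun B f -> measurable_fun B (f \o @yflip R n).
Proof.
move=> mf; apply: (measurable_comp _ _ mf).
- exact: measurable_eball.
- by move=> _ [z zB <-]; apply/eball_yflip.
- by apply: measurable_funTS; exact: measurable_yflip.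
Qed.

Lemma ge0_integral_eball_yflip (f : 'rV[R]_n.+1 -> R) :
  measurable_fun B f -> (forall z, B z -> 0 <= f z)%R ->
  \int[mu]_(z in B) (f (yflip z))%:E = \int[mu]_(z in B) (f z)%:E.
Proof.
move=> mf f0; have mB := @measurable_eball R n 1.
pose F := (fun z => (f z)%:E) \_ B.
have F0 z : 0 <= F z.
  by rewrite /F patchE; case: ifPn => [/set_mem zB|//]; rewrite lee_fin f0.
have mF : measurable_fun setT F.
  by apply/(measurable_restrictT _ _).1 => //; exact/measurable_EFinP.
rewrite integral_mkcond [RHS]integral_mkcond -/F -(ge0_integral_yflip mF F0).
apply: eq_integral => z _; rewrite /F !patchE.
suff -> : (yflip z \in B) = (z \in B) by [].
by apply/idP/idP; rewrite !inE => /eball_yflip.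
Qed.

Lemma ae_integral_leD (f g1 g2 : 'rV[R]_n.+1 -> R) (c1 c2 m1 m2 : R) :
  measurable_fun B f -> measurable_fun B g1 -> measurable_fun B g2 ->
  (forall z, B z -> 0 <= f z)%R -> (forall z, B z -> 0 <= g1 z)%R ->
  (forall z, B z -> 0 <= g2 z)%R -> (0 <= c1)%R -> (0 <= c2)%R ->
  {ae mu, forall z, B z -> (f z <= c1 * g1 z + c2 * g2 z)%R} ->
  \int[mu]_(z in B) (g1 z)%:E <= m1%:E -> \int[mu]_(z in B) (g2 z)%:E <= m2%:E ->
  \int[mu]_(z in B) (f z)%:E <= (c1 * m1 + c2 * m2)%:E.
Proof.
move=> mf mg1 mg2 f0 g10 g20 c10 c20 fg gm1 gm2.
apply: le_trans (ae_ge0_le_integralD (@measurable_eball R n 1)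
  mf mg1 mg2 f0 g10 g20 c10 c20 fg) _.
by rewrite EFinD !EFinM leeD// lee_wpmul2l.
Qed.

Lemma integral_weight_sqr_le b u (U : 'I_n.+1 -> 'rV[R]_n.+1 -> R) :
  measurable_fun B u -> (forall i, measurable_fun B (U i)) ->
  \int[mu]_(z in B) (weight b z * u z ^+ 2)%:E <= energy b B u U /\
  forall i, \int[mu]_(z in B) (weight b z * U i z ^+ 2)%:E <= energy b B u U.
Proof.
move=> mu' mU; have mB := @measurable_eball R n 1.
have mw : measurable_fun B (weight b).
  by apply: measurable_funTS; exact: measurable_weight.
split=> [|i]; apply: ge0_le_integral => //.
- by move=> z _; rewrite lee_fin mulr_ge0 ?weight_ge0 ?sqr_ge0.
- by apply/measurable_EFinP/measurable_funM => //; exact: measurable_funX.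
- by apply/measurable_EFinP; exact: measurable_weight_sqjet.
- move=> z _; rewrite lee_fin ler_wpM2l ?weight_ge0// lerDl.
  by apply: sumr_ge0 => i _; exact: sqr_ge0.
- by move=> z _; rewrite lee_fin mulr_ge0 ?weight_ge0 ?sqr_ge0.
- by apply/measurable_EFinP/measurable_funM => //; exact: measurable_funX.
- by apply/measurable_EFinP; exact: measurable_weight_sqjet.
- move=> z _; rewrite lee_fin ler_wpM2l ?weight_ge0// /sqjet (bigD1 i)//= addrCA.
  by rewrite lerDl addr_ge0 ?sqr_ge0// sumr_ge0// => j _; exact: sqr_ge0.
Qed.

(** Hardy's inequality in the weighted Sobolev space. Smooth approximants of $u$
need not be odd, but their odd parts are, and approximate $u$ at least as well.
For them the inequality holds with the weight $(|y| + d)^a$. Since $|y|^{a-2}$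
is not controlled by $|y|^a$ near the hyperplane, the integral is truncated to
$|y| \ge e$ with $e = 1/(k+1)$: there $|y|^{a-2} \le e^{-2} |y|^a$, so an
approximant with error $e^2$ gives a bound that does not depend on $k$, and
Fatou's lemma concludes. The shift $d$ is chosen after the approximant, to
replace $(|y| + d)^a$ by $2 |y|^a$ up to a small error. *)
Lemma hardy u U : in_H1_with_gradient a B u U -> odd_in_y B u ->
  \int[mu]_(z in B) (weight (a - 2) z * u z ^+ 2)%:E < +oo.
Proof.
move=> uH1 uodd; have mB := @measurable_eball R n 1.
have Eoo := energy_lty mB uH1.
have [mu' mU H] := (in_H1_energyP _ _ _ mB).1 uH1.
pose e0 := fine (energy a B u U).
have e0E : energy a B u U = e0%:E by rewrite /e0 fineK// ge0_fin_numE// energy_ge0.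
have e00 : (0 <= e0)%R by rewrite /e0 fine_ge0// energy_ge0.
have mw b : measurable_fun B (weight b).
  by apply: measurable_funTS; exact: measurable_weight.
pose M : R := (2 * 1 + 2 * 2 `^ (2 - a) * (K * (2 * (2 * 1 + 2 * e0)) + 1))%R.
apply: (@le_lt_trans _ _ M%:E); last exact: ltry.
pose F (k : nat) (z : 'rV[R]_n.+1) : R :=
  (weight (a - 2) z * u z ^+ 2 * (k.+1%:R^-1 <= `|ycoord z|)%R%:R)%R.
have F0 k z : (0 <= F k z)%R by rewrite /F mulr_ge0 ?ler0n// mulr_ge0 ?weight_ge0 ?sqr_ge0.
have mF k : measurable_fun B (F k).
  apply: measurable_funM.
    by apply: measurable_funM => //; exact: measurable_funX.
  apply: measurable_funTS.
  rewrite (_ : (fun z => _) =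
      \1_((fun z : 'rV[R]_n.+1 => `|ycoord z|%R) @^-1` `[(k.+1%:R^-1)%R, +oo[)); last first.
    apply/funext => z; rewrite indicE; congr (nat_of_bool _)%:R.
    by apply/idP/idP; rewrite inE/= in_itv/= andbT.
  apply: measurable_indic; rewrite -[X in measurable X]setTI.
  have mabs : measurable_fun setT (fun z : 'rV[R]_n.+1 => `|ycoord z|%R).
    by apply: (measurableT_comp (@normr_measurable R setT)); exact: measurable_coord.
  by apply: mabs => //; exact: measurable_itv.
apply: (@fatou_le _ _ _ mu B (fun k z => (F k z)%:E)) => //.
- by move=> k; apply/measurable_EFinP; exact: mF.
- by move=> k z _; rewrite lee_fin F0.
- move=> z _; apply: cvg_EFin; first exact: nearW.
  have [y0|y0] := eqVneq (ycoord z) 0%R.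
    have w0 : weight (a - 2) z = 0%R.
      have a2 : (a - 2 < 0)%R by move: a1; lra.
      by rewrite /weight y0 normr0 powR0// lt_eqF.
    by rewrite /F /comp/= w0 !mul0r; under eq_cvg do rewrite !mul0r; exact: cvg_cst.
  have yp : (0 < `|ycoord z|)%R by rewrite normr_gt0.
  apply: cvg_near_cst; near=> k; rewrite /F /=.
  suff -> : (k.+1%:R^-1 <= `|ycoord z|)%R by rewrite mulr1.
  by apply: ltW; near: k; exact: (near_infty_natSinv_lt (PosNum yp)).
move=> k; pose e : R := (k.+1%:R^-1)%R.
have ep : (0 < e)%R by rewrite invr_gt0.
have ele1 : (e <= 1)%R by rewrite /e invf_le1// ler1n.
have e1 : (e ^+ 2 <= 1)%R by rewrite expr_le1// ltW.
have [|phi [sphi phioo Hphi]] := H (e ^+ 2)%R; first by rewrite exprn_gt0.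
have mphi : measurable_fun B phi.
  by apply: measurable_funTS; exact: measurable_smooth.
have mg i : measurable_fun B (gradient phi i) by exact: measurable_gradient.
have mdu : measurable_fun B (fun z => u z - phi z)%R by exact: measurable_funB.
have mdU i : measurable_fun B (fun z => U i z - gradient phi i z)%R.
  exact: measurable_funB.
have [Hdu HdU] := integral_weight_sqr_le a mdu mdU.
have [_ /(_ ord_max) HU] := integral_weight_sqr_le a mu' mU.
have {}Hdu := le_trans Hdu (ltW Hphi).
have {HdU}HdU := le_trans (HdU ord_max) (ltW Hphi).
have [C [C0 HC]] := bounded_on_eball (continuous_partial (i := ord_max) sphi).
pose mB1 := fine (mu B).
have mB1E : mu B = mB1%:E.
  by rewrite /mB1 fineK// ge0_fin_numE// eball_lty.
have mB10 : (0 <= mB1)%R by rewrite /mB1 fine_ge0.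
pose eta : R := ((K * (C ^+ 2 * mB1) + 1)^-1)%R.
have KC0 : (0 <= K * (C ^+ 2 * mB1))%R by rewrite mulr_ge0// mulr_ge0// sqr_ge0.
have eta0 : (0 < eta)%R by rewrite invr_gt0; lra.
have [d [d0 de Hd]] := powR_shift_le ep eta0.
have mv (D : set 'rV[R]_n.+1) := measurable_odd_part (D := D) sphi.
have mvy (D : set 'rV[R]_n.+1) := measurable_odd_part_dy (D := D) sphi.
have mpow p : measurable_fun B (fun z : 'rV[R]_n.+1 => (`|ycoord z| + d) `^ p)%R.
  apply: measurable_funTS.
  apply: (@measurableT_comp _ _ _ _ _ _ (fun x => x `^ p)%R).
    exact: measurable_powR.
  apply: measurable_funD => //.
  by apply: (measurableT_comp (@normr_measurable R setT)); exact: measurable_coord.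
have wflip b z : weight b (yflip z) = weight b z.
  by rewrite /weight ycoord_yflip normrN.
have m2 (g : 'rV[R]_n.+1 -> R) b : measurable_fun B g ->
    measurable_fun B (fun z => weight b z * g z ^+ 2)%R.
  by move=> mg'; apply: measurable_funM => //; exact: measurable_funX.
have w20 b (z : 'rV[R]_n.+1) (x : R) : (0 <= weight b z * x ^+ 2)%R.
  by rewrite mulr_ge0 ?weight_ge0 ?sqr_ge0.
(* the odd part of the approximant is at least as close to u *)
have duv : \int[mu]_(z in B) (weight a z * (u z - odd_part phi z) ^+ 2)%:E <=
    (2^-1 * e ^+ 2 + 2^-1 * e ^+ 2)%:E.
  pose g z := (weight a z * (u z - phi z) ^+ 2)%R.
  have mg' : measurable_fun B g by exact: m2.
  have g0 z : B z -> (0 <= g z)%R by move=> _; exact: w20.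
  have mf : measurable_fun B (fun z => weight a z * (u z - odd_part phi z) ^+ 2)%R.
    by apply: m2; exact: measurable_funB.
  have half0 : (0 <= 2^-1 :> R)%R by rewrite invr_ge0.
  apply: (ae_integral_leD (g1 := g) (g2 := g \o @yflip R n) mf mg'
    (measurable_eball_yflip mg') (fun z _ => w20 a z _) g0
    (fun z _ => w20 a (yflip z) _) half0 half0).
  - apply: filterS uodd => z uodd zB.
    rewrite /g /= wflip uodd// /odd_part -subr_ge0.
    rewrite [leRHS](_ : _ = weight a z * ((u z - phi z + (- u z - phi (yflip z))) / 2) ^+ 2)%R; last by field.
    exact: w20.
  - exact: Hdu.
  - by rewrite (ge0_integral_eball_yflip mg' g0).
have dyphi : \int[mu]_(z in B) (weight a z * gradient phi ord_max z ^+ 2)%:E <=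
    (2 * 1 + 2 * e0)%:E.
  apply: (@ae_integral_leD _ (fun z => weight a z * (U ord_max z - gradient phi ord_max z) ^+ 2)%R
     (fun z => weight a z * U ord_max z ^+ 2)%R) => //; try exact: m2; try by move=> z _; exact: w20.
  - apply: nearW => z _; rewrite -subr_ge0.
    rewrite [leRHS](_ : _ = weight a z * (2 * U ord_max z - gradient phi ord_max z) ^+ 2)%R; last by field.
    exact: w20.
  - by apply: le_trans HdU _; rewrite lee_fin.
  - by rewrite -e0E.
have dyv : \int[mu]_(z in B) (weight a z * odd_part_dy phi z ^+ 2)%:E <=
    (2^-1 * (2 * 1 + 2 * e0) + 2^-1 * (2 * 1 + 2 * e0))%:E.
  pose g z := (weight a z * gradient phi ord_max z ^+ 2)%R.
  have mg' : measurable_fun B g by exact: m2.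
  have g0 z : B z -> (0 <= g z)%R by move=> _; exact: w20.
  have mf : measurable_fun B (fun z => weight a z * odd_part_dy phi z ^+ 2)%R.
    exact: m2.
  have half0 : (0 <= 2^-1 :> R)%R by rewrite invr_ge0.
  apply: (ae_integral_leD (g1 := g) (g2 := g \o @yflip R n) mf mg'
    (measurable_eball_yflip mg') (fun z _ => w20 a z _) g0
    (fun z _ => w20 a (yflip z) _) half0 half0).
  - apply: nearW => z zB.
    rewrite /g /= wflip /odd_part_dy /gradient -subr_ge0.
    rewrite [leRHS](_ : _ = weight a z * ((partial ord_max phi z - partial ord_max phi (yflip z)) / 2) ^+ 2)%R; last by field.
    exact: w20.
  - exact: dyphi.
  - by rewrite (ge0_integral_eball_yflip mg' g0).
have dyv_bounded : \int[mu]_(z in B) (odd_part_dy phi z ^+ 2)%:E <= (C ^+ 2 * mB1)%:E.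
  rewrite EFinM -mB1E -integral_cst//; apply: ge0_le_integral => //.
  - by move=> z _; rewrite lee_fin sqr_ge0.
  - by apply/measurable_EFinP/measurable_funX.
  - move=> z zB; rewrite lee_fin -real_normK ?num_real//.
    rewrite ler_sqr ?nnegrE ?normr_ge0 ?(ltW C0)// /odd_part_dy normrM.
    rewrite [X in (_ * X)%R]ger0_norm// ler_pdivrMr//.
    apply: le_trans (ler_normD _ _) _.
    have := HC _ zB; have := HC (yflip z) ((eball_yflip _ _).2 zB); lra.
have shifted : \int[mu]_(z in B) ((`|ycoord z| + d) `^ a * odd_part_dy phi z ^+ 2)%:E <=
    (2 * (2 * 1 + 2 * e0) + eta * (C ^+ 2 * mB1))%:E.
  apply: (@ae_integral_leD _ (fun z => weight a z * odd_part_dy phi z ^+ 2)%R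
    (fun z => odd_part_dy phi z ^+ 2)%R) => //.
  - by apply: measurable_funM => //; exact: measurable_funX.
  - exact: m2.
  - exact: measurable_funX.
  - by move=> z _; rewrite mulr_ge0 ?powR_ge0 ?sqr_ge0.
  - by move=> z _; exact: sqr_ge0.
  - exact: ltW.
  - apply: filterS (@ae_ycoord_neq0 R n) => z y0 zB.
    rewrite [X in (_ <= X + _)%R]mulrA -mulrDl ler_wpM2r ?sqr_ge0//.
    by apply: Hd; rewrite normr_gt0.
  - apply: le_trans dyv _; rewrite lee_fin le_eqVlt; apply/orP; left.
    by apply/eqP; field.
have hv : \int[mu]_(z in B) ((`|ycoord z| + d) `^ (a - 2) * odd_part phi z ^+ 2)%:E <=
    (K * (2 * (2 * 1 + 2 * e0)) + 1)%:E.
  apply: le_trans (hardy_odd_part sphi d0) _.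
  apply: le_trans (lee_wpmul2l _ shifted) _; first by rewrite lee_fin.
  rewrite -EFinM lee_fin mulrDr lerD2l mulrCA /eta mulrC ler_pdivrMr ?mul1r; clear -KC0; lra.
rewrite /M -[X in (2 * X + _)%R](mulVf (lt0r_neq0 (exprn_gt0 2 ep))) mulrA.
apply: (@ae_integral_leD _ (fun z => weight a z * (u z - odd_part phi z) ^+ 2)%R
  (fun z => (`|ycoord z| + d) `^ (a - 2) * odd_part phi z ^+ 2)%R) => //.
- by apply: m2; exact: measurable_funB.
- by apply: measurable_funM => //; exact: measurable_funX.
- by move=> z _; rewrite mulr_ge0 ?powR_ge0 ?sqr_ge0.
- by rewrite mulr_ge0// invr_ge0 sqr_ge0.
- apply: nearW => z _; rewrite /F -/e.
  have [ey|_] := leP e `|ycoord z|%R; last first.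
    have c1 : (0 <= 2 / e ^+ 2)%R by rewrite divr_ge0// sqr_ge0.
    have c2 : (0 <= 2 * 2 `^ (2 - a))%R by rewrite mulr_ge0// powR_ge0.
    rewrite mulr0 addr_ge0//; first exact: mulr_ge0 c1 (w20 _ _ _).
    apply: mulr_ge0 c2 _.
    by apply: mulr_ge0; [exact: powR_ge0|exact: sqr_ge0].
  rewrite mulr1.
  have y0 : (0 < `|ycoord z|)%R by exact: lt_le_trans ep ey.
  have w1 : (weight (a - 2) z <= e ^- 2 * weight a z)%R.
    rewrite /weight powRB; last by rewrite (gt_eqF y0) implybT.
    rewrite powR_mulrn// mulrC ler_wpM2r ?powR_ge0//.
    by rewrite lef_pV2 ?posrE ?exprn_gt0// ler_sqr ?nnegrE ?(ltW ep).
  have w2 : (weight (a - 2) z <= 2 `^ (2 - a) * (`|ycoord z| + d) `^ (a - 2))%R.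
    rewrite /weight -[(a - 2)%R]opprB [leLHS]powRN powRN.
    rewrite -[leRHS]invrK lef_pV2 ?posrE ?powR_gt0//; last first.
      by rewrite invr_gt0 mulr_gt0 ?invr_gt0 ?powR_gt0// addr_gt0.
    rewrite invfM invrK mulrC ler_pdivrMr ?powR_gt0// mulrC -powRM//.
    have a2 : (0 <= 2 - a)%R by move: a1; lra.
    by apply: ge0_ler_powR => //; rewrite ?nnegrE; clear -d0 de ey; lra.
  apply: (@le_trans _ _ (weight (a - 2) z * (2 * (u z - odd_part phi z) ^+ 2 + 2 * odd_part phi z ^+ 2)))%R.
    by rewrite ler_wpM2l ?weight_ge0// sqr_le_sub.
  rewrite mulrDr lerD//.
    rewrite mulrCA -!mulrA ler_wpM2l// mulrA ler_wpM2r ?sqr_ge0//.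
  by rewrite mulrCA -!mulrA ler_wpM2l// mulrA ler_wpM2r ?sqr_ge0.
- apply: le_trans duv _; rewrite lee_fin le_eqVlt; apply/orP; left.
  by apply/eqP; field.
Unshelve. all: by end_near. Qed.

End hardy.

(** * The quotient belongs to the Sobolev space with weight 2 - a *)

Section profile.
Context {R : realType} (n : nat).
Implicit Types (a d : R) (z : 'rV[R]_n.+1).
Local Notation B := (@eball R n 1).

Lemma weight_y0 b z : b != 0 -> ycoord z = 0 -> weight b z = 0.
Proof. by move=> b0 y0; rewrite /weight y0 normr0 powR0. Qed.

Lemma weight_gt0 b z : ycoord z != 0 -> 0 < weight b z.
Proof. by move=> y0; rewrite powR_gt0// normr_gt0. Qed.

Lemma weightD b c z : ycoord z != 0 -> weight (b + c) z = weight b z * weight c z.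
Proof. by move=> y0; rewrite /weight powRD// normr_eq0 y0 implybT. Qed.

Lemma weight2 z : weight 2 z = ycoord z ^+ 2.
Proof. by rewrite /weight powR_mulrn// real_normK ?num_real. Qed.

Lemma weightN b z : weight (- b) z = (weight b z)^-1.
Proof. exact: powRN. Qed.

Lemma weight_le1 b z : 0 <= b -> B z -> weight b z <= 1.
Proof.
move=> b0 zB; have := eball_coord ord_max zB => /ltW y1.
apply: (@le_trans _ _ (1 `^ b)); last by rewrite powR1.
by apply: ge0_ler_powR; rewrite ?nnegrE.
Qed.

(** Both sides vanish on the hyperplane, where the quotient by the profile is 0
by convention. *)
Lemma odd_profileV a z : a < 1 ->
  (odd_profile a z)^-1 = ycoord z * weight (a - 2) z.
Proof.
move=> a1; have [y0|y0] := eqVneq (ycoord z) 0.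
  by rewrite /odd_profile y0 !mul0r invr0.
rewrite weightD// weightN weight2 /odd_profile invfM -powRN opprK -/(weight a z).
by field.
Qed.

Lemma flat_expE d m c y : y != 0 ->
  flat d m c y = Num.sg y ^+ m * `|y| `^ c * expR (- (d / y ^+ 2)).
Proof. by rewrite /flat => /negbTE ->. Qed.

Lemma sg_weight b z : Num.sg (ycoord z) * weight (b + 1) z = ycoord z * weight b z.
Proof.
have [y0|y0] := eqVneq (ycoord z) 0; first by rewrite y0 sgr0 !mul0r.
rewrite weightD// [weight 1 z]powRr1// mulrCA mulrA.
by rewrite -mulrA -numEsg mulrC.
Qed.

Lemma sg2_weight b z : ycoord z != 0 -> Num.sg (ycoord z) ^+ 2 * weight b z = weight b z.
Proof. by move=> y0; rewrite sqr_sg y0 mul1r. Qed.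

Lemma measurable_ycoord D : measurable_fun D (@ycoord R n).
Proof. by apply: measurable_funTS; exact: measurable_coord. Qed.

Lemma measurable_weightS b D : measurable_fun D (fun z : 'rV[R]_n.+1 => weight b z).
Proof. by apply: measurable_funTS; exact: measurable_weight. Qed.

End profile.

Section quotient.
Context {R : realType} (n : nat) (a : R).
Hypothesis a1 : a < 1.
Local Notation mu := (@lebesgue_rV R n.+1).
Local Notation B := (@eball R n 1).
Implicit Types (phi u : 'rV[R]_n.+1 -> R) (U : 'I_n.+1 -> 'rV[R]_n.+1 -> R)
  (z : 'rV[R]_n.+1) (d : R).

Let a2_ge0 : 0 <= 2 - a. Proof. by move: a1; lra. Qed.

Definition quot u z : R := u z / odd_profile a z.

(** The term of the last component comes from $\partial_y (y|y|^{-a}) =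
(1 - a) |y|^{-a}$. *)
Definition quot_gradient u U (i : 'I_n.+1) z : R :=
  U i z / odd_profile a z -
  (i == ord_max)%:R * ((1 - a) * (u z * weight (a - 2) z)).

Lemma measurable_quot u : measurable_fun B u -> measurable_fun B (quot u).
Proof.
move=> mu'; rewrite /quot.
under [X in measurable_fun _ X]eq_fun do rewrite odd_profileV//.
apply: measurable_funM => //; apply: measurable_funM.
  exact: measurable_ycoord.
exact: measurable_weightS.
Qed.

Lemma measurable_quot_gradient u U i : measurable_fun B u ->
  measurable_fun B (U i) -> measurable_fun B (quot_gradient u U i).
Proof.
move=> mu' mU; apply: measurable_funB; first exact: (measurable_quot mU).
apply: measurable_funM => //; apply: measurable_funM => //.
by apply: measurable_funM => //; exact: measurable_weightS.
Qed.

Lemma energy_smooth_lty (b : R) phi : 0 <= b -> smooth phi ->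
  (energy b B phi (gradient phi) < +oo)%E.
Proof.
move=> b0 sphi; have mB := @measurable_eball R n 1.
have [C [C0 HC]] := bounded_on_eball (smooth_continuous sphi).
have [D HD] : exists D : 'I_n.+1 -> R, forall i z, B z -> `|partial i phi z| <= D i.
  have h i : {D : R | forall z, B z -> `|partial i phi z| <= D}.
    apply: cid; have [D [_ HD]] := bounded_on_eball (continuous_partial (i := i) sphi).
    by exists D.
  by exists (fun i => sval (h i)) => i; case: (h i).
apply: (@bounded_integral_lty _ _ _ _ _ mB _ (C ^+ 2 + \sum_i D i ^+ 2)).
- exact: eball_lty.
- apply: measurable_weight_sqjet => [|i]; last exact: measurable_gradient.
  by apply: measurable_funTS; exact: measurable_smooth.
- move=> z zB; rewrite weight_sqjet_ge0/=.
  apply: (@le_trans _ _ (sqjet phi (gradient phi) z)).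
    by rewrite ler_piMl ?sqjet_ge0// weight_le1.
  have sq (x y : R) : `|x| <= y -> x ^+ 2 <= y ^+ 2.
    move=> xy; rewrite -[leLHS]real_normK ?num_real// ler_sqr ?nnegrE//.
    exact: le_trans xy.
  rewrite /sqjet lerD//; first by apply: sq; exact: HC.
  by apply: ler_sum => i _; apply: sq; exact: HD.
Qed.

Definition eta d z : R := expR (- (d / ycoord z ^+ 2)).

(** This is $y\, \partial_y e^{-d/y^2}$. *)
Definition teta d z : R := 2 * (d / ycoord z ^+ 2 * eta d z).

(** The quotient of $\phi$ by $y|y|^{-a}$, made smooth by the factor $e^{-d/y^2}$. *)
Definition quot_approx phi d z : R := phi z * flat d 1 (a - 1) (ycoord z).

(** Off the hyperplane, with $\eta = e^{-d/y^2}$ and $t = 2 d \eta/y^2$, the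
approximant $\eta \phi/(y|y|^{-a})$ of the quotient differs from it by terms
that vanish with $d$ and terms that are controlled by the error of $\phi$. *)
Lemma sqjet_quot_approx u U phi d z : smooth phi -> 0 < d -> ycoord z != 0 ->
  weight (2 - a) z * sqjet (fun z => quot u z - quot_approx phi d z)
    (fun i z => quot_gradient u U i z - gradient (quot_approx phi d) i z) z <=
  4 * ((1 - eta d z) ^+ 2 * (weight a z * sqjet u U z) +
       ((1 - a) * (1 - eta d z) + teta d z) ^+ 2 * (weight (a - 2) z * u z ^+ 2)) +
  4 * (1 + (((1 - a) * eta d z - teta d z) / ycoord z) ^+ 2) *
    (weight a z * sqjet (fun z => u z - phi z) (fun i z => U i z - gradient phi i z) z).
Proof.
move=> sphi d0 y0; set p := quot_approx phi d.
set y := ycoord z in y0 *; set eta := eta d z; set t := teta d z.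
have etaE : eta = expR (- (d / y ^+ 2)) by [].
have tE : t = 2 * (d / y ^+ 2 * eta) by [].
pose A := weight (a - 2) z; have A0 : 0 < A by exact: weight_gt0.
have wa : weight a z = A * y ^+ 2.
  by rewrite /A weightD// weightN weight2 mulfVK// sqrf_eq0.
have w2a : weight (2 - a) z = A^-1 by rewrite /A -weightN opprB.
pose s := y * A.
have qE : flat d 1 (a - 1) y = eta * s.
  rewrite flat_expE// expr1 -/(weight (a - 1) z) -[X in weight X z](_ : (a - 2) + 1 = a - 1).
    by rewrite sg_weight mulrC.
  by ring.
have dqE : (a - 1) * flat d 2 (a - 1 - 1) y + 2 * d * flat d 2 (a - 1 - 3) y =
    A * ((a - 1) * eta + t).
  rewrite !flat_expE// -!/(weight _ z) !sg2_weight//.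
  have -> : a - 1 - 1 = a - 2 by ring.
  have -> : a - 1 - 3 = (a - 2) - 2 by ring.
  rewrite [weight (a - 2 - 2) z]weightD// weightN weight2 -/A -/y -etaE tE.
  by field.
have sq2 (x : R) : 0 <= 2 * x ^+ 2 by rewrite mulr_ge0 ?sqr_ge0.
have jet0 : (quot u z - p z) ^+ 2 <=
    s ^+ 2 * (2 * (1 - eta) ^+ 2 * u z ^+ 2 + 2 * eta ^+ 2 * (u z - phi z) ^+ 2).
  rewrite /quot odd_profileV// -/A -/y -/s /p /quot_approx -/y qE.
  rewrite -subr_ge0 (_ : _ - _ =
    s ^+ 2 * ((1 - eta) * u z - eta * (u z - phi z)) ^+ 2); last by ring.
  by rewrite mulr_ge0 ?sqr_ge0.
have jet1 i : (quot_gradient u U i z - gradient p i z) ^+ 2 <=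
    s ^+ 2 * (4 * (1 - eta) ^+ 2 * U i z ^+ 2 +
              4 * eta ^+ 2 * (U i z - gradient phi i z) ^+ 2) +
    (i == ord_max)%:R * (A ^+ 2 * (4 * ((1 - a) * (1 - eta) + t) ^+ 2 * u z ^+ 2 +
              4 * ((1 - a) * eta - t) ^+ 2 * (u z - phi z) ^+ 2)).
  rewrite /gradient /p /quot_approx partial_mul_flat// -/y qE dqE.
  rewrite /quot_gradient odd_profileV// -/A -/y -/s.
  set v := u z - phi z; set V := U i z - partial i phi z.
  rewrite [X in X ^+ 2 <= _](_ : _ = s * ((1 - eta) * U i z + eta * V) -
    (i == ord_max)%:R * (A * (((1 - a) * (1 - eta) + t) * u z + ((1 - a) * eta - t) * v)));
    last by rewrite /v /V; ring.
  set P := (1 - eta) * U i z; set Q := eta * V.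
  set P' := (_ + t) * u z; set Q' := (_ - t) * v.
  have -> : 4 * (1 - eta) ^+ 2 * U i z ^+ 2 = 4 * P ^+ 2 by rewrite /P; ring.
  have -> : 4 * eta ^+ 2 * V ^+ 2 = 4 * Q ^+ 2 by rewrite /Q; ring.
  have -> : 4 * ((1 - a) * (1 - eta) + t) ^+ 2 * u z ^+ 2 = 4 * P' ^+ 2 by rewrite /P'; ring.
  have -> : 4 * ((1 - a) * eta - t) ^+ 2 * v ^+ 2 = 4 * Q' ^+ 2 by rewrite /Q'; ring.
  case: (i == ord_max); rewrite /= ?mul1r ?mul0r ?subr0 ?addr0 -subr_ge0.
    rewrite (_ : _ - _ = (s * (P + Q) + A * (P' + Q')) ^+ 2 +
      2 * (s * (P - Q)) ^+ 2 + 2 * (A * (P' - Q')) ^+ 2); last by ring.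
    exact: (addr_ge0 (addr_ge0 (sqr_ge0 _) (sq2 _)) (sq2 _)).
  rewrite (_ : _ - _ = s ^+ 2 * (2 * P ^+ 2 + 2 * Q ^+ 2 + (P - Q) ^+ 2)); last by ring.
  exact: (mulr_ge0 (sqr_ge0 _) (addr_ge0 (addr_ge0 (sq2 _) (sq2 _)) (sqr_ge0 _))).
rewrite w2a ler_pdivrMl//.
apply: (@le_trans _ _ (_ + \sum_i _)); first by apply: lerD jet0 (ler_sum _ (fun i _ => jet1 i)).
rewrite big_split/= -mulr_sumr big_split/= -!mulr_sumr.
have sum_max (c : R) : \sum_(i < n.+1) (i == ord_max)%:R * c = c.
  rewrite (bigD1 ord_max)//= eqxx mul1r big1 ?addr0// => i /negbTE ->.
  by rewrite mul0r.
rewrite sum_max wa /sqjet.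
set SU := \sum_i _; set SV := \sum_i _.
have SU0 : 0 <= SU by apply: sumr_ge0 => i _; exact: sqr_ge0.
have SV0 : 0 <= SV by apply: sumr_ge0 => i _; exact: sqr_ge0.
set v := u z - phi z; set e := (1 - a) * eta - t; set e' := _ + t.
have eta0 : 0 <= eta by exact: expR_ge0.
have eta1 : eta <= 1.
  by rewrite expR_le1 oppr_le0 divr_ge0 ?sqr_ge0// ltW.
rewrite -subr_ge0 /s -/A.
rewrite (_ : _ - _ = A ^+ 2 * (y ^+ 2 * (2 * ((1 - eta) * u z) ^+ 2) +
   y ^+ 2 * ((4 - 2 * eta ^+ 2) * v ^+ 2) + y ^+ 2 * (4 * (1 - eta ^+ 2) * SV) +
   4 * e ^+ 2 * SV)); last by field.
have eta21 : eta ^+ 2 <= 1 by rewrite expr_le1.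
have ? : 0 <= 1 - eta ^+ 2 by rewrite subr_ge0.
have ? : 0 <= 4 - 2 * eta ^+ 2 by clear -eta21; lra.
have y20 : 0 <= y ^+ 2 := sqr_ge0 _.
apply: mulr_ge0; first exact: sqr_ge0.
apply: addr_ge0; last by rewrite mulr_ge0// mulr_ge0// sqr_ge0.
apply: addr_ge0; last by rewrite mulr_ge0// mulr_ge0// mulr_ge0.
by apply: addr_ge0; apply: mulr_ge0 => //; apply: mulr_ge0 => //; exact: sqr_ge0.
Qed.

Lemma eta_ge0 d z : 0 <= eta d z. Proof. exact: expR_ge0. Qed.

Lemma eta_le1 d z : 0 <= d -> eta d z <= 1.
Proof. by move=> d0; rewrite expR_le1 oppr_le0 divr_ge0 ?sqr_ge0. Qed.

Lemma teta_bound d z : 0 <= d -> 0 <= teta d z <= 2.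
Proof.
move=> d0; have x0 : 0 <= d / ycoord z ^+ 2 by rewrite divr_ge0 ?sqr_ge0.
apply/andP; split; first by rewrite /teta mulr_ge0// mulr_ge0// eta_ge0.
rewrite /teta -[leRHS]mulr1 ler_wpM2l// /eta expRN ler_pdivrMr ?expR_gt0// mul1r.
by apply: le_trans (expR_ge1Dx _); rewrite lerDr.
Qed.

Lemma measurable_eta d : measurable_fun setT (@eta d).
Proof.
apply: (measurableT_comp (@measurable_expR R)).
apply: (measurableT_comp (@oppr_measurable R setT)).
under [X in measurable_fun _ X]eq_fun do rewrite -weight2 -weightN.
by apply: measurable_funM => //; exact: measurable_weightS.
Qed.

Lemma measurable_teta d : measurable_fun setT (@teta d).
Proof.
rewrite /teta; apply: measurable_funM => //; apply: measurable_funM; last exact: measurable_eta.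
under [X in measurable_fun _ X]eq_fun do rewrite -weight2 -weightN.
by apply: measurable_funM => //; exact: measurable_weightS.
Qed.

Lemma cvg_eta z : eta k.+1%:R^-1 z @[k --> \oo] --> (1 : R).
Proof.
have h : - (k.+1%:R^-1 / ycoord z ^+ 2) @[k --> \oo] --> (0 : R).
  rewrite -oppr0 -[X in - X](mul0r (ycoord z ^+ 2)^-1).
  by apply: cvgN; apply: cvgM; [exact: cvg_harmonic|exact: cvg_cst].
by have := cvg_comp _ _ h (@continuous_expR R 0); rewrite expR0; exact.
Qed.

Lemma cvg_teta z : teta k.+1%:R^-1 z @[k --> \oo] --> (0 : R).
Proof.
rewrite /teta -[X in _ --> X](_ : 2 * (0 * (ycoord z ^+ 2)^-1 * 1) = 0); last by rewrite !mul0r mulr0.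
apply: cvgM; first exact: cvg_cst.
apply: cvgM; last exact: cvg_eta.
by apply: cvgM; [exact: cvg_harmonic|exact: cvg_cst].
Qed.

(** The quotients by $y$ are flat functions, hence bounded, though not uniformly
in $d$. *)
Lemma approx_error_bound d : 0 < d -> exists C : R, 0 <= C /\
  forall z, B z -> ycoord z != 0 -> (((1 - a) * eta d z - teta d z) / ycoord z) ^+ 2 <= C.
Proof.
move=> d0.
have [C1 [C10 HC1]] := flat_bound d0 0 (- 1).
have [C2 [C20 HC2]] := flat_bound d0 0 (- 3).
exists (((1 - a) * C1 + 2 * d * C2) ^+ 2); split=> [|z zB y0]; first exact: sqr_ge0.
have y1 : `|ycoord z| <= 1 by apply: ltW; exact: eball_coord.
have sq1 : ycoord z ^+ 2 <= 1 by rewrite -real_normK ?num_real// expr_le1.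
have flat1 m c C : 0 <= C -> (forall y, `|y| <= 1 -> `|flat d m c y| <= C * y ^+ 2) ->
    `|flat d m c (ycoord z)| <= C.
  by move=> C0 /(_ _ y1) /le_trans; apply; rewrite ler_piMr.
have f1 := flat1 _ _ _ C10 HC1; have f2 := flat1 _ _ _ C20 HC2.
rewrite norm_flat// -/(eta d z) in f1; rewrite norm_flat// -/(eta d z) in f2.
rewrite -real_normK ?num_real// ler_sqr ?nnegrE ?normr_ge0//; last first.
  by rewrite addr_ge0 ?mulr_ge0// ?subr_ge0 ltW.
rewrite mulrBl; apply: le_trans (ler_normB _ _) _; apply: lerD.
  rewrite [leLHS](_ : _ = (1 - a) * (`|ycoord z| `^ (- 1) * eta d z)).
    by rewrite ler_wpM2l// subr_ge0 ltW.
  rewrite !normrM (ger0_norm (eta_ge0 _ _)) normfV powR_inv1//.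
  by rewrite ger0_norm ?subr_ge0 ?ltW// -mulrA [eta d z * _]mulrC.
rewrite [leLHS](_ : _ = 2 * d * (`|ycoord z| `^ (- 3) * eta d z)).
  by rewrite ler_wpM2l// mulr_ge0// ltW.
rewrite (_ : teta d z / ycoord z = 2 * d * (ycoord z ^- 3 * eta d z)); last first.
  by rewrite /teta; field.
rewrite normrM [X in X * _]ger0_norm; last by rewrite mulr_ge0// ltW.
by rewrite normrM (ger0_norm (eta_ge0 _ _)) normfV normrX powR_invn.
Qed.

Local Open Scope ereal_scope.

(** Dominated convergence: the Hardy integral is what dominates the second term. *)
Lemma cvg_tail_energy u U : energy a B u U < +oo ->
  \int[mu]_(z in B) (weight (a - 2) z * u z ^+ 2)%:E < +oo ->
  measurable_fun B u -> (forall i, measurable_fun B (U i)) ->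
  \int[mu]_(z in B) ((1 - eta k.+1%:R^-1 z) ^+ 2 * (weight a z * sqjet u U z) +
       ((1 - a) * (1 - eta k.+1%:R^-1 z) + teta k.+1%:R^-1 z) ^+ 2 *
         (weight (a - 2) z * u z ^+ 2))%:E @[k --> \oo] --> 0.
Proof.
move=> Eoo Hoo mu' mU; have mB := @measurable_eball R n 1.
pose d k : R := (k.+1%:R^-1)%R; have d0 k : (0 <= d k)%R by rewrite invr_ge0.
have mE : measurable_fun B (fun z => weight a z * sqjet u U z)%R.
  exact: measurable_weight_sqjet.
have mH : measurable_fun B (fun z => weight (a - 2) z * u z ^+ 2)%R.
  by apply: measurable_funM; [exact: measurable_weightS|exact: measurable_funX].
have H0 z : (0 <= weight (a - 2) z * u z ^+ 2)%R.
  by rewrite mulr_ge0 ?weight_ge0 ?sqr_ge0.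
pose c : R := ((1 - a + 2) ^+ 2)%R.
pose G z := (weight a z * sqjet u U z + c * (weight (a - 2) z * u z ^+ 2))%R.
have iE : mu.-integrable B (fun z => (weight a z * sqjet u U z)%:E).
  apply/integrableP; split; first exact/measurable_EFinP.
  under eq_integral do rewrite gee0_abs ?lee_fin ?weight_sqjet_ge0//.
  exact: Eoo.
have iH : mu.-integrable B (fun z => (weight (a - 2) z * u z ^+ 2)%:E).
  apply/integrableP; split; first exact/measurable_EFinP.
  by under eq_integral do rewrite gee0_abs ?lee_fin ?H0//.
have iG : mu.-integrable B (fun z => (G z)%:E).
  have -> : (fun z => (G z)%:E) = (fun z => (weight a z * sqjet u U z)%:E +
      c%:E * (weight (a - 2) z * u z ^+ 2)%:E) by apply/funext => z; rewrite EFinD EFinM.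
  by apply: integrableD => //; exact: integrableZl.
pose F k z := ((1 - eta (d k) z) ^+ 2 * (weight a z * sqjet u U z) +
       ((1 - a) * (1 - eta (d k) z) + teta (d k) z) ^+ 2 *
         (weight (a - 2) z * u z ^+ 2))%R.
have meta k := measurable_funTS (D := B) (measurable_eta (d k)).
have mteta k := measurable_funTS (D := B) (measurable_teta (d k)).
have mF k : measurable_fun B (F k).
  apply: measurable_funD; apply: measurable_funM => //; apply: measurable_funX.
    exact: measurable_funB.
  apply: measurable_funD => //; apply: measurable_funM => //.
  exact: measurable_funB.
have := @dominated_convergence _ _ _ mu B mB (fun k z => (F k z)%:E) (cst 0)
  (fun z => (G z)%:E) _ _ _ iG.
case => //.
- by move=> k; exact/measurable_EFinP.
- apply: nearW => z _; apply: cvg_EFin; first exact: nearW.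
  rewrite /F /comp/=.
  rewrite -[X in _ --> X](_ : (1 - 1) ^+ 2 * (weight a z * sqjet u U z) +
       ((1 - a) * (1 - 1) + 0) ^+ 2 * (weight (a - 2) z * u z ^+ 2) = 0)%R; last by ring.
  have ce : (1 - eta (d k) z)%R @[k --> \oo] --> (1 - 1 : R)%R.
    by apply: cvgB; [exact: cvg_cst|exact: cvg_eta].
  apply: cvgD; (apply: cvgM; last exact: cvg_cst).
    by apply: cvgM.
  have cq : ((1 - a) * (1 - eta (d k) z) + teta (d k) z)%R @[k --> \oo] -->
      ((1 - a) * (1 - 1) + 0)%R.
    apply: cvgD; last exact: cvg_teta.
    by apply: cvgM => //; exact: cvg_cst.
  by apply: cvgM.
- apply: nearW => z k zB; rewrite gee0_abs ?lee_fin; last first.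
    rewrite addr_ge0// mulr_ge0 ?sqr_ge0 ?weight_sqjet_ge0//.
  have e0 := eta_ge0 (d k) z; have e1 := eta_le1 z (d0 k).
  have /andP[t0 t2] := teta_bound z (d0 k).
  rewrite /F /G lerD//.
    rewrite ler_piMl ?weight_sqjet_ge0// expr_le1//; clear -e0 e1; lra.
  rewrite ler_wpM2r// /c ler_sqr ?nnegrE.
  - by rewrite lerD// ler_piMr ?subr_ge0 ?(ltW a1)//; clear -e0; lra.
  - by rewrite addr_ge0// mulr_ge0 ?subr_ge0 ?(ltW a1).
  - by rewrite addr_ge0// subr_ge0 ltW.
- by move=> _ _; rewrite integral0.
Qed.

(** First $d$ is fixed so that the terms depending on $u$ are small, and then
$\phi$ is taken close enough to $u$ to beat the constant that depends on $d$. *)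
Lemma in_H1_quot u U : in_H1_with_gradient a B u U ->
  \int[mu]_(z in B) (weight (a - 2) z * u z ^+ 2)%:E < +oo ->
  in_H1_with_gradient (2 - a) B (quot u) (quot_gradient u U).
Proof.
move=> uH1 Hoo; have mB := @measurable_eball R n 1.
have Eoo := energy_lty mB uH1.
have [mu' mU H] := (in_H1_energyP _ _ _ mB).1 uH1.
have mW i := measurable_quot_gradient mu' (mU i).
apply/(in_H1_energyP _ _ _ mB); split=> [|i|e e0]; first exact: measurable_quot.
  exact: mW.
have := cvg_tail_energy Eoo Hoo mu' mU.
have e80 : (0 < e / 8)%R by rewrite divr_gt0.
move=> /fine_cvgP[tail_fin /cvgr0Pnorm_lt /(_ _ e80)] tail_lt.
have [k _ /(_ _ (leqnn k))[{}tail_fin {}tail_lt]] := filterI tail_fin tail_lt.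
pose d : R := (k.+1%:R^-1)%R; have d0 : (0 < d)%R by rewrite invr_gt0.
have [C [C0 HC]] := approx_error_bound d0.
have C1 : (0 < 1 + C)%R by rewrite ltr_pwDl.
have [|phi [sphi phioo Hphi]] := H (e / (8 * (1 + C)))%R.
  by rewrite divr_gt0// mulr_gt0.
exists (quot_approx phi d).
have sapp : smooth (quot_approx phi d) by exact: smooth_mul_flat.
split; first exact: sapp.
  by apply: energy_smooth_lty; [exact: a2_ge0|exact: sapp].
have mphi : measurable_fun B phi by apply: measurable_funTS; exact: measurable_smooth.
have mg i : measurable_fun B (gradient phi i) by exact: measurable_gradient.
have mapp : measurable_fun B (quot_approx phi d).
  by apply: measurable_funTS; exact: measurable_smooth.
have mgapp i : measurable_fun B (gradient (quot_approx phi d) i) by exact: measurable_gradient.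
set T := fun z => ((1 - eta d z) ^+ 2 * (weight a z * sqjet u U z) +
       ((1 - a) * (1 - eta d z) + teta d z) ^+ 2 *
         (weight (a - 2) z * u z ^+ 2))%R.
have mT : measurable_fun B T.
  have meta := measurable_funTS (D := B) (measurable_eta d).
  have mteta := measurable_funTS (D := B) (measurable_teta d).
  apply: measurable_funD; apply: measurable_funM.
  - by apply: measurable_funX; exact: measurable_funB.
  - exact: measurable_weight_sqjet.
  - apply: measurable_funX; apply: measurable_funD => //; apply: measurable_funM => //.
    exact: measurable_funB.
  - by apply: measurable_funM; [exact: measurable_weightS|exact: measurable_funX].
have T0 z : (0 <= T z)%R.
  apply: addr_ge0; apply: mulr_ge0; rewrite ?sqr_ge0 ?weight_sqjet_ge0//.
  by rewrite mulr_ge0 ?weight_ge0 ?sqr_ge0.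
have C10 : (0 <= 4 * (1 + C))%R by rewrite mulr_ge0// addr_ge0.
have := @ae_ge0_le_integralD _ _ _ mu B mB
  (fun z => weight (2 - a) z * sqjet (fun z => quot u z - quot_approx phi d z)
    (fun i z => quot_gradient u U i z - gradient (quot_approx phi d) i z) z)%R T
  (fun z => weight a z * sqjet (fun z => u z - phi z) (fun i z => U i z - gradient phi i z) z)%R
  4 (4 * (1 + C))%R.
move=> /(_ _ mT) bound.
apply: le_lt_trans (bound _ _ _ _ _ _ _ _) _ => {bound} //.
- apply: measurable_weight_sqjet => [|i]; apply: measurable_funB => //.
  exact: measurable_quot.
- by apply: measurable_weight_sqjet => [|i]; apply: measurable_funB.
- by move=> z _; exact: weight_sqjet_ge0.
- by move=> z _; exact: weight_sqjet_ge0.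
- apply: filterS (@ae_ycoord_neq0 R n) => z y0 zB.
  apply: le_trans (sqjet_quot_approx u U sphi d0 y0) _.
  rewrite lerD2l ler_wpM2r ?weight_sqjet_ge0// ler_wpM2l// lerD2l.
  exact: HC.
rewrite (_ : e = 4 * (e / 8) + 4 * (1 + C) * (e / (8 * (1 + C))))%R; last first.
  by field; rewrite gt_eqF.
rewrite [ltRHS]EFinD.
apply: lteD.
  rewrite [ltRHS]EFinM lte_pmul2l ?lte_fin// -[ltLHS]fineK//.
  by rewrite lte_fin; apply: le_lt_trans tail_lt; exact: ler_norm.
by rewrite [ltRHS]EFinM lte_pmul2l// lte_fin mulr_gt0.
Qed.

End quotient.

(** * Integration by parts across the hyperplane *)

Section integration_by_parts.
Context {R : realType} (n : nat).
Local Notation mu := (@lebesgue_rV R n.+1).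
Local Notation B := (@eball R n 1).
Implicit Types (phi psi : 'rV[R]_n.+1 -> R) (z : 'rV[R]_n.+1).
Local Open Scope ereal_scope.

Lemma sube_fin_eq0 (x y : \bar R) : x \is a fin_num -> y \is a fin_num ->
  x - y = 0 -> x = y.
Proof. by move: x y => [x| |] [y| |]// _ _ [/subr0_eq ->]. Qed.

Lemma integrable_eball (f : 'rV[R]_n.+1 -> R) (C : R) : measurable_fun B f ->
  (forall z, B z -> `|f z| <= C)%R -> mu.-integrable B (EFin \o f).
Proof.
move=> mf fC; apply/integrableP; split; first exact/measurable_EFinP.
apply: (@bounded_integral_lty _ _ _ _ _ (@measurable_eball R n 1) (fun z => `|f z|%R) C).
- exact: eball_lty.
- exact: measurableT_comp.
- by move=> z /fC /= ->; rewrite normr_ge0.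
Qed.

(** Fubini's theorem for a function whose slices have mean zero. *)
Lemma integral_slices_eq0 (g : 'rV[R]_n.+1 -> R) :
  mu.-integrable setT (EFin \o g) ->
  (forall x, lebesgue_measure.-integrable setT (fun t => (g (snoc_rV (x, t)))%:E) /\
    \int[lebesgue_measure]_t (g (snoc_rV (x, t)))%:E = 0) ->
  \int[mu]_z (g z)%:E = 0.
Proof.
move=> ig gx; have mg := (integrableP _ _ _ ig).1.
rewrite integralE ge0_integral_slices//; last exact: measurable_funepos.
rewrite ge0_integral_slices//; last exact: measurable_funeneg.
have E x : \int[lebesgue_measure]_t ((EFin \o g)^\+ (snoc_rV (x, t))) =
    \int[lebesgue_measure]_t ((EFin \o g)^\- (snoc_rV (x, t))).
  have [ix] := gx x; rewrite integralE.
  have fp := integrable_fin_num (measurableT) (integrable_funepos measurableT ix).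
  have fn := integrable_fin_num (measurableT) (integrable_funeneg measurableT ix).
  move=> h; have h' := sube_fin_eq0 fp fn h.
  apply: etrans (etrans _ h') _; apply: eq_integral => t _; by rewrite ?funeposE ?funenegE.
under eq_integral do rewrite E.
rewrite subee// -ge0_integral_slices//; last exact: measurable_funeneg.
exact: (integrable_fin_num measurableT (integrable_funeneg measurableT ig)).
Qed.

(** On each slice the integrand is the derivative of a function that vanishes at
both ends. *)
Lemma integral_partial_eq0 phi psi : smooth phi -> smooth_compact_support B psi ->
  \int[mu]_(z in B) (partial ord_max phi z * psi z + phi z * partial ord_max psi z)%:E = 0.
Proof.
move=> sphi [spsi [K [cK KB psi0]]].
have mB := @measurable_eball R n 1.
have clK : closed K by apply: compact_closed => //; exact: norm_hausdorff.
have dpsi0 := partial_eq0_off_support ord_max clK psi0.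
pose g z := (partial ord_max phi z * psi z + phi z * partial ord_max psi z)%R.
have g0 z : ~ B z -> g z = 0%R.
  by move=> nB; rewrite /g psi0 ?dpsi0 ?mulr0 ?addr0// => /KB.
have mg : measurable_fun setT g.
  apply: measurable_funD; apply: measurable_funM.
  - exact: measurable_partial.
  - exact: measurable_smooth.
  - exact: measurable_smooth.
  - exact: measurable_partial.
have gE : (EFin \o g) \_ B = EFin \o g.
  apply/funext => z; rewrite patchE; case: ifPn => //; rewrite notin_setE => /g0 gz.
  by rewrite /= gz.
rewrite integral_mkcond gE; apply: integral_slices_eq0.
  rewrite -gE; apply/(integrable_restrict _ mB) => //=; rewrite setTI.
  have [C1 [C10 HC1]] := bounded_on_eball (smooth_continuous sphi).
  have [C2 [C20 HC2]] := bounded_on_eball (smooth_continuous spsi).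
  have [C3 [C30 HC3]] := bounded_on_eball (continuous_partial (i := ord_max) sphi).
  have [C4 [C40 HC4]] := bounded_on_eball (continuous_partial (i := ord_max) spsi).
  apply: (@integrable_eball g (C3 * C2 + C1 * C4)); first exact: measurable_funTS.
  move=> z zB; apply: le_trans (ler_normD _ _) _; rewrite !normrM.
  by apply: lerD; apply: ler_pM => //; [exact: HC3|exact: HC2|exact: HC1|exact: HC4].
move=> x; have d1 t := is_derive_slice x t sphi; have d2 t := is_derive_slice x t spsi.
have c1 := continuous_slice (x := x) (smooth_continuous sphi).
have c2 := continuous_slice (x := x) (smooth_continuous spsi).
have c3 := continuous_slice (x := x) (continuous_partial (i := ord_max) sphi).
have c4 := continuous_slice (x := x) (continuous_partial (i := ord_max) spsi).
have outB t : (1 <= `|t|)%R -> ~ B (snoc_rV (x, t)).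
  move=> t1 /(eball_coord ord_max); rewrite -/(ycoord _) ycoord_snoc => h.
  by have := lt_le_trans h t1; rewrite ltxx.
pose gx t := g (snoc_rV (x, t)).
have cgx : continuous gx.
  move=> t; apply: cvgD; apply: cvgM; [exact: c3|exact: c2|exact: c1|exact: c4].
have igx : lebesgue_measure.-integrable `[(-1)%R, 1%R] (EFin \o gx).
  by apply: integrable_itv_continuous => t _; exact: cgx.
have gxE : (EFin \o gx) \_ `[(-1)%R, 1%R] = EFin \o gx.
  apply/funext => t; rewrite patchE; case: ifPn => //.
  rewrite notin_setE/= in_itv/= => /negP; rewrite -ler_norml -ltNge => t1.
  by rewrite /gx g0//; apply: outB; exact: ltW.
split.
  rewrite -[X in integrable _ _ X]gxE.
  by apply/(integrable_restrict _ _ _ _).1 => //=; rewrite setTI.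
rewrite -[X in integral _ _ X]gxE -integral_mkcond -[LHS]fineK; last first.
  exact: integrable_fin_num igx.
rewrite [X in X%:E](@ftc_is_derive R (fun t => phi (snoc_rV (x, t)) * psi (snoc_rV (x, t)))%R gx).
- by rewrite !psi0 ?mulr0 ?subrr// => /KB; apply: outB; rewrite ?normrN normr1.
- lra.
- by move=> t _; apply: cvgM; [exact: c1|exact: c2].
- by move=> t _; exact: cgx.
- move=> t _; have := is_deriveM (d1 t) (d2 t) => /is_derive_eq; apply.
  by rewrite /gx /g /GRing.scale/=; ring.
Qed.

(** The arithmetic-geometric inequality splits off the weight $|y|^{-a}$,
which is integrable because $a < 1$. *)
Lemma norm_le_weights (a e v : R) z : (0 < e)%R -> ycoord z != 0%R ->
  (`|v| <= e * weight (- a) z + e^-1 * (weight a z * v ^+ 2))%R.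
Proof.
move=> e0 y0; have w0 := weight_gt0 a y0; rewrite weightN.
have h : (`|v| = (2 * `|v|) / 2)%R by field.
apply: (@le_trans _ _ (2 * `|v|)%R); first by have := normr_ge0 v; lra.
rewrite -(real_normK (num_real v)); set x := `|v|%R.
rewrite -subr_ge0 (_ : _ - _ = (e * weight a z)^-1 * (weight a z * x - e) ^+ 2)%R.
  by rewrite mulr_ge0 ?sqr_ge0// invr_ge0 mulr_ge0// ltW.
by field; rewrite !gt_eqF.
Qed.

Lemma integral_norm_le (a e v2 : R) (v : 'rV[R]_n.+1 -> R) : (0 < e)%R ->
  measurable_fun B v -> \int[mu]_(z in B) (weight a z * v z ^+ 2)%:E <= v2%:E ->
  \int[mu]_(z in B) (`|v z|)%:E <=
    e%:E * \int[mu]_(z in B) (weight (- a) z)%:E + (e^-1 * v2)%:E.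
Proof.
move=> e0 mv hv.
have := @ae_ge0_le_integralD _ _ _ mu B (@measurable_eball R n 1) (fun z => `|v z|%R)
  (fun z => weight (- a) z) (fun z => weight a z * v z ^+ 2)%R e e^-1.
move=> bound; apply: le_trans (bound _ _ _ _ _ _ _ _ _) _ => {bound}.
- exact: measurableT_comp.
- exact: measurable_weightS.
- by apply: measurable_funM; [exact: measurable_weightS|exact: measurable_funX].
- by move=> z _; exact: normr_ge0.
- by move=> z _; exact: weight_ge0.
- by move=> z _; rewrite mulr_ge0 ?weight_ge0 ?sqr_ge0.
- exact: ltW.
- by rewrite invr_ge0 ltW.
- by apply: filterS (@ae_ycoord_neq0 R n) => z y0 _; exact: norm_le_weights.
by rewrite leeD2l// EFinM lee_wpmul2l// lee_fin invr_ge0 ltW.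
Qed.

Lemma integrable_weighted_L2 (a : R) (v : 'rV[R]_n.+1 -> R) : (a < 1)%R ->
  measurable_fun B v -> \int[mu]_(z in B) (weight a z * v z ^+ 2)%:E < +oo ->
  mu.-integrable B (EFin \o v).
Proof.
move=> a1 mv hv; apply/integrableP; split; first exact/measurable_EFinP.
have v0 : 0 <= \int[mu]_(z in B) (weight a z * v z ^+ 2)%:E.
  by apply: integral_ge0 => z _; rewrite lee_fin mulr_ge0 ?weight_ge0 ?sqr_ge0.
apply: le_lt_trans (@integral_norm_le a 1 (fine (\int[mu]_(z in B) (weight a z * v z ^+ 2)%:E))
  v ltr01 mv _) _.
  by rewrite fineK// ge0_fin_numE.
rewrite mul1e lte_add_pinfty ?ltry// integral_weight_lty//; lra.
Qed.

Lemma integrable_mul_bounded (v psi : 'rV[R]_n.+1 -> R) (C : R) :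
  mu.-integrable B (EFin \o v) -> measurable_fun B psi ->
  (forall z, B z -> `|psi z| <= C)%R ->
  mu.-integrable B (fun z => (v z * psi z)%:E).
Proof.
move=> iv mpsi HC; have mB := @measurable_eball R n 1.
have mv : measurable_fun B v by apply/measurable_EFinP; have /integrableP[] := iv.
apply: (@le_integrable _ _ _ mu B mB _ (fun z => C%:E * (v z)%:E)).
- by apply/measurable_EFinP; exact: measurable_funM.
- move=> z zB; rewrite -EFinM lee_fin !normrM mulrC ler_wpM2r//.
  exact: le_trans (HC _ zB) (ler_norm _).
- exact: integrableZl.
Qed.

(** The distributional derivative of a function of the weighted Sobolev space
does not charge the hyperplane: convergence in $H^{1,a}$ implies convergence in
$L^1$ of the functions and of their gradients, as $|y|^{-a}$ is integrable. *)
Lemma integration_by_parts_H1 (a : R) u U psi : (a < 1)%R ->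
  in_H1_with_gradient a B u U -> smooth_compact_support B psi ->
  \int[mu]_(z in B) (U ord_max z * psi z + u z * partial ord_max psi z)%:E = 0.
Proof.
move=> a1 uH1 cpsi; have [spsi _] := cpsi; have mB := @measurable_eball R n 1.
have Eoo := energy_lty mB uH1.
have [mu' mU H] := (in_H1_energyP _ _ _ mB).1 uH1.
have [Eu EU] := integral_weight_sqr_le a mu' mU.
have iu := integrable_weighted_L2 a1 mu' (le_lt_trans Eu Eoo).
have iU i := integrable_weighted_L2 a1 (mU i) (le_lt_trans (EU i) Eoo).
have [C1 [C10 HC1]] := bounded_on_eball (smooth_continuous spsi).
have [C2 [C20 HC2]] := bounded_on_eball (continuous_partial (i := ord_max) spsi).
have mpsi : measurable_fun B psi by apply: measurable_funTS; exact: measurable_smooth.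
have mdpsi : measurable_fun B (partial ord_max psi).
  by apply: measurable_funTS; exact: measurable_partial.
pose h z := (U ord_max z * psi z + u z * partial ord_max psi z)%R.
have ih : mu.-integrable B (EFin \o h).
  have -> : EFin \o h = (fun z => (U ord_max z * psi z)%:E + (u z * partial ord_max psi z)%:E).
    by apply/funext => z; rewrite -EFinD.
  apply: integrableD => //; first exact: (integrable_mul_bounded (iU ord_max) mpsi HC1).
  exact: (integrable_mul_bounded iu mdpsi HC2).
pose M := fine (\int[mu]_(z in B) (weight (- a) z)%:E).
have ME : \int[mu]_(z in B) (weight (- a) z)%:E = M%:E.
  rewrite fineK// ge0_fin_numE; last first.
    by apply: integral_ge0 => z _; rewrite lee_fin weight_ge0.
  by apply: integral_weight_lty; lra.
have M0 : (0 <= M)%R.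
  by apply: fine_ge0; apply: integral_ge0 => z _; rewrite lee_fin weight_ge0.
have hE : \int[mu]_(z in B) (h z)%:E = (fine (\int[mu]_(z in B) (h z)%:E))%:E.
  by rewrite fineK//; exact: integrable_fin_num ih.
suff small (e : R) : (0 < e)%R ->
    `|\int[mu]_(z in B) (h z)%:E| <= ((C1 + C2) * (M + 1) * e)%:E.
  rewrite -/(h _) hE; congr (_%:E); apply/eqP; rewrite -normr_le0.
  apply/ler_addgt0Pr => e e0; rewrite add0r.
  have k0 : (0 < (C1 + C2) * (M + 1))%R by apply: mulr_gt0; [exact: addr_gt0|lra].
  have := small (e / ((C1 + C2) * (M + 1)))%R; rewrite divr_gt0// => /(_ isT).
  by rewrite hE lee_fin mulrC divfK// gt_eqF.
move=> e0; have [|phi [sphi phioo Hphi]] := H (e ^+ 2)%R; first by rewrite exprn_gt0.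
have mphi : measurable_fun B phi by apply: measurable_funTS; exact: measurable_smooth.
have mg i : measurable_fun B (gradient phi i) by exact: measurable_gradient.
have mdu : measurable_fun B (fun z => u z - phi z)%R by exact: measurable_funB.
have mdU i : measurable_fun B (fun z => U i z - gradient phi i z)%R.
  exact: measurable_funB.
have [Hdu /(_ ord_max) HdU] := integral_weight_sqr_le a mdu mdU.
have {}Hdu := le_trans Hdu (ltW Hphi); have {}HdU := le_trans HdU (ltW Hphi).
have {}Hdu := integral_norm_le e0 mdu Hdu.
have {}HdU := integral_norm_le e0 (mdU ord_max) HdU.
pose g' z := (partial ord_max phi z * psi z + phi z * partial ord_max psi z)%R.
pose g z := ((U ord_max z - gradient phi ord_max z) * psi z +
             (u z - phi z) * partial ord_max psi z)%R.
have ig' : mu.-integrable B (EFin \o g').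
  have [C3 [C30 HC3]] := bounded_on_eball (smooth_continuous sphi).
  have [C4 [C40 HC4]] := bounded_on_eball (continuous_partial (i := ord_max) sphi).
  apply: (@integrable_eball g' (C4 * C1 + C3 * C2)).
    by apply: measurable_funD; apply: measurable_funM => //; exact: (mg ord_max).
  move=> z zB; apply: le_trans (ler_normD _ _) _; rewrite !normrM.
  by apply: lerD; apply: ler_pM => //; [exact: HC4|exact: HC1|exact: HC3|exact: HC2].
have mgg : measurable_fun B g.
  by apply: measurable_funD; apply: measurable_funM.
have hg : \int[mu]_(z in B) (h z)%:E = \int[mu]_(z in B) (g z)%:E.
  rewrite -[LHS]sube0 -(integral_partial_eq0 sphi cpsi) -integralB//.
  by apply: eq_integral => z _; rewrite -EFinB /h /g /gradient; congr (_%:E); ring.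
rewrite hg; apply: le_trans (le_abse_integral _ mB _) _; first exact/measurable_EFinP.
have bound := @ge0_le_integralD _ _ _ mu B mB (fun z => `|g z|%R)
  (fun z => `|U ord_max z - gradient phi ord_max z|)%R (fun z => `|u z - phi z|)%R C1 C2.
apply: le_trans (bound _ _ _ _ _ _ _ _ _) _ => {bound}.
- exact: measurableT_comp.
- exact: measurableT_comp.
- exact: measurableT_comp.
- by move=> z _; exact: normr_ge0.
- by move=> z _; exact: normr_ge0.
- by move=> z _; exact: normr_ge0.
- exact: ltW.
- exact: ltW.
- move=> z zB; apply: le_trans (ler_normD _ _) _; rewrite !normrM.
  apply: lerD; rewrite mulrC ler_wpM2r//; [exact: HC1|exact: HC2].
rewrite ME -EFinM -EFinD in Hdu HdU.
apply: le_trans (leeD (lee_wpmul2l _ HdU) (lee_wpmul2l _ Hdu)) _.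
- by rewrite lee_fin ltW.
- by rewrite lee_fin ltW.
rewrite -!EFinM -EFinD lee_fin le_eqVlt; apply/orP; left; apply/eqP.
by field; rewrite gt_eqF.
Qed.

End integration_by_parts.

(** * Integrability of the right-hand side *)

Section density.
Context {R : realType} (n : nat).
Local Notation mu := (@lebesgue_rV R n.+1).
Local Notation B := (@eball R n 1).
Local Open Scope ereal_scope.

Lemma weighted_indic (b x : R) (D E : set 'rV[R]_n.+1) : (0 <= x)%R ->
  measurable D -> measurable E ->
  \int[mu]_(z in D) (weight b z * (x * \1_E z))%:E = x%:E * weighted_measure b (E `&` D).
Proof.
move=> x0 mD mE; rewrite /weighted_measure setIC integral_mkcondr.
rewrite -(@ge0_integralZl_EFin _ _ _ mu D mD _ _ _ x x0); last first.
- apply: (measurable_restrict _ mE mD).1; apply/measurable_EFinP.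
  by apply: measurable_funTS; exact: measurable_weight.
- by move=> z _; rewrite patchE; case: ifPn => // _; rewrite lee_fin weight_ge0.
apply: eq_integral => z _; rewrite patchE indicE; case: (z \in E).
  by rewrite -EFinM mulr1 mulrC.
by rewrite !mulr0 mule0.
Qed.

Import HBNNSimple.

Lemma integral_density_nnsfun (b : R) (D : set 'rV[R]_n.+1)
    (h : {nnsfun 'rV[R]_n.+1 >-> R}) : measurable D ->
  \int[mu]_(z in D) (weight b z * h z)%:E = \int[weighted_measure b]_(z in D) (h z)%:E.
Proof.
move=> mD.
under [RHS]eq_integral do rewrite fimfunE -fsumEFin//.
rewrite [RHS]ge0_integral_fsum//; last 2 first.
- by move=> r; apply/measurable_EFinP/measurable_funTS/measurableT_comp.
- by move=> r x _; rewrite EFinM nnfun_muleindic_ge0.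
under [LHS]eq_integral.
  move=> x xD; rewrite fimfunE EFinM -fsumEFin// ge0_mule_fsumr; last first.
    by move=> r; rewrite EFinM nnfun_muleindic_ge0.
  over.
rewrite [LHS]ge0_integral_fsum//; last 2 first.
- move=> r; apply/measurable_EFinP/measurable_funTS; apply: measurable_funM.
    exact: measurable_weight.
  exact: measurableT_comp.
- by move=> r x _; rewrite mule_ge0 ?lee_fin ?weight_ge0// -lee_fin EFinM nnfun_muleindic_ge0.
apply: eq_fsbigr => r /[!inE] -[x _ <-].
rewrite integralZl_indic_nnsfun// integral_indic//.
rewrite -weighted_indic//.
Qed.

(** Monotone approximation by simple functions, whose integrals agree by the
very definition of the weighted measure. *)
Lemma integral_density_le (b : R) (D : set 'rV[R]_n.+1) (F : 'rV[R]_n.+1 -> R) :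
  measurable D -> measurable_fun D F -> (forall z, D z -> 0 <= F z)%R ->
  \int[mu]_(z in D) (weight b z * F z)%:E <= \int[weighted_measure b]_(z in D) (F z)%:E.
Proof.
move=> mD mF F0.
have mF' : measurable_fun D (EFin \o F) by exact/measurable_EFinP.
pose h := nnsfun_approx mD mF'.
apply: (@fatou_le _ _ _ mu D (fun k z => (weight b z * h k z)%:E)) => //.
- move=> k; apply/measurable_EFinP/measurable_funTS; apply: measurable_funM => //.
  exact: measurable_weight.
- by move=> k z _; rewrite lee_fin mulr_ge0 ?weight_ge0.
- move=> z Dz; under eq_fun do rewrite EFinM; rewrite EFinM.
  by apply: cvgeZl => //; apply: cvg_nnsfun_approx => // x /F0; rewrite lee_fin.
- move=> k; rewrite integral_density_nnsfun//; apply: ge0_le_integral => //.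
  + by move=> z _; rewrite lee_fin.
  + by apply/measurable_EFinP/measurable_funTS.
  + move=> z Dz; rewrite /h nnsfun_approxE; exact: le_approx.
Qed.

(** On a set of finite measure $L^p \subset L^1$ because $|t| \le 1 + |t|^p$. *)
Lemma Lfun_integral_lty d (T : measurableType d) (nu : {measure set T -> \bar R})
    (D : set T) (p : \bar R) (F : T -> R) : measurable D -> nu D < +oo -> 1 <= p ->
  F \in Lfun nu p -> \int[nu]_(z in D) (`|F z|)%:E < +oo.
Proof.
move=> mD Doo p1 Fp.
have mF : measurable_fun setT F.
  by move: Fp => /sub_Lfun_mfun; rewrite inE.
have mFD : measurable_fun D (fun z => `|F z|)%R.
  by apply: measurable_funTS; exact: measurableT_comp.
case: p p1 Fp => [p| |]// p1 Fp.
  rewrite lee_fin in p1; have p0 : (0 < p)%R by exact: lt_le_trans p1.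
  have /integrableP[_] := Lfun_integrable p1 Fp => ip.
  have mFp : measurable_fun setT (fun z => `|F z| `^ p)%R.
    by apply: (measurableT_comp (measurable_powR p)); exact: measurableT_comp.
  apply: le_lt_trans (@ge0_le_integralD _ _ _ nu D mD _ (cst 1%R)
    (fun z => `|F z| `^ p)%R 1 1 mFD _ _ _ _ _ _ _ _) _ => //.
  - exact: measurable_funTS.
  - move=> z _ /=; rewrite !mul1r; have [F1|F1] := leP `|F z|%R 1%R.
      by rewrite (le_trans F1)// lerDl powR_ge0.
    by apply: ler_wpDl => //; rewrite -[leLHS]powRr1// ler_powR// ltW.
  rewrite !mul1e lte_add_pinfty//.
    by rewrite (@integral_cst _ _ _ nu D mD 1) mul1e.
  apply: le_lt_trans ip; under [leRHS]eq_integral do rewrite gee0_abs ?lee_fin ?powR_ge0//.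
  apply: ge0_subset_integral => //; first exact/measurable_EFinP.
have [nuT|] := ltP 0 (nu setT); last first.
  rewrite measure_le0 => /eqP nuT0.
  have nuD : nu D = 0.
    by apply/eqP; rewrite -measure_le0 -nuT0 le_measure// inE.
  rewrite null_set_integral//.
  by apply/measurable_EFinP.
move: Fp; rewrite inE => /andP[_]; rewrite inE/= /finite_norm unlock /Lnorm nuT.
move=> /ess_sup_inf.ess_supr_bounded[M FM].
apply: (@le_lt_trans _ _ (\int[nu]_(z in D) (cst (`|M|%R%:E) z))).
  apply: ae_ge0_le_integral => //.
  - exact/measurable_EFinP.
  - by move=> z _; rewrite /cst lee_fin.
  - by apply: filterS FM => z FzM _; rewrite lee_fin (le_trans FzM)// ler_norm.
by rewrite integral_cst// lte_mul_pinfty// lee_fin.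
Qed.

End density.

Section source.
Context {R : realType} (n : nat).
Local Notation mu := (@lebesgue_rV R n.+1).
Local Notation B := (@eball R n 1).
Implicit Types z : 'rV[R]_n.+1.
Local Open Scope ereal_scope.

Lemma exponent_ge1 (c : R) (b : bool) (p : \bar R) : (1 <= n)%N -> (0 <= c)%R ->
  (if b then ((2 * (n%:R + 1 + c)) / (n%:R + c + 3))%R%:E <= p else 1 < p) -> 1 <= p.
Proof.
move=> n1 c0; case: b => [|/ltW//]; apply: le_trans; rewrite lee_fin.
have n1' : (1 <= n%:R :> R)%R by rewrite ler1n.
have d0 : (0 < n%:R + c + 3 :> R)%R by clear -c0 n1'; lra.
rewrite ler_pdivlMr//; clear -c0 n1'; lra.
Qed.

(** On the unit ball $|y| \le |y|^b$. *)
Lemma integrable_ycoordM (a b : R) (f : 'rV[R]_n.+1 -> R) : (b <= 1)%R ->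
  measurable_fun B (fun z => ycoord z * f z)%R ->
  measurable_fun B (fun z => weight b z * `|f z|)%R ->
  \int[mu]_(z in B) (weight b z * `|f z|)%:E < +oo ->
  mu.-integrable B (fun z => (ycoord z * f z)%:E).
Proof.
move=> b1 myf mbf bfoo; apply/integrableP; split; first exact/measurable_EFinP.
apply: le_lt_trans bfoo; apply: ae_ge0_le_integral => //.
- exact: measurable_eball.
- by apply: measurableT_comp => //; exact/measurable_EFinP.
- by move=> z _; rewrite lee_fin mulr_ge0 ?weight_ge0.
- exact/measurable_EFinP.
apply: filterS (@ae_ycoord_neq0 R n) => z y0 zB.
rewrite lee_fin normrM ler_wpM2r// (_ : `|ycoord z|%R = weight (b + (1 - b))%R z); last first.
  by rewrite addrC subrK /weight powRr1.
rewrite weightD// -[leRHS]mulr1 ler_wpM2l ?weight_ge0// weight_le1//; clear -b1; lra.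
Qed.

(** For $a > -1$ the weighted measure of the ball is finite, so $|y|^a f$ is
integrable. For $a \le -1$ it is infinite, but $|y|^{a/2} f$ belongs to $L^p$ of
the Lebesgue measure. *)
Lemma integrable_source (a : R) (f : 'rV[R]_n.+1 -> R) : (1 <= n)%N -> (a < 1)%R ->
  standing_integrability a f -> mu.-integrable B (fun z => (ycoord z * f z)%:E).
Proof.
move=> n1 a1; have mB := @measurable_eball R n 1.
rewrite /standing_integrability; case: ifPn => [a0 [p [/= pge fp]]|].
  have p1 : 1 <= p by apply: exponent_ge1 pge => //; rewrite le_max lexx orbT.
  have mf : measurable_fun B f.
    have /sub_Lfun_mfun := fp; rewrite inE /= => mf.
    apply: (eq_measurable_fun (f \_ B)); first by move=> z zB; rewrite patchE zB.
    exact: measurable_funTS.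
  apply: (@integrable_ycoordM a a f); first exact: ltW.
  - by apply: measurable_funM => //; apply: measurable_funTS; exact: measurable_ycoord.
  - by apply: measurable_funM; [exact: measurable_weightS|exact: measurableT_comp].
  apply: le_lt_trans (@integral_density_le R n a B (fun z => `|f z|)%R mB _ _) _ => //.
    exact: measurableT_comp.
  have := Lfun_integral_lty mB _ p1 fp => /(_ (integral_weight_lty n a0)).
  by under eq_integral => z zB do rewrite patchE zB.
rewrite -leNgt => a0 [p [/= pge fp]].
have p1 : 1 <= p.
  by apply: (@exponent_ge1 0 (2 <= n)%N) => //; rewrite !addr0.
have mg : measurable_fun B (fun z => weight (a / 2) z * f z)%R.
  have /sub_Lfun_mfun := fp; rewrite inE /= => mf.
  apply: (eq_measurable_fun ((fun z => weight (a / 2) z * f z)%R \_ B)).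
    by move=> z zB; rewrite patchE zB.
  exact: measurable_funTS.
have mgn : measurable_fun B (fun z => weight (a / 2) z * `|f z|)%R.
  apply: (eq_measurable_fun (fun z => `|weight (a / 2) z * f z|)%R).
    by move=> z _; rewrite normrM ger0_norm ?weight_ge0.
  exact: measurableT_comp.
apply: (@integrable_ycoordM a (a / 2) f) => //.
- clear -a0; lra.
- apply: (eq_measurable_fun (fun z => (ycoord z * weight (- (a / 2)) z) *
      (weight (a / 2) z * f z))%R).
    move=> z _; have [->|y0] := eqVneq (ycoord z) 0%R; first by rewrite !mul0r.
    by rewrite -mulrA (mulrA (weight _ _)) -weightD// addNr /weight powRr0 mul1r.
  apply: measurable_funM => //; apply: measurable_funM; last exact: measurable_weightS.
  by apply: measurable_funTS; exact: measurable_ycoord.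
have := Lfun_integral_lty mB (eball_lty n ltr01) p1 fp.
under eq_integral => z zB do rewrite patchE zB normrM ger0_norm ?weight_ge0//.
by [].
Qed.

End source.

(** * The equation of the quotient *)

Section cutoff.
Context {R : realType} (n : nat) (a d : R).
Hypothesis a1 : a < 1.
Hypothesis d0 : 0 < d.
Local Notation mu := (@lebesgue_rV R n.+1).
Local Notation B := (@eball R n 1).
Implicit Types (psi : 'rV[R]_n.+1 -> R) (z : 'rV[R]_n.+1).

(** The test function $\psi\, y|y|^{-a} e^{-d/y^2}$. Without the exponential it
would in general be neither smooth nor of finite energy. *)
Definition cutoff psi z : R := psi z * flat d 1 (1 - a) (ycoord z).

Lemma smooth_cutoff psi : smooth psi -> smooth (cutoff psi).
Proof. exact: smooth_mul_flat. Qed.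

Lemma cutoff_compact_support psi : smooth_compact_support B psi ->
  smooth_compact_support B (cutoff psi).
Proof.
move=> [spsi [K [cK KB psi0]]]; split; first exact: smooth_cutoff.
by exists K; split=> // z /psi0; rewrite /cutoff => ->; rewrite mul0r.
Qed.

Lemma weight_cutoff psi z : ycoord z != 0 ->
  weight a z * cutoff psi z = eta d z * (ycoord z * psi z).
Proof.
move=> y0; rewrite /cutoff flat_expE// expr1 -/(weight (1 - a) z) -/(eta d z).
rewrite (_ : 1 - a = - a + 1); last exact: addrC.
rewrite sg_weight weightN.
by field; rewrite gt_eqF// weight_gt0.
Qed.

Lemma weight_partial_cutoff psi i z : smooth psi -> ycoord z != 0 ->
  weight a z * partial i (cutoff psi) z = eta d z * (ycoord z * partial i psi z) +
    (i == ord_max)%:R * (((1 - a) * eta d z + teta d z) * psi z).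
Proof.
move=> spsi y0; rewrite /cutoff partial_mul_flat// !flat_expE// expr1.
rewrite -/(weight (1 - a) z) -/(weight (1 - a - 1) z) -/(weight (1 - a - 3) z) -/(eta d z).
rewrite !sg2_weight// (_ : 1 - a - 3 = - a + - 2); last by ring.
rewrite (_ : 1 - a - 1 = - a); last by ring.
rewrite (weightD (- a) (- 2) y0) (weightN 2) weight2 mulrDr.
rewrite [_ * (_ * (Num.sg _ * _ * _))](_ : _ = eta d z * (ycoord z * partial i psi z)).
  congr (_ + _); rewrite /teta weightN.
  by field; rewrite y0 gt_eqF// weight_gt0.
rewrite (_ : 1 - a = - a + 1); last exact: addrC.
rewrite sg_weight weightN.
by field; rewrite gt_eqF// weight_gt0.
Qed.

Lemma weight_flat_bounded (b : R) m c psi : continuous psi -> exists C : R, 0 <= C /\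
  forall z, B z -> weight b z * (psi z * flat d m c (ycoord z)) ^+ 2 <= C.
Proof.
move=> cpsi; have [C1 [C10 HC1]] := bounded_on_eball cpsi.
have [C2 [C20 HC2]] := flat_bound d0 m (c + b / 2).
exists ((C1 * C2) ^+ 2); split=> [|z zB]; first exact: sqr_ge0.
have [y0|y0] := eqVneq (ycoord z) 0; first by rewrite y0 flat0 mulr0 expr0n/= mulr0 sqr_ge0.
have y1 : `|ycoord z| <= 1 by apply: ltW; exact: eball_coord.
rewrite (_ : b = b / 2 + b / 2); last by field.
rewrite weightD// -expr2 -exprMn -[leLHS]real_normK ?num_real//.
rewrite ler_sqr ?nnegrE//; last by rewrite mulr_ge0// ltW.
rewrite mulrCA normrM.
apply: ler_pM => //; first exact: HC1.
have -> : weight (b / 2) z * flat d m c (ycoord z) = flat d m (c + b / 2) (ycoord z).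
  rewrite !flat_expE// -/(weight c z) -/(weight (c + b / 2) z) weightD//; ring.
apply: le_trans (HC2 _ y1) _; rewrite -[leRHS]mulr1 ler_wpM2l//.
by rewrite -[leLHS]real_normK ?num_real// expr_le1.
Qed.

(** The weighted squares of the flat functions are bounded, whatever the weight. *)
Lemma energy_cutoff_lty psi : smooth psi ->
  (energy a B (cutoff psi) (gradient (cutoff psi)) < +oo)%E.
Proof.
move=> spsi; have mB := @measurable_eball R n 1; have sc := smooth_cutoff spsi.
have [C0 [C00 HC0]] := weight_flat_bounded a 1 (1 - a) (smooth_continuous spsi).
have [D HD] : exists D : 'I_n.+1 -> R, forall i z, B z ->
    weight a z * partial i (cutoff psi) z ^+ 2 <= D i.
  have h i : {D : R | forall z, B z -> weight a z * partial i (cutoff psi) z ^+ 2 <= D}.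
    apply: cid.
    have [C1 [C10 HC1]] := weight_flat_bounded a 1 (1 - a) (continuous_partial (i := i) spsi).
    have [C2 [C20 HC2]] := weight_flat_bounded a 2 (1 - a - 1) (smooth_continuous spsi).
    have [C3 [C30 HC3]] := weight_flat_bounded a 2 (1 - a - 3) (smooth_continuous spsi).
    exists (3 * (C1 + (1 - a) ^+ 2 * C2 + (2 * d) ^+ 2 * C3)) => z zB.
    rewrite /cutoff partial_mul_flat//.
    have := HC1 z zB; have := HC2 z zB; have := HC3 z zB.
    set p1 := partial i psi z * _; set f2 := flat d 2 (1 - a - 1) _.
    set f3 := flat d 2 (1 - a - 3) _; set p := psi z => h3 h2 h1.
    have w0 := weight_ge0 a z.
    set k : R := (i == ord_max)%:R; have k2 : k ^+ 2 <= 1.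
      by rewrite /k; case: eqP; rewrite ?expr1n ?expr0n.
    apply: (@le_trans _ _ (weight a z * (3 * (p1 ^+ 2 +
      ((1 - a) ^+ 2 * (p * f2) ^+ 2 + (2 * d) ^+ 2 * (p * f3) ^+ 2))))).
      rewrite ler_wpM2l//.
      apply: (@le_trans _ _ (3 * (p1 ^+ 2 + k ^+ 2 *
        ((1 - a) ^+ 2 * (p * f2) ^+ 2 + (2 * d) ^+ 2 * (p * f3) ^+ 2)))).
        rewrite -subr_ge0 [leRHS](_ : _ = (p1 - k * p * (1 - a) * f2) ^+ 2 +
          (p1 - k * p * (2 * d) * f3) ^+ 2 +
          (k * p * (1 - a) * f2 - k * p * (2 * d) * f3) ^+ 2); last by ring.
        by rewrite addr_ge0 ?sqr_ge0// addr_ge0 ?sqr_ge0.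
      rewrite ler_wpM2l// lerD2l -[leRHS]mul1r ler_wpM2r//.
      by apply: addr_ge0; apply: mulr_ge0; exact: sqr_ge0.
    rewrite [leLHS](_ : _ = 3 * (weight a z * p1 ^+ 2 +
      (1 - a) ^+ 2 * (weight a z * (p * f2) ^+ 2) +
      (2 * d) ^+ 2 * (weight a z * (p * f3) ^+ 2))); last by ring.
    rewrite ler_wpM2l// lerD ?lerD// ler_wpM2l ?sqr_ge0//.
  by exists (fun i => sval (h i)) => i; exact: (svalP (h i)).
apply: (@bounded_integral_lty _ _ _ mu B mB _ (C0 + \sum_i D i)).
- exact: eball_lty.
- apply: measurable_weight_sqjet; first by apply: measurable_funTS; exact: measurable_smooth.
  by move=> i; exact: measurable_gradient.
- move=> z zB; rewrite weight_sqjet_ge0/= /sqjet mulrDr lerD ?HC0//.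
  by rewrite mulr_sumr; apply: ler_sum => i _; exact: HD.
Qed.

Lemma in_H1_cutoff psi : smooth psi -> in_H1 a B (cutoff psi).
Proof.
move=> spsi; have mB := @measurable_eball R n 1; have sc := smooth_cutoff spsi.
exists (gradient (cutoff psi)); apply/(in_H1_energyP _ _ _ mB); split.
- by apply: measurable_funTS; exact: measurable_smooth.
- by move=> i; exact: measurable_gradient.
- move=> e e0; exists (cutoff psi); split=> //; first exact: energy_cutoff_lty.
  rewrite /energy; under eq_integral => z _.
    rewrite /sqjet subrr big1 => [|i _]; last by rewrite subrr expr0n.
    rewrite expr0n addr0 mulr0; over.
  by rewrite integral0 lte_fin.
Qed.

End cutoff.

Section quotient_equation.
Context {R : realType} (n : nat) (a : R).
Hypothesis a1 : a < 1.
Local Notation mu := (@lebesgue_rV R n.+1).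
Local Notation B := (@eball R n 1).
Implicit Types (u f psi : 'rV[R]_n.+1 -> R) (U : 'I_n.+1 -> 'rV[R]_n.+1 -> R)
  (z : 'rV[R]_n.+1).
Local Open Scope ereal_scope.

Lemma integrable_pairing U psi : (forall i, mu.-integrable B (EFin \o U i)) ->
  smooth psi -> mu.-integrable B (fun z => (ycoord z * \sum_i U i z * partial i psi z)%:E).
Proof.
move=> iU spsi; have mB := @measurable_eball R n 1.
have -> : (fun z => (ycoord z * \sum_i U i z * partial i psi z)%:E) =
    (fun z => \sum_i (U i z * (ycoord z * partial i psi z))%:E).
  apply/funext => z; rewrite sumEFin mulr_sumr; congr (_%:E).
  by apply: eq_bigr => i _; rewrite mulrCA.
apply: integrable_sum => // i _.
have [C [C0 HC]] := bounded_on_eball (continuous_partial (i := i) spsi).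
apply: (@integrable_mul_bounded R n (U i) (fun z => ycoord z * partial i psi z)%R C) => //.
  apply: measurable_funM; first exact: measurable_ycoord.
  by apply: measurable_funTS; exact: measurable_partial.
move=> z zB; rewrite normrM -[leRHS]mul1r ler_pM//; last exact: HC.
by apply: ltW; exact: eball_coord.
Qed.

(** The equation tested with the cutoffs, in the limit $d \to 0$. Both sides
pass to the limit by dominated convergence: the weighted gradient of the cutoff
is $e^{-d/y^2} y \nabla\psi$ plus $\psi$ times a bounded function that tends to
$1 - a$, the latter in the last component only. *)
Lemma profile_equation u f U psi :
  in_H1_with_gradient a B u U ->
  mu.-integrable B (fun z => (ycoord z * f z)%:E) ->
  (forall phi, smooth_compact_support B phi -> in_H1 a B phi ->
    mu.-integrable B (fun z => (weight a z * f z * phi z)%:E) /\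
    \int[mu]_(z in B) (weight a z * \sum_i U i z * gradient phi i z)%:E =
    \int[mu]_(z in B) (weight a z * f z * phi z)%:E) ->
  smooth_compact_support B psi ->
  \int[mu]_(z in B) (ycoord z * (\sum_i U i z * partial i psi z) +
    (1 - a) * (U ord_max z * psi z))%:E =
  \int[mu]_(z in B) (ycoord z * f z * psi z)%:E.
Proof.
move=> uH1 iyf sol cpsi; have [spsi _] := cpsi; have mB := @measurable_eball R n 1.
have Eoo := energy_lty mB uH1.
have [mu' mU _] := (in_H1_energyP _ _ _ mB).1 uH1.
have [_ EU] := integral_weight_sqr_le a mu' mU.
have iU i := integrable_weighted_L2 a1 (mU i) (le_lt_trans (EU i) Eoo).
have mpsi : measurable_fun B psi by apply: measurable_funTS; exact: measurable_smooth.
have [C [C0 HC]] := bounded_on_eball (smooth_continuous spsi).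
have iUpsi := integrable_mul_bounded (iU ord_max) mpsi HC.
have iyfpsi := integrable_mul_bounded iyf mpsi HC.
have iS := integrable_pairing iU spsi.
pose d (k : nat) : R := (k.+1%:R^-1)%R.
have d0 k : (0 < d k)%R by rewrite invr_gt0.
pose S z := (ycoord z * \sum_i U i z * partial i psi z)%R.
pose P z := (U ord_max z * psi z)%R.
pose L k z := (weight a z * \sum_i U i z * gradient (cutoff a (d k) psi) i z)%:E.
pose F k z := (weight a z * f z * cutoff a (d k) psi z)%:E.
have solk k : mu.-integrable B (F k) /\
    \int[mu]_(z in B) L k z = \int[mu]_(z in B) F k z.
  apply: sol; first exact: cutoff_compact_support.
  exact: in_H1_cutoff.
have LE k z : ycoord z != 0%R ->
    L k z = (eta (d k) z * S z + ((1 - a) * eta (d k) z + teta (d k) z) * P z)%:E.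
  move=> y0; rewrite /L /S /P mulr_sumr; congr (_%:E).
  under eq_bigr do rewrite mulrCA /gradient weight_partial_cutoff// mulrDr.
  rewrite big_split/= !mulr_sumr; congr (_ + _)%R.
    by apply: eq_bigr => i _; ring.
  rewrite (bigD1 ord_max)//= eqxx (_ : true%:R = 1%R :> R)// big1 ?addr0; first by ring.
  by move=> i /negbTE ->; rewrite mul0r mulr0.
have FE k z : ycoord z != 0%R -> F k z = (eta (d k) z * (ycoord z * f z * psi z))%:E.
  move=> y0; rewrite /F mulrAC weight_cutoff//; congr (_%:E); ring.
have cL : {ae mu, forall z, B z -> L ^~ z @ \oo --> (S z + (1 - a) * P z)%:E}.
  apply: filterS (@ae_ycoord_neq0 R n) => z y0 _.
  under eq_fun do rewrite LE//.
  apply: cvg_EFin; first by near=> k.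
  rewrite -[X in _ --> X](_ : 1 * S z + ((1 - a) * 1 + 0) * P z = _)%R; last by ring.
  apply: cvgD; apply: cvgM; [exact: cvg_eta|exact: cvg_cst| |exact: cvg_cst].
  by apply: cvgD; [apply: cvgM; [exact: cvg_cst|exact: cvg_eta]|exact: cvg_teta].
have cF : {ae mu, forall z, B z -> F ^~ z @ \oo --> (ycoord z * f z * psi z)%:E}.
  apply: filterS (@ae_ycoord_neq0 R n) => z y0 _.
  under eq_fun do rewrite FE//.
  apply: cvg_EFin; first by near=> k.
  rewrite -[X in _ --> X]mul1r.
  by apply: cvgM; [exact: cvg_eta|exact: cvg_cst].
have mS : measurable_fun B S by apply/measurable_EFinP; have /integrableP[] := iS.
have mP : measurable_fun B P by exact: measurable_funM.
have [||||_ _ lim1] := @dominated_convergence _ _ _ mu B mB L _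
  (fun z => `|(S z)%:E| + (3 - a)%:E * `|(P z)%:E|) _ _ cL.
- move=> k; apply/measurable_EFinP; apply: measurable_funM; first exact: measurable_weightS.
  apply: measurable_sum => i; apply: measurable_funM; first exact: mU.
  by apply: measurable_gradient; exact: smooth_cutoff.
- by apply/measurable_EFinP; apply: measurable_funD => //; exact: measurable_funM.
- apply: integrableD => //; first exact: integrable_abse.
  by apply: integrableZl => //; exact: integrable_abse.
- apply: filterS (@ae_ycoord_neq0 R n) => z y0 k _; rewrite LE//=.
  have e0 := eta_ge0 (d k) z; have e1 := eta_le1 z (ltW (d0 k)).
  have /andP[t0 t2] := teta_bound z (ltW (d0 k)).
  rewrite -EFinM -EFinD lee_fin; apply: le_trans (ler_normD _ _) _; rewrite !normrM.
  rewrite lerD//; first by rewrite -[leRHS]mul1r ler_wpM2r// ger0_norm.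
  rewrite ler_wpM2r// ger0_norm; first by have := a1; clear -e0 e1 t0 t2; nra.
  by rewrite addr_ge0// mulr_ge0// subr_ge0 ltW.
have [||||_ _ lim2] := @dominated_convergence _ _ _ mu B mB F _
  (fun z => `|(ycoord z * f z * psi z)%:E|) _ _ cF.
- by move=> k; have /integrableP[] := (solk k).1.
- by have /integrableP[] := iyfpsi.
- exact: integrable_abse.
- apply: filterS (@ae_ycoord_neq0 R n) => z y0 k _; rewrite FE//=.
  have e0 := eta_ge0 (d k) z; have e1 := eta_le1 z (ltW (d0 k)).
  by rewrite lee_fin normrM -[leRHS]mul1r ler_wpM2r// ger0_norm.
have E : [sequence \int[mu]_(x in B) L k x]_k = [sequence \int[mu]_(x in B) F k x]_k.
  by apply/funext => k; exact: (solk k).2.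
rewrite E in lim1; exact: (cvg_unique _ lim1 lim2).
Unshelve. all: by end_near. Qed.

Lemma weight_quot (v : R) z :
  (weight (2 - a) z * (v / odd_profile a z) = ycoord z * v)%R.
Proof.
have [y0|y0] := eqVneq (ycoord z) 0%R.
  have h : (0 < 2 - a)%R by rewrite subr_gt0 (lt_trans a1)// ltr1n.
  by rewrite y0 mul0r weight_y0 ?mul0r// gt_eqF.
rewrite odd_profileV// (_ : a - 2 = - (2 - a))%R; last by ring.
by rewrite weightN; field; rewrite gt_eqF// weight_gt0.
Qed.

(** Integrating by parts turns the term $(1 - a) \psi\, \partial_y u$ left by the
profile into $- (1 - a) u\, \partial_y \psi$, which is what the gradient of the
quotient contains. *)
Lemma quot_equation u f U psi :
  in_H1_with_gradient a B u U ->
  mu.-integrable B (fun z => (ycoord z * f z)%:E) ->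
  (forall phi, smooth_compact_support B phi -> in_H1 a B phi ->
    mu.-integrable B (fun z => (weight a z * f z * phi z)%:E) /\
    \int[mu]_(z in B) (weight a z * \sum_i U i z * gradient phi i z)%:E =
    \int[mu]_(z in B) (weight a z * f z * phi z)%:E) ->
  smooth_compact_support B psi ->
  mu.-integrable B (fun z => (weight (2 - a) z * (f z / odd_profile a z) * psi z)%:E) /\
  \int[mu]_(z in B) (weight (2 - a) z *
    \sum_i quot_gradient a u U i z * gradient psi i z)%:E =
  \int[mu]_(z in B) (weight (2 - a) z * (f z / odd_profile a z) * psi z)%:E.
Proof.
move=> uH1 iyf sol cpsi; have [spsi _] := cpsi; have mB := @measurable_eball R n 1.
have Eoo := energy_lty mB uH1.
have [mu' mU _] := (in_H1_energyP _ _ _ mB).1 uH1.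
have [Eu EU] := integral_weight_sqr_le a mu' mU.
have iu := integrable_weighted_L2 a1 mu' (le_lt_trans Eu Eoo).
have iU i := integrable_weighted_L2 a1 (mU i) (le_lt_trans (EU i) Eoo).
have mpsi : measurable_fun B psi by apply: measurable_funTS; exact: measurable_smooth.
have mdpsi i : measurable_fun B (partial i psi).
  by apply: measurable_funTS; exact: measurable_partial.
have [C [C0 HC]] := bounded_on_eball (smooth_continuous spsi).
have [C' [C'0 HC']] := bounded_on_eball (continuous_partial (i := ord_max) spsi).
have iUpsi := integrable_mul_bounded (iU ord_max) mpsi HC.
have iudpsi := integrable_mul_bounded iu (mdpsi ord_max) HC'.
have iS := integrable_pairing iU spsi.
have fE z : ((weight (2 - a) z * (f z / odd_profile a z) * psi z)%:E =
    (ycoord z * f z * psi z)%:E) by rewrite weight_quot.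
split; first by under eq_fun do rewrite fE; exact: (integrable_mul_bounded iyf mpsi HC).
under [RHS]eq_integral do rewrite fE.
rewrite -(profile_equation uH1 iyf sol cpsi).
pose S z := (ycoord z * (\sum_i U i z * partial i psi z))%R.
pose P z := (U ord_max z * psi z)%R.
pose Q z := (u z * partial ord_max psi z)%R.
have mS : measurable_fun B S by apply/measurable_EFinP; have /integrableP[] := iS.
have mP : measurable_fun B P by exact: measurable_funM.
have mQ : measurable_fun B Q by exact: measurable_funM.
transitivity (\int[mu]_(z in B) (S z - (1 - a) * Q z)%:E).
  apply: ae_eq_integral => //.
  - apply/measurable_EFinP; apply: measurable_funM; first exact: measurable_weightS.
    apply: measurable_sum => i; apply: measurable_funM; last exact: mdpsi.
    exact: measurable_quot_gradient.
  - by apply/measurable_EFinP; apply: measurable_funB => //; exact: measurable_funM.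
  apply: filterS (@ae_ycoord_neq0 R n) => z y0 _; congr (_%:E).
  rewrite /S !mulr_sumr /quot_gradient /gradient.
  under eq_bigr do rewrite mulrBl mulrBr (mulrA (weight _ _)) weight_quot.
  rewrite sumrB; congr (_ - _)%R; first by apply: eq_bigr => i _; rewrite mulrA.
  rewrite (bigD1 ord_max)//= eqxx (_ : true%:R = 1%R :> R)// big1 ?addr0; last first.
    by move=> i /negbTE ->; rewrite !mul0r mulr0.
  rewrite /Q (_ : a - 2 = - (2 - a))%R; last by ring.
  by rewrite weightN; field; rewrite gt_eqF// weight_gt0.
have iSP : mu.-integrable B (fun z => (S z + (1 - a) * P z)%:E).
  under eq_fun do rewrite EFinD (EFinM (1 - a)).
  by apply: integrableD => //; exact: integrableZl.
have iPQ : mu.-integrable B (fun z => (P z + Q z)%:E).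
  by under eq_fun do rewrite EFinD; exact: integrableD.
have ibp : \int[mu]_(z in B) (P z + Q z)%:E = 0 := integration_by_parts_H1 a1 uH1 cpsi.
transitivity (\int[mu]_(z in B) ((S z + (1 - a) * P z)%:E - (1 - a)%:E * (P z + Q z)%:E)).
  by apply: eq_integral => z _; rewrite -EFinM -EFinB; congr (_%:E); ring.
rewrite integralB//; last exact: integrableZl.
by rewrite integralZl// ibp mule0 sube0.
Qed.

End quotient_equation.

(** * The proposition *)

Section restriction.
Context {R : realType} (n : nat).
Implicit Types z : 'rV[R]_n.+1.

Lemma odd_profile_yflip (a : R) z : odd_profile a (yflip z) = - odd_profile a z.
Proof. by rewrite /odd_profile ycoord_yflip normrN mulNr. Qed.

Lemma integral_support d (T : measurableType d) (mu : {measure set T -> \bar R})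
    (D D' : set T) (h : T -> \bar R) : D' `<=` D ->
  (forall x, D x -> ~ D' x -> h x = 0%E) ->
  (\int[mu]_(x in D') h x = \int[mu]_(x in D) h x)%E.
Proof.
move=> sub h0; rewrite integral_mkcond [RHS]integral_mkcond.
apply: eq_integral => x _; rewrite !patchE.
have [xD'|] := boolP (x \in D'); first by rewrite mem_set//; apply/sub/set_mem.
by rewrite notin_setE => xD'; case: ifPn => // /set_mem xD; rewrite h0.
Qed.

End restriction.

Theorem proposition1p1 (R : realType) (n : nat) (a : R)
    (u f : 'rV[R]_n.+1 -> R) (n_ge1 : (1 <= n)%N) (a_lt1 : a < 1)
    (f_int : standing_integrability a f)
    (u_H1 : in_H1 a (eball 1) u)
    (u_odd : odd_in_y (eball 1) u)
    (u_sol : energy_solution a (eball 1) u f)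
    (r : R) (r_gt0 : 0 < r) (r_lt1 : r < 1) :
  let w := fun z => u z / odd_profile a z in
  let fbar := fun z => f z / odd_profile a z in
  [/\ in_H1 (2 - a) (eball r) w,
      even_in_y (eball r) w &
      energy_solution (2 - a) (eball r) w fbar].
Proof.
move=> w fbar; have [U uH1 sol] := u_sol.
have mB := @measurable_eball R n 1; have mBr := @measurable_eball R n r.
have sub : eball r `<=` (eball 1 : set 'rV[R]_n.+1) by exact: (sub_eball (ltW r_lt1)).
have wH1 := in_H1_quot a_lt1 uH1 (hardy a_lt1 uH1 u_odd).
have wrH1 := in_H1_with_gradientS mB mBr sub wH1.
split; first by exists (quot_gradient a u U).
  apply: filterS u_odd => z uz zr; rewrite /w odd_profile_yflip uz; last exact: sub.
  by rewrite invrN mulrNN.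
exists (quot_gradient a u U); first exact: wrH1.
move=> phi [sphi [K [cK Kr phi0]]] _.
have cphi : smooth_compact_support (eball 1) phi.
  by split=> //; exists K; split=> //; exact: subset_trans sub.
have [ifbar eqB] := quot_equation a_lt1 uH1 (integrable_source n_ge1 a_lt1 f_int) sol cphi.
split; first exact: (integrableS mB mBr sub ifbar).
have clK : closed K by apply: compact_closed => //; exact: norm_hausdorff.
rewrite (integral_support _ sub); last first.
  move=> z _ zr; rewrite big1 ?mulr0// => i _.
  by rewrite /gradient (partial_eq0_off_support i clK phi0) ?mulr0// => /Kr.
rewrite eqB (integral_support _ sub)// => z _ zr.
by rewrite phi0 ?mulr0// => /Kr.
Qed.
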